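(* Let $1\leq p<2$. Let $\gamma:[0,1]\rightarrow\mathbb{R}^{2}$ be a continuous closed curve with finite $p$-variation. Let $\{\mathbf{e}_{1},\mathbf{e}_{2}\}$ be the standard basis of $\mathbb{R}^{2}$, ordered by $\mathbf{e}_{1}<\mathbf{e}_{2}$. Then: 1. For each $(n,k)\in\mathbb{N}\times\mathbb{N}$ (with $n,k\ge 1$), $\mathbf{e}_{1}^{\otimes n}\otimes\mathbf{e}_{2}^{\otimes k}$ is a Lyndon word in the free Lie algebra generated by $\{\mathbf{e}_{1},\mathbf{e}_{2}\}$ with respect to the tensor product. 2. For integers $n,k\ge 0$, let $\mathcal{P}_{\mathbf{e}_{1}^{\otimes(n+1)}\otimes\mathbf{e}_{2}^{\otimes(k+1)}}$ be the Lyndon element corresponding to the Lyndon word $\mathbf{e}_{1}^{\otimes(n+1)}\otimes\mathbf{e}_{2}^{\otimes(k+1)}$. Then for all integers $n,k\geq 0$ and all $N\geq n+k+2$, the coefficient of $\mathcal{P}_{\mathbf{e}_{1}^{\otimes(n+1)}\otimes\mathbf{e}_{2}^{\otimes(k+1)}}$ in the Lyndon basis expansion of the truncated log signature $\pi_{N}(\log S(\gamma)_{0,1})$ is $$(-1)^{k}\int_{\mathbb{R}^{2}}\frac{x^{n}y^{k}}{n!\,k!}\,\eta\big(\gamma-\gamma_{0},(x,y)\big)\,\mathrm{d}x\,\mathrm{d}y,$$ where $\eta(\gamma-\gamma_{0},(x,y))$ is the winding number of the curve $\gamma-\gamma_{0}$ around the point $x\mathbf{e}_{1}+y\mathbf{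e}_{2}$.
   Context: Variation: a continuous $\gamma:[0,1]\to\mathbb{R}^2$ has finite $p$-variation if $\sup\sum_k|\gamma_{t_{k+1}}-\gamma_{t_k}|^p<\infty$, the supremum being over all finite partitions of $[0,1]$. The curve $\gamma$ is closed if $\gamma_0=\gamma_1$. Signature: $T((\mathbb{R}^2))$ is the algebra of sequences $(a_0,a_1,a_2,\ldots)$, $a_i\in(\mathbb{R}^2)^{\otimes i}$, with componentwise addition and product $\otimes$ whose $n$-th component is $\sum_{i=0}^n a_i\otimes b_{n-i}$; $\pi_N$ denotes truncation to $(a_0,\ldots,a_N)$. For $\gamma$ of finite $p$-variation, $1\le p<2$, the signature is $S(\gamma)_{0,1}=1+\sum_{n\ge1}\int_{0<t_1<\cdots<t_n<1}\mathrm{d}\gamma_{t_1}\otimes\cdots\otimes\mathrm{d}\gamma_{t_n}$ (Young integrals), an element of $T((\mathbb{R}^2))$. $\log$ is the formal logarithm in $T((\mathbb{R}^2))$; $\log S(\gamma)_{0,1}$ is a Lie series. Lyndon basis: a word is a monomial in $\mathbf{e}_1,\mathbf{e}_2$ under $\otimes$; $1$ is the empty word. Words are ordered lexicographically: $\mathbf{e}_1<\mathbf{e}_2$; $\mathbf{u}<\mathbf{u}\otimes\mathbf{x}$ for nonempty $\mathbf{x}$; $\mathbf{u}\otimes\mathbf{e}_1\otimes\mathbf{x}<\mathbf{u}\otimes\mathbf{e}_2\otimes\mathbf{x}'$ for all words $\mathbf{u},\mathbf{x},\mathbf{x}'$. A word $\mathbf{w}$ is Lyndon if $\mathbf{w}\in\{\mathbf{e}_1,\mathbf{e}_2\}$,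 or (for $\mathbf{w}$ of length at least 2) $\mathbf{w}<\mathbf{v}$ whenever $\mathbf{w}=\mathbf{u}\otimes\mathbf{v}$ with $\mathbf{u},\mathbf{v}\ne1$. The standard factorisation of a Lyndon word $\mathbf{w}\neq \mathbf{e}_1,\mathbf{e}_2$ is $\mathbf{w}=\mathbf{u}\otimes\mathbf{v}$ where $\mathbf{v}$ is the smallest nonempty Lyndon word such that $\mathbf{w}=\mathbf{u}\otimes\mathbf{v}$ for some nonempty word $\mathbf{u}$. Lyndon elements are defined by $\mathcal{P}_{\mathbf{e}_i}=\mathbf{e}_i$ and $\mathcal{P}_{\mathbf{w}}=[\mathcal{P}_{\mathbf{u}},\mathcal{P}_{\mathbf{v}}]$ for the standard factorisation $\mathbf{w}=\mathbf{u}\otimes\mathbf{v}$, where $[a,b]=a\otimes b-b\otimes a$. The Lyndon elements form a basis (the Lyndon basis) of the Lie series generated by $\mathbf{e}_1,\mathbf{e}_2$ (after truncation, those of degree at most $N$ form a basis of the truncated Lie series). Winding number: for a continuous closed curve $\gamma$ and $z\in\mathbb{R}^2\setminus\gamma[0,1]$, $\eta(\gamma,z)=\frac1{2\pi}(\tilde g(1)-\tilde g(0))$, where $\tilde g:[0,1]\to\mathbb{R}$ is a continuous function with $e^{i\tilde g(s)}=(\gamma_s-z)/\|\gamma_s-z\|$ (identifying $\mathbb{R}^2$ with $\mathbb{C}$). The image of a curve of finite $p$-variation with $p<2$ is Lebesgue-null, so $\eta(\gamma,\cdot)$ is defined almost everywhere. *)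

(* Defs.v *)
From mathcomp Require Export all_boot all_order all_algebra.
From mathcomp Require Export all_classical all_reals all_analysis.

Set Implicit Arguments.
Unset Strict Implicit.
Unset Printing Implicit Defensive.

Import Order.TTheory GRing.Theory Num.Theory.
Import numFieldNormedType.Exports.

Local Open Scope classical_set_scope.
Local Open Scope ring_scope.

(** Words in the letters e1 < e2; concatenation is the tensor product. *)

Definition word := seq 'I_2.

Definition e1 : 'I_2 := ord0.
Definition e2 : 'I_2 := ord_max.

Definition word_le (u v : word) : bool :=
  (Order.le (u : seqlexi 'I_2) (v : seqlexi 'I_2)).
Definition word_lt (u v : word) : bool :=
  (Order.lt (u : seqlexi 'I_2) (v : seqlexi 'I_2)).

(* The [drop i w] with 0 < i < size w are the proper nonempty right factors. *)
Definition lyndon (w : word) : bool :=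
  (w != [::]) && all (fun i => word_lt w (drop i w)) (iota 1 (size w).-1).

Lemma lyndonP (w : word) :
  reflect (w = [:: e1] \/ w = [:: e2] \/
           ((2 <= size w)%N /\
            forall u v : word, w = u ++ v -> u <> [::] -> v <> [::] ->
              word_lt w v))
          (lyndon w).
Proof.
have I2 (x : 'I_2) : x = e1 \/ x = e2.
  by case: x => -[|[|//]] ?; [left|right]; apply/val_inj.
apply: (iffP idP) => [/andP[w0 /allP wl]|].
  case: w w0 wl => [//|x [|y w]] _ wl.
    by case: (I2 x) => ->; [left|right; left].
  right; right; split=> // u v wuv u0 v0.
  have -> : v = drop (size u) (x :: y :: w) by rewrite wuv drop_size_cat.
  apply: wl; rewrite mem_iota.
  have -> : (1 + (size (x :: y :: w)).-1 = size u + size v)%N.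
    by rewrite -size_cat -wuv.
  by case: u u0 {wuv} => // a u _; case: v v0 => // b v _ /=; rewrite addnS ltnS leq_addr.
case=> [->//|[->//|[sw wl]]].
have w0 : w != [::] by case: w sw {wl}.
rewrite /lyndon w0 /=; apply/allP => i; rewrite mem_iota => /andP[i0 iw].
have {}iw : (i < size w)%N by move: iw; rewrite add1n prednK// (ltn_trans _ sw).
apply: (wl (take i w)) => [|/(congr1 size)|/(congr1 size)].
- by rewrite cat_take_drop.
- by rewrite size_takel ?(ltnW iw)//= => i00; rewrite i00 in i0.
- by rewrite size_drop /= => /eqP; rewrite subn_eq0 leqNgt iw.
Qed.

Definition lyndon_right_factors (w : word) : seq word :=
  [seq v <- [seq drop i w | i <- iota 1 (size w).-1] | lyndon v].

Definition std_right (w : word) : word :=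
  head [::] (sort word_le (lyndon_right_factors w)).
Definition std_left (w : word) : word :=
  take (size w - size (std_right w)) w.

Lemma mem_lyndon_right_factors (w v : word) :
  reflect (lyndon v /\ exists2 u : word, u <> [::] & w = u ++ v)
          (v \in lyndon_right_factors w).
Proof.
rewrite mem_filter; apply: (iffP andP) => -[lv].
  move=> /mapP[i]; rewrite mem_iota => /andP[i0 iw] vE; split=> //.
  exists (take i w); last by rewrite vE cat_take_drop.
  case: (w) iw => [|x t _]; first by rewrite addn0 ltnNge i0.
  by case: i i0 {vE}.
move=> [u u0 wuv]; split=> //; apply/mapP; exists (size u).
  have v0 : v != [::] by case/andP: lv.
  rewrite mem_iota wuv size_cat; case: u u0 {wuv} => // a u _.
  by case: v v0 {lv} => // b v _ /=; rewrite addnS ltnS leq_addr.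
by rewrite wuv drop_size_cat.
Qed.

Lemma std_factorisationP (w : word) : (2 <= size w)%N ->
  [/\ w = std_left w ++ std_right w, std_left w <> [::], lyndon (std_right w)
    & forall u v : word, w = u ++ v -> u <> [::] -> lyndon v ->
        word_le (std_right w) v].
Proof.
move=> sw; set s := lyndon_right_factors w.
have s_last : drop (size w).-1 w \in s.
  apply/mem_lyndon_right_factors; split.
    have : size (drop (size w).-1 w) = 1%N.
      by rewrite size_drop; case: (w) sw => //= x t _; rewrite subSnn.
    by case: (drop _ _) => [//|x [|//]] _.
  exists (take (size w).-1 w); last by rewrite cat_take_drop.
  by case: (w) sw => [//|x [|y t]].
have sorted_s : sorted word_le (sort word_le s).
  by apply: sort_sorted => u v; exact: (@le_total _ (seqlexi 'I_2)).
have le_tr : transitive word_le.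
  by move=> a b c; exact: (@le_trans _ (seqlexi 'I_2)).
have rs : std_right w \in s.
  rewrite -(mem_sort word_le) /std_right -/s.
  have : sort word_le s != [::].
    by rewrite -size_eq0 size_sort size_eq0; case: (s) s_last.
  by case: (sort _ _) => [//|x t] _; rewrite mem_head.
have /mem_lyndon_right_factors [ls [u u0 wu]] := rs.
have lu : std_left w = u.
  have := congr1 size wu; rewrite size_cat => sz.
  by rewrite /std_left sz addnK [X in take _ X]wu take_size_cat.
split; rewrite ?lu// => u' v wuv u'0 lv.
have : v \in sort word_le s.
  by rewrite mem_sort; apply/mem_lyndon_right_factors; split=> //; exists u'.
rewrite /std_right -/s; case: (sort _ _) sorted_s => [//|x t] /= pt.
rewrite inE => /predU1P[->|vt]; first exact: (@le_refl _ (seqlexi 'I_2)).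
by move: pt; rewrite path_sortedE// => /andP[/allP/(_ _ vt)].
Qed.

(** An element of T((R^2)) is given by its coordinates in the basis of words;
    the component of degree n is its restriction to the words of length n. *)

Definition tensor (R : realType) := word -> R.

Section tensor_algebra.
Variable R : realType.
Implicit Types (a b : tensor R) (u v w : word).

Definition tword u : tensor R := fun w => (w == u)%:R.

Definition tone : tensor R := tword [::].

Definition tsub a b : tensor R := fun w => a w - b w.

Definition tmul a b : tensor R :=
  fun w => \sum_(i < (size w).+1) a (take i w) * b (drop i w).

Definition texp a (m : nat) : tensor R := iter m (tmul a) tone.

Definition tbracket a b : tensor R := tsub (tmul a b) (tmul b a).

Definition ttrunc (N : nat) a : tensor R :=
  fun w => if (size w <= N)%N then a w else 0.

(* Meant for a with constant term 1: then (a - 1)^m vanishes on words of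
   length < m, so the logarithmic series is finite on each word. *)
Definition tlog a : tensor R := fun w =>
  \sum_(1 <= m < (size w).+1)
    (-1) ^+ m.-1 / m%:R * texp (tsub a tone) m w.

(* The first argument is fuel; see lyndon_elt1 and lyndon_eltE below. *)
Fixpoint lyndon_elt_rec (d : nat) (w : word) : tensor R :=
  if d is d'.+1 then
    if (size w <= 1)%N then tword w
    else tbracket (lyndon_elt_rec d' (std_left w))
                  (lyndon_elt_rec d' (std_right w))
  else tword w.

Definition lyndon_elt (w : word) : tensor R := lyndon_elt_rec (size w) w.

Lemma lyndon_elt1 (i : 'I_2) : lyndon_elt [:: i] = tword [:: i].
Proof. by []. Qed.

Lemma lyndon_elt_recE (d : nat) (w : word) : (size w <= d)%N ->
  lyndon_elt_rec d w = lyndon_elt w.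
Proof.
suff H : forall n (w : word) d d', (size w <= n)%N -> (size w <= d)%N ->
    (size w <= d')%N -> lyndon_elt_rec d w = lyndon_elt_rec d' w.
  by move=> wd; exact: (H (size w)).
elim=> [|n IH] {}w {}d d' wn wd wd'.
  by case: w wn {wd wd'} => // _; case: d; case: d'.
have [w1|w1] := leqP (size w) 1%N; first by case: d d' {wd wd'} => [|?] [|?] //=; rewrite w1.
have [wE l0 /andP[r0 _] _] := std_factorisationP w1.
case: d wd => [|d] wd; first by rewrite leqNgt (ltn_trans _ w1) in wd.
case: d' wd' => [|d'] wd'; first by rewrite leqNgt (ltn_trans _ w1) in wd'.
have sz : (size (std_left w) + size (std_right w) = size w)%N.
  by rewrite -size_cat -wE.
have l1 : (0 < size (std_left w))%N by case: (std_left w) l0.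
have r1 : (0 < size (std_right w))%N by case: (std_right w) r0.
have bl k : (size w <= k.+1)%N -> (size (std_left w) <= k)%N.
  by rewrite -sz => H; rewrite -ltnS (leq_trans _ H)// -addn1 leq_add2l.
have br k : (size w <= k.+1)%N -> (size (std_right w) <= k)%N.
  by rewrite -sz => H; rewrite -ltnS (leq_trans _ H)// -add1n leq_add2r.
rewrite /= leqNgt w1 /=.
by rewrite (IH _ d d' (bl _ wn) (bl _ wd) (bl _ wd'))
           (IH _ d d' (br _ wn) (br _ wd) (br _ wd')).
Qed.

Lemma lyndon_eltE (w : word) : (2 <= size w)%N ->
  lyndon_elt w = tbracket (lyndon_elt (std_left w)) (lyndon_elt (std_right w)).
Proof.
move=> w1; have [wE l0 /andP[r0 _] _] := std_factorisationP w1.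
have sz : (size (std_left w) + size (std_right w) = size w)%N.
  by rewrite -size_cat -wE.
have l1 : (0 < size (std_left w))%N by case: (std_left w) l0.
have r1 : (0 < size (std_right w))%N by case: (std_right w) r0.
rewrite {1}/lyndon_elt; case E : (size w) w1 => [//|d] w1 /=.
rewrite E leqNgt w1 /= !lyndon_elt_recE//.
  by rewrite -ltnS -E -sz -add1n leq_add2r.
by rewrite -ltnS -E -sz -addn1 leq_add2l.
Qed.

Definition lyndon_expansion (N : nat) a (c : word -> R) : Prop :=
  forall u, a u =
    \sum_(m < N.+1) \sum_(w : m.-tuple 'I_2 | lyndon w) c w * lyndon_elt w u.

(* Carries its own well-definedness: the expansion of a in the Lyndon elements
   of degree at most N exists and is unique, and its coefficient at w is r. *)
Definition lyndon_coef (N : nat) a (w : word) (r : R) : Prop :=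
  exists c : word -> R,
    [/\ lyndon_expansion N a c,
        forall c' : word -> R, lyndon_expansion N a c' ->
          forall v, lyndon v -> (size v <= N)%N -> c' v = c v
      & c w = r].

End tensor_algebra.

(** Curves in R^2 are functions R -> R * R considered on [0, 1] only. *)

Section curves.
Variable R : realType.
Implicit Types (f g : R -> R) (gamma : R -> R * R) (z : R * R).

(* The norm of the library on R * R is the sup norm. *)
Definition enorm (z : R * R) : R := Num.sqrt (z.1 ^+ 2 + z.2 ^+ 2).

Definition finite_pvariation (p : R) gamma : Prop :=
  exists M : R, forall s : seq R, itv_partition 0 1 s ->
    \sum_(0 <= k < size s)
      enorm (gamma (nth 1 (0 :: s) k.+1) - gamma (nth 1 (0 :: s) k)) `^ p <= M.

(* l is the limit of the Riemann-Stieltjes sums of f against g over [a, b], for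
   arbitrary tags, as the mesh tends to 0. *)
Definition is_young_integral (a b : R) f g (l : R) : Prop :=
  forall e : R, 0 < e -> exists2 d : R, 0 < d &
    forall (s : seq R) (tag : nat -> R),
      let t := nth b (a :: s) in
      itv_partition a b s ->
      (forall k, (k < size s)%N -> t k.+1 - t k < d) ->
      (forall k, (k < size s)%N -> t k <= tag k <= t k.+1) ->
      `| \sum_(0 <= k < size s) f (tag k) * (g (t k.+1) - g (t k)) - l | < e.

Definition young_integral (a b : R) f g : R :=
  xget 0 [set l | is_young_integral a b f g l].

Definition coordinate gamma (i : 'I_2) : R -> R :=
  fun t => if i == e1 then (gamma t).1 else (gamma t).2.

(* The iterated integral over 0 < t_1 < ... < t_n < t of a word given in
   reversed order: the head of the list carries the outermost variable t_n. *)
Fixpoint iterated_integral gamma (w : word) : R -> R :=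
  if w is i :: w' then
    fun t => young_integral 0 t (iterated_integral gamma w') (coordinate gamma i)
  else fun=> 1.

Definition signature gamma : tensor R :=
  fun w => iterated_integral gamma (rev w) 1.

(* As division by 0 gives 0, there is no angle function when z is on the
   curve. *)
Definition is_winding_number gamma z (r : R) : Prop :=
  exists g : R -> R,
    [/\ {within `[0, 1], continuous g},
        forall s, s \in `[0, 1] ->
          (cos (g s) = (gamma s - z).1 / enorm (gamma s - z)) /\
          (sin (g s) = (gamma s - z).2 / enorm (gamma s - z))
      & r = (g 1 - g 0) / (2 * pi)].

(* Set to 0 on the image of the curve. *)
Definition winding_number gamma z : R :=
  xget 0 [set r | is_winding_number gamma z r].

End curves.

(* Main.v *)
(** The signature satisfies the shuffle relations, so its powers [S^m] do too; as
    [S^m] is polynomial in [m] on every word, with linear coefficient [log S],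
    the logarithm vanishes on proper shuffles.  Every non-Lyndon word is the
    largest word of a proper shuffle, so such a tensor is determined by its values
    on Lyndon words, and the triangularity [P_w = w + larger words] gives its
    expansion.  As [e1^(n+1) e2^(k+1)] is the smallest rearrangement of its
    letters, its coefficient is the value of [log S] there, which is that of [S]
    because the curve is closed; this is the Young integral
    [(-1)^k \int x^(n+1)/(n+1)! y^k/k! dy].

    Formally [eta(z) = \int 1_{z1 < x} d(1_{z2 <= y})]: off the curve, the Riemann
    sums of this integral, which are winding numbers of staircases, are eventually
    equal to [eta(z)].  Tested against a bounded function, the increments of these
    sums are almost additive with an error [|dx| |dy|], exactly like those of a
    Young integral, so the sewing lemma bounds the L^1 distance between two Riemann
    sums.  Fatou's lemma then gives L^1 convergence to [eta], and the moments of
    the staircases are Riemann sums of the Young integral above. *)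

Require Import Defs.
From mathcomp Require Import all_boot all_order all_algebra.
From mathcomp Require Import zify ring lra.
From mathcomp Require Import all_classical all_reals all_analysis.
From mathcomp Require Import measurable_realfun.

Set Implicit Arguments.
Unset Strict Implicit.
Unset Printing Implicit Defensive.

Import Order.TTheory GRing.Theory Num.Theory.
Import numFieldNormedType.Exports.

Local Open Scope classical_set_scope.
Local Open Scope ring_scope.

(** * Words, shuffles and Lyndon words *)

(** The whole analysis rests on one order of magnitude. An error of order [om ^ th] with [th > 1] on
    each interval disappears in the limit of fine subdivisions; increments of the curve have order
    [om ^ (th / 2)], so a product of two increments is such an error. This is where [p < 2] enters:
    [th = 2 / q] with [q] strictly between [p] and 2. Working at the exponent [q] instead of [p]
    makes the control small on short intervals by uniform continuity alone. Young integrals are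
    handled as functions with a prescribed differential up to errors of order [om ^ th]. The shuffle
    relations, the powers and the integrations by parts then become uniqueness statements for a
    function with given differential and initial value. On the algebraic side, evaluating at integer
    powers replaces the calculus of formal exponentials: being group-like is stable under products,
    and an identity valid at all naturals is one between polynomials. *)

Lemma word_le_cons (a b : 'I_2) (u v : word) :
  word_le (a :: u) (b :: v) = ((a < b)%N || (a == b) && word_le u v).
Proof.
have leE (x y : 'I_2) : (x <= y)%O = (x <= y)%N by [].
rewrite /word_le lexi_cons !leE -val_eqE /=.
by case: (ltngtP a b).
Qed.

Lemma word_le_refl (u : word) : word_le u u.
Proof. exact: (@le_refl _ (seqlexi 'I_2)). Qed.

Lemma word_le_trans (v u w : word) : word_le u v -> word_le v w -> word_le u w.
Proof. exact: (@le_trans _ (seqlexi 'I_2)). Qed.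

Lemma word_le_anti (u v : word) : word_le u v -> word_le v u -> u = v.
Proof.
by move=> uv vu; apply: (@le_anti _ (seqlexi 'I_2)); apply/andP; split.
Qed.

Lemma word_ltNge (u v : word) : word_lt u v = ~~ word_le v u.
Proof. exact: (@ltNge _ (seqlexi 'I_2)). Qed.

Lemma word_lt_neqAle (u v : word) : word_lt u v = (u != v) && word_le u v.
Proof. exact: (@lt_neqAle _ (seqlexi 'I_2)). Qed.

Lemma word_le_total (u v : word) : word_le u v || word_le v u.
Proof. exact: (@le_total _ (seqlexi 'I_2)). Qed.

Lemma word_le_catl (x u v : word) : word_le (x ++ u) (x ++ v) = word_le u v.
Proof. by elim: x => //= a x IH; rewrite word_le_cons ltnn eqxx IH. Qed.

Lemma word_le_prefix (u x : word) : word_le u (u ++ x).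
Proof. by rewrite -{1}[u]cats0 word_le_catl. Qed.

Lemma word_le_cat (u u' v v' : word) : size u = size u' ->
  word_le u u' -> word_le v v' -> word_le (u ++ v) (u' ++ v').
Proof.
elim: u u' => [[]//|a u IH [//|b u']] [] suu' /=.
rewrite !word_le_cons => /orP[-> //|/andP[-> uu'] vv'].
by rewrite IH// orbT.
Qed.

Lemma word_le_cat_inv (v p q : word) : word_le v (p ++ q) ->
  word_le v p \/ exists2 x, v = p ++ x & word_le x q.
Proof.
elim: p v => [|a p IH] v; first by move=> vq; right; exists v.
case: v => [|b v]; first by left.
rewrite cat_cons !word_le_cons => /orP[->|/andP[/eqP -> vpq]]; first by left.
rewrite ltnn eqxx; have [?|[x -> ?]] := IH v vpq; first by left.
by right; exists x.
Qed.

(** A list and not a set: interleavings are counted with multiplicity, as in the shuffle product.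
    The inner fixpoint recurses on the second word while the first is kept. *)
Fixpoint shuffle (u v : word) {struct u} : seq word :=
  if u is a :: u' then
    (fix shuffle_u (v : word) : seq word :=
       if v is b :: v' then
         [seq a :: s | s <- shuffle u' v] ++ [seq b :: s | s <- shuffle_u v']
       else [:: u]) v
  else [:: v].

Lemma shuffle0 (u : word) : shuffle u [::] = [:: u].
Proof. by case: u. Qed.

Lemma shuffle_cons (a b : 'I_2) (u v : word) :
  shuffle (a :: u) (b :: v) =
  [seq a :: s | s <- shuffle u (b :: v)] ++ [seq b :: s | s <- shuffle (a :: u) v].
Proof. by []. Qed.

Lemma shuffle_consl (a : 'I_2) (u v s : word) :
  s \in shuffle u v -> a :: s \in shuffle (a :: u) v.
Proof.
case: v => [|b v] su; first by move: su; rewrite !shuffle0 !inE => /eqP->.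
by rewrite shuffle_cons mem_cat map_f.
Qed.

Lemma shuffle_consr (b : 'I_2) (u v s : word) :
  s \in shuffle u v -> b :: s \in shuffle u (b :: v).
Proof.
case: u => [|a u] su; first by move: su; rewrite /= !inE => /eqP->.
by rewrite shuffle_cons mem_cat map_f ?orbT.
Qed.

Lemma shuffle_cat (u v : word) : u ++ v \in shuffle u v.
Proof. by elim: u => [|a u IH] /=; [rewrite inE | exact: shuffle_consl]. Qed.

Lemma shuffle_inv (u v s : word) : s \in shuffle u v ->
  [\/ s = [::] /\ (u = [::] /\ v = [::]),
      exists a u' s', [/\ u = a :: u', s = a :: s' & s' \in shuffle u' v]
    | exists b v' s', [/\ v = b :: v', s = b :: s' & s' \in shuffle u v']].
Proof.
case: u v => [|a u] [|b v].
- by rewrite /= inE => /eqP ->; constructor 1.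
- by rewrite /= inE => /eqP ->; constructor 3; exists b, v, v; rewrite /= inE.
- by rewrite /= inE => /eqP ->; constructor 2; exists a, u, u; rewrite shuffle0 inE.
rewrite shuffle_cons mem_cat => /orP[] /mapP[s' s's ->].
  by constructor 2; exists a, u, s'.
by constructor 3; exists b, v, s'.
Qed.

Lemma size_shuffle (u v s : word) :
  s \in shuffle u v -> size s = (size u + size v)%N.
Proof.
have [n] := ubnP (size u + size v); elim: n u v s => // n IH u v s le_n.
move=> /shuffle_inv[[-> [-> ->]]//|[a [u' [s' [uE -> ss]]]]|[b [v' [s' [vE -> ss]]]]].
  by rewrite uE /= (IH u' v)//; rewrite uE in le_n.
by rewrite vE /= (IH u v') ?addnS//; rewrite vE /= addnS in le_n.
Qed.

(* Moving the prefix [a] from the larger to the smaller word does not decrease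
   the largest shuffle. *)
Lemma shuffle_exchange (a x y s : word) : word_le y x ->
  s \in shuffle (a ++ x) y ->
  exists2 t, t \in shuffle x (a ++ y) & word_le s t.
Proof.
have [n] := ubnP (size (a ++ x) + size y); elim: n a x y s => // n IH a x y s.
case: a => [|a1 a] le_n yx; first by exists s => //; exact: word_le_refl.
move=> /shuffle_inv[[-> [//]]|[c [u' [s' [[<- <-] -> ss]]]]|].
  have [t tx st] := IH a x y s' le_n yx ss.
  exists (a1 :: t); first exact: shuffle_consr.
  by rewrite word_le_cons ltnn eqxx.
move=> [b [y' [r [yE -> rs]]]]; subst y.
case: x le_n yx rs => [//|c x] le_n; rewrite word_le_cons => /orP[bc|/andP[/eqP bc yx]] rs.
  exists (c :: (x ++ (a1 :: a) ++ b :: y')).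
    exact: (shuffle_cat (c :: x)).
  by rewrite word_le_cons bc.
(* Equal first letters: the letter heading [x] is absorbed into the moved prefix, so that only [y]
   gets shorter, and it returns at the head of the shuffle obtained by induction. *)
subst c; have le_n' : (size (rcons (a1 :: a) b ++ x) + size y' < n)%N.
  move: le_n; rewrite /= !size_cat size_rcons /=; lia.
have [|t tx rt] := IH (rcons (a1 :: a) b) x y' r le_n' yx.
  by rewrite cat_rcons.
exists (b :: t); first by apply: shuffle_consl; rewrite cat_rcons in tx.
by rewrite word_le_cons ltnn eqxx.
Qed.

(** Taking the first letter from [v] never helps: it is at most the first letter of [u], and in case
    of equality [shuffle_exchange] bounds the result by a shuffle that took this letter from [u]. *)
Lemma shuffle_le_cat (u v s : word) :
  (forall i, (i < size u)%N -> word_le v (drop i u)) ->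
  s \in shuffle u v -> word_le s (u ++ v).
Proof.
elim: u v s => [|c u IH] v s vu.
  by rewrite /= inE => /eqP ->; exact: word_le_refl.
have vu' i : (i < size u)%N -> word_le v (drop i u) by move=> iu; exact: (vu i.+1).
move=> /shuffle_inv[[-> //]|[a [u' [s' [[<- <-] -> ss]]]]|[b [v' [r [vE -> rs]]]]].
  by rewrite /= word_le_cons ltnn eqxx IH.
subst v; have := vu 0 isT; rewrite drop0 word_le_cons => /orP[bc|/andP[/eqP bc v'u]].
  by rewrite /= word_le_cons bc.
subst c; have [t tu rt] := @shuffle_exchange [:: b] u v' r v'u rs.
by rewrite /= word_le_cons ltnn eqxx (word_le_trans rt)// IH.
Qed.

Lemma suffix_min (w : word) : (2 <= size w)%N ->
  exists2 i, (0 < i < size w)%N &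
    forall j, (0 < j < size w)%N -> word_le (drop i w) (drop j w).
Proof.
move=> sw.
have : forall n, (1 <= n)%N -> (n < size w)%N -> exists2 i, (0 < i <= n)%N &
    forall j, (0 < j <= n)%N -> word_le (drop i w) (drop j w).
  elim=> [//|n IH] _ nw; case: n IH nw => [|n] IH nw.
    exists 1%N => // j j1; have -> : j = 1%N by lia.
    exact: word_le_refl.
  have [//||i i0 ih] := IH; first by lia.
  case/orP: (word_le_total (drop i w) (drop n.+2 w)) => [le1|le1].
    exists i; first by lia.
    move=> j jn; have [->//|jn'] := eqVneq j n.+2; apply: ih; lia.
  exists n.+2; first by lia.
  move=> j jn; have [->//|jn'] := eqVneq j n.+2; first exact: word_le_refl.
  apply: word_le_trans le1 _; apply: ih; lia.
move=> /(_ (size w).-1); case=> [||i i0 ih]; [lia|lia|].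
by exists i; [lia|move=> j jw; apply: ih; lia].
Qed.

Lemma lyndonE (w : word) : lyndon w <-> w != [::] /\
  forall i : nat, (0 < i < size w)%N -> word_lt w (drop i w).
Proof.
split=> [/andP[w0 /allP wl]|[w0 wl]].
  split=> // i iw; apply: wl; rewrite mem_iota; lia.
rewrite /lyndon w0; apply/allP => i; rewrite mem_iota add1n => /andP[i0 iw].
by apply: wl; rewrite i0 (leq_trans iw)// prednK// lt0n size_eq0.
Qed.

Lemma lyndon_proper_suffix (w u v : word) : lyndon w -> w = u ++ v ->
  u <> [::] -> v <> [::] -> word_lt w v.
Proof.
move=> /lyndonE[_ wl] wuv u0 v0.
have -> : v = drop (size u) w by rewrite wuv drop_size_cat.
apply: wl; rewrite wuv size_cat.
by case: u u0 {wuv} => // a u _; case: v v0 => // b v _ /=; lia.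
Qed.

Lemma min_suffix_lyndon (w : word) i : (0 < i < size w)%N ->
  (forall j, (0 < j < size w)%N -> word_le (drop i w) (drop j w)) ->
  lyndon (drop i w).
Proof.
move=> iw minw; apply/lyndonE; split.
  by rewrite -size_eq0 size_drop subn_eq0 -ltnNge; case/andP: iw.
move=> j; rewrite size_drop drop_drop => jw.
rewrite word_lt_neqAle minw ?andbT; last by lia.
apply/eqP => /(congr1 size); rewrite !size_drop /=; lia.
Qed.

(* A word that is not Lyndon is the largest shuffle of its smallest proper
   suffix and the remaining prefix. *)
Lemma not_lyndon_shuffle (w : word) : (2 <= size w)%N -> ~~ lyndon w ->
  exists u v, [/\ w = u ++ v, u <> [::], v <> [::] &
    forall s, s \in shuffle u v -> word_le s w].
Proof.
move=> sw nlw; have [i iw imin] := suffix_min sw.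
have lv := min_suffix_lyndon iw imin; set v := drop i w in lv imin *.
have vw : word_le v w.
  apply: contraNT nlw => vw; apply/lyndonE; split=> [|j jw].
    by case: (w) sw.
  by rewrite word_ltNge; apply: contra vw; apply: word_le_trans; exact: imin.
exists (take i w), v; split; first by rewrite cat_take_drop.
- by move/(congr1 size); rewrite size_takel /=; lia.
- by move/(congr1 size); rewrite size_drop /=; lia.
move=> s ss; rewrite -(cat_take_drop i w); apply: shuffle_le_cat ss => j.
rewrite size_takel ?[X in X]ltnW//; last by lia.
move=> ji; set u' := drop j (take i w).
have wE : drop j w = u' ++ v.
  by rewrite -{1}(cat_take_drop i w) drop_cat size_takel ?ji//; lia.
have su' : (0 < size u')%N by rewrite size_drop size_takel; lia.
have vu' : word_le v (u' ++ v).
  rewrite -wE; case: j ji {u' wE su'} => [|j] ji; first by rewrite drop0.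
  by apply: imin; lia.
(* Otherwise [v = u' ++ x] with [x] at most [v]; as a Lyndon word is smaller than its proper
   suffixes, [x] is empty and [v = u']. *)
have [//|[x vE xv]] := word_le_cat_inv vu'.
have [x0|x0] := eqVneq x [::].
  by rewrite -/v vE x0 cats0 word_le_refl.
have u'0 : u' <> [::] by move=> u'0; rewrite u'0 in su'.
have := lyndon_proper_suffix lv vE u'0 (elimN eqP x0).
by rewrite word_ltNge xv.
Qed.

(** * Shuffles of tensors, group-like and primitive elements *)

Section tensors.
Variable R : realType.
Implicit Types (a b f : tensor R) (u v w : word).

(** The value of [a] on the shuffle product of [u] and [v], that is, the coordinate at the pair
    [(u, v)] of the coproduct of [a] dual to the shuffle. *)
Definition tshuf a u v : R := \sum_(s <- shuffle u v) a s.

Definition tder (c : 'I_2) a : tensor R := fun w => a (c :: w).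

Lemma tshuf0l a v : tshuf a [::] v = a v.
Proof. by rewrite /tshuf big_seq1. Qed.

Lemma tshuf0r a u : tshuf a u [::] = a u.
Proof. by rewrite /tshuf shuffle0 big_seq1. Qed.

Lemma tshuf_cons a c d u v : tshuf a (c :: u) (d :: v) =
  tshuf (tder c a) u (d :: v) + tshuf (tder d a) (c :: u) v.
Proof. by rewrite /tshuf shuffle_cons big_cat !big_map. Qed.


Lemma tmul_cons a b c w :
  tmul a b (c :: w) = a [::] * b (c :: w) + tmul (tder c a) b w.
Proof. by rewrite /tmul big_ord_recl. Qed.

Lemma tmul_nil a b : tmul a b [::] = a [::] * b [::].
Proof. by rewrite /tmul big_ord1. Qed.

Lemma tder_mul a b c : tder c (tmul a b) =
  fun w => a [::] * tder c b w + tmul (tder c a) b w.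
Proof. by apply/funext => w; rewrite /tder tmul_cons. Qed.

Lemma tshuf_lin (x : R) a b u v :
  tshuf (fun w => x * a w + b w) u v = x * tshuf a u v + tshuf b u v.
Proof. by rewrite /tshuf big_split -big_distrr. Qed.

(* Concatenation and shuffle are compatible as the product and coproduct of a
   bialgebra. *)
Lemma tshuf_mul a b u v : tshuf (tmul a b) u v =
  \sum_(i < (size u).+1) \sum_(j < (size v).+1)
    tshuf a (take i u) (take j v) * tshuf b (drop i u) (drop j v).
Proof.
have [n] := ubnP (size u + size v); elim: n a u v => // n IH a u v le_n.
case: u le_n => [|c u] le_n.
  rewrite tshuf0l big_ord1; apply: eq_bigr => j _; by rewrite !tshuf0l.
case: v le_n => [|d v] le_n.
  rewrite tshuf0r; apply: eq_bigr => j _; by rewrite big_ord1 !tshuf0r.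
rewrite tshuf_cons !tder_mul !tshuf_lin !IH ?addrA; first last.
- by move: le_n; rewrite /=; lia.
- by move: le_n; rewrite /=; lia.
set A := \sum_(i < _) _; set B := \sum_(i < _) _.
have -> p q : p + A + q + B = (p + q) + (B + A) by ring.
rewrite -mulrDr -tshuf_cons.
rewrite [RHS]big_ord_recl [X in _ = X + _]big_ord_recl /= tshuf0l -!addrA; congr (_ + _).
rewrite /B big_ord_recl [X in X + A = _](_ : _ =
   \sum_(j < (size v).+1) tshuf a [::] (d :: take j v) * tshuf b (c :: u) (drop j v)
   + \sum_(i < (size u).+1) \sum_(j < (size v).+1)
        tshuf (tder d a) (c :: take i u) (take j v) * tshuf b (drop i u) (drop j v)); last first.
  by congr (_ + _); apply: eq_bigr => j _; rewrite !tshuf0l.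
rewrite -addrA; congr (_ + _).
rewrite /A -big_split; apply: eq_bigr => i _ /=.
rewrite add0n [X in _ + X = _]big_ord_recl [X in _ = X]big_ord_recl /=.
rewrite !tshuf0r addrCA; congr (_ + _).
rewrite -big_split; apply: eq_bigr => j _; by rewrite /= add0n tshuf_cons -mulrDl addrC.
Qed.

(** The characters of the shuffle algebra. *)
Definition grouplike a :=
  a [::] = 1 /\ forall u v, tshuf a u v = a u * a v.

Lemma grouplike_one : grouplike (@tone R).
Proof.
split=> [|u v]; first by rewrite /tone /tword eqxx.
case: u => [|c u]; first by rewrite tshuf0l /tone /tword eqxx mul1r.
case: v => [|d v]; first by rewrite tshuf0r /tone /tword eqxx mulr1.
by rewrite /tone /tword mul0r /tshuf big_seq big1// => s /size_shuffle;
   case: s.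
Qed.

Lemma grouplike_mul a b : grouplike a -> grouplike b -> grouplike (tmul a b).
Proof.
move=> [a1 ga] [b1 gb]; split=> [|u v]; first by rewrite tmul_nil a1 b1 mulr1.
rewrite tshuf_mul /tmul big_distrlr; apply: eq_bigr => i _; apply: eq_bigr => j _.
by rewrite ga gb mulrACA.
Qed.

Lemma grouplike_exp a m : grouplike a -> grouplike (texp a m).
Proof.
by move=> ga; elim: m => [|m IH]; [exact: grouplike_one|exact: grouplike_mul].
Qed.

(** Ree's criterion for Lie series, taken as the definition: the infinitesimal characters of the
    shuffle algebra. *)
Definition primitive a :=
  a [::] = 0 /\ forall u v, u <> [::] -> v <> [::] -> tshuf a u v = 0.

(** In the double sum of [tshuf_mul] only the two splittings survive that give all of [u] to one
    factor and all of [v] to the other. The result is symmetric in [a] and [b], so it cancels in a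
    bracket. *)
Lemma primitive_tshuf_mul a b u v : primitive a -> primitive b ->
  u <> [::] -> v <> [::] -> tshuf (tmul a b) u v = a u * b v + a v * b u.
Proof.
move=> [a0 pa] [b0 pb] u0 v0; rewrite tshuf_mul.
have P f x y : primitive f -> (0 < size x)%N -> (0 < size y)%N -> tshuf f x y = 0.
  by move=> [_ pf] x0 y0; apply: pf; [case: x x0|case: y y0].
have su : (0 < size u)%N by case: u u0.
have sv : (0 < size v)%N by case: v v0.
have V i j : (i <= size u)%N -> (j <= size v)%N ->
   ~~ ((i == size u) && (j == 0)%N) -> ~~ ((i == 0)%N && (j == size v)) ->
   tshuf a (take i u) (take j v) * tshuf b (drop i u) (drop j v) = 0.
  move=> iu jv n1 n2.
  have [i0|i0] := eqVneq i 0%N; have [j0|j0] := eqVneq j 0%N.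
  - by rewrite i0 j0 !take0 tshuf0l a0 mul0r.
  - rewrite i0 drop0 [X in _ * X]P ?mulr0// size_drop subn_gt0 ltn_neqAle jv andbT.
    by move: n2; rewrite i0.
  - rewrite j0 drop0 [X in _ * X]P ?mulr0// size_drop subn_gt0 ltn_neqAle iu andbT.
    by move: n1; rewrite j0 eqxx andbT.
  - by rewrite [X in X * _]P ?mul0r// size_takel// lt0n.
rewrite pair_big /= (bigD1 (ord_max, ord0)) //= (bigD1 (ord0, ord_max)) /=; last first.
  by rewrite xpair_eqE -val_eqE /= negb_and; case: (size u) su.
rewrite !take0 !drop0 !take_size !drop_size !tshuf0l !tshuf0r big1 ?addr0// => -[i j] /=.
rewrite !xpair_eqE -!val_eqE /= => /andP[n1 n2].
by apply: V => //; rewrite -ltnS.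
Qed.

Lemma primitive_bracket a b :
  primitive a -> primitive b -> primitive (tbracket a b).
Proof.
move=> pa pb; split; first by rewrite /tbracket /tsub !tmul_nil mulrC subrr.
move=> u v u0 v0; rewrite /tbracket.
have -> : tshuf (tsub (tmul a b) (tmul b a)) u v =
          tshuf (tmul a b) u v - tshuf (tmul b a) u v.
  by rewrite /tshuf -sumrB.
rewrite !primitive_tshuf_mul//; ring.
Qed.

Lemma primitive_letter (i : 'I_2) : primitive (tword R [:: i]).
Proof.
split=> // u v u0 v0; rewrite /tshuf big_seq big1// => s /size_shuffle ss.
rewrite /tword; case: eqP => // sE; rewrite sE /= in ss.
by case: u v u0 v0 ss => [//|x u] [//|y v] _ _ /=; rewrite addnS.
Qed.

Lemma primitive_lyndon_elt w : w <> [::] -> primitive (lyndon_elt R w).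
Proof.
have [n] := ubnP (size w); elim: n w => // n IH w le_n w0.
have [w1|w1] := leqP (size w) 1%N.
  case: w w1 w0 {le_n} => [|i [|//]] // _ _.
  by rewrite lyndon_elt1; exact: primitive_letter.
have [wE l0 /lyndonE[/eqP r0 _] _] := std_factorisationP w1.
have sz : (size (std_left w) + size (std_right w) = size w)%N.
  by rewrite -size_cat -wE.
have l1 : (0 < size (std_left w))%N by case: (std_left w) l0.
have r1 : (0 < size (std_right w))%N by case: (std_right w) r0.
by rewrite lyndon_eltE//; apply: primitive_bracket; apply: IH => //; lia.
Qed.

(* By induction on the word, as a non-Lyndon word is the largest of its shuffles. *)
Lemma primitive_eq0 f m : (forall u v, (size u + size v = m)%N ->
    u <> [::] -> v <> [::] -> tshuf f u v = 0) ->
  (forall w, size w = m -> lyndon w -> f w = 0) -> (0 < m)%N ->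
  forall w, size w = m -> f w = 0.
Proof.
move=> fs fl m0 w sw.
(* The rank of a word among those of its length; the other shuffles of a non-Lyndon word have
   smaller rank. *)
pose rk (w : word) := #|[pred t : m.-tuple 'I_2 | word_lt t w]|.
have [n] := ubnP (rk w); elim: n w sw => // n IH w sw le_n.
have [lw|nlw] := boolP (lyndon w); first exact: fl.
have [w1|w1] := leqP (size w) 1%N.
  by case: w w1 sw nlw {le_n} => [|i [|//]] // _ sm; rewrite -sm in m0.
have [u [v [wE u0 v0 ws]]] := not_lyndon_shuffle w1 nlw.
have suv : (size u + size v = m)%N by rewrite -size_cat -wE.
have := fs u v suv u0 v0; rewrite /tshuf (bigID (xpred1 w)) /= [X in _ + X]big_seq_cond.
rewrite [X in _ + X]big1 ?addr0 => [|s /andP[su sw']]; last first.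
  have szs : size s = m by rewrite (size_shuffle su).
  apply: IH => //; rewrite -ltnS (leq_trans _ le_n)// ltnS; apply: proper_card.
  have sltw : word_lt s w by rewrite word_lt_neqAle sw' ws.
  apply/properP; split.
    apply/fintype.subsetP => t; rewrite !inE => ts; rewrite word_ltNge; apply/negP => wt.
    by move: ts; rewrite word_ltNge (word_le_trans _ wt)// ws.
  exists (Tuple (introT eqP szs)); rewrite !inE //=.
  by rewrite word_ltNge word_le_refl.
rewrite (eq_bigr (fun=> f w)) => [|s /eqP->//].
(* Only the occurrences of [w] itself are left: the sum is [f w] times the multiplicity of [w] in
   the shuffle, which is positive because the concatenation is a shuffle. *)
rewrite big_const_seq iter_addr_0 => /eqP; rewrite mulrn_eq0 => /orP[|/eqP//].
rewrite (@eq_count _ _ (pred1 w))//; move=> /eqP c0.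
have : w \in shuffle u v by rewrite wE shuffle_cat.
by rewrite -has_pred1 has_count c0.
Qed.

End tensors.

(** * The logarithm of a group-like element *)

Section tensor_log.
Variable R : realType.
Implicit Types (a b x f : tensor R) (u v w : word).

Lemma texpS a m : texp a m.+1 = tmul a (texp a m).
Proof. by []. Qed.

Lemma tmul_onel a : tmul (@tone R) a = a.
Proof.
apply/funext => w; rewrite /tmul big_ord_recl take0 drop0 /tone /tword eqxx mul1r.
by rewrite big1 ?addr0// => i _; case: w i => [|c w] [i /= iw]//; rewrite mul0r.
Qed.

Lemma tmul_oner a : tmul a (@tone R) = a.
Proof.
apply/funext => w; rewrite /tmul big_ord_recr /= drop_size take_size.
rewrite /tone /tword eqxx mulr1 big1 ?add0r// => i _.
case: eqP; rewrite ?mulr0// => /(congr1 size)/=; rewrite size_drop => /eqP.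
by rewrite subn_eq0 leqNgt ltn_ord.
Qed.

Lemma tmulDl a b x : tmul (fun w => a w + b w) x = fun w => tmul a x w + tmul b x w.
Proof.
apply/funext => w; rewrite /tmul -big_split; apply: eq_bigr => i _ /=.
by rewrite mulrDl.
Qed.

Lemma tmul_sumr x n (c : nat -> R) (a : nat -> tensor R) w :
  tmul x (fun u => \sum_(k < n) c k * a k u) w =
  \sum_(k < n) c k * tmul x (a k) w.
Proof.
rewrite /tmul; under eq_bigr do rewrite big_distrr.
rewrite exchange_big; apply: eq_bigr => k _; rewrite big_distrr.
by apply: eq_bigr => i _ /=; rewrite mulrCA.
Qed.

Lemma texp_small x m w : x [::] = 0 -> (size w < m)%N -> texp x m w = 0.
Proof.
move=> x0; elim: m w => // m IH w wm; rewrite texpS /tmul big1// => i _.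
have [i0|i0] := posnP i; first by rewrite i0 take0 x0 mul0r.
rewrite IH ?mulr0// size_drop; have := ltn_ord i; lia.
Qed.

Lemma texp_binomial a m w : texp a m w =
  \sum_(k < m.+1) 'C(m, k)%:R * texp (tsub a (@tone R)) k w.
Proof.
set x := tsub a (@tone R).
have aE : a = fun w => (@tone R) w + x w.
  by apply/funext => u; rewrite /x /tsub addrC subrK.
elim: m w => [|m IH] w; first by rewrite big_ord1 bin0 mul1r.
rewrite texpS (_ : texp a m = fun u => \sum_(k < m.+1) 'C(m, k)%:R * texp x k u); last exact/funext.
rewrite [in LHS]aE tmulDl tmul_onel /= (tmul_sumr x m.+1 (fun k => 'C(m, k)%:R) (texp x)).
under [X in _ + X]eq_bigr do rewrite -texpS.
rewrite [RHS]big_ord_recl; under [X in _ = _ + X]eq_bigr do rewrite binS natrD mulrDl.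
rewrite big_split /= addrA; congr (_ + _).
rewrite big_ord_recl !bin0; congr (_ + _).
by rewrite [RHS]big_ord_recr /= bin_small// mul0r addr0.
Qed.

(** The range of [k] no longer depends on [m]: this is what makes the powers polynomial in [m] on
    each word. *)
Lemma texp_binomial_size a m w : a [::] = 1 -> texp a m w =
  \sum_(k < (size w).+1) 'C(m, k)%:R * texp (tsub a (@tone R)) k w.
Proof.
move=> a1; rewrite texp_binomial; pose F k := 'C(m, k)%:R * texp (tsub a (@tone R)) k w.
rewrite -!(big_mkord xpredT F); have [mw|wm] := leqP m (size w).
  rewrite [RHS](big_cat_nat (n := m.+1))//= [X in _ = _ + X]big1_seq ?addr0// => k /andP[_]; rewrite mem_index_iota => /andP[mk _].
  by rewrite /F bin_small ?mul0r.
rewrite [LHS](big_cat_nat (n := (size w).+1))//=; last exact: ltnW.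
rewrite [X in _ + X = _]big1_seq ?addr0// => k /andP[_]; rewrite mem_index_iota => /andP[mk _].
by rewrite /F texp_small ?mulr0// /tsub /tone /tword a1 eqxx subrr.
Qed.

Definition binpoly (k : nat) : {poly R} := k`!%:R^-1 *: \prod_(i < k) ('X - i%:R%:P).

Lemma horner_binpoly k (m : nat) : (binpoly k).[m%:R] = 'C(m, k)%:R.
Proof.
rewrite hornerZ horner_prod; under eq_bigr do rewrite hornerXsubC.
have kf : (k`!%:R : R) != 0 by rewrite pnatr_eq0 -lt0n fact_gt0.
apply: (mulfI kf); rewrite mulrA divff// mul1r -natrM mulnC bin_ffact.
elim: k m {kf} => [|k IH] m; first by rewrite big_ord0 ffactn0.
rewrite big_ord_recl subr0 ffactnS; case: m => [|m]; first by rewrite mul0r mul0n.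
rewrite natrM -IH; congr (_ * _); apply: eq_bigr => i _.
by rewrite lift0 -!natr1 opprD addrACA subrr addr0.
Qed.

(** These are the coefficients of the logarithmic series, which is how [tlog] appears as a linear
    coefficient. *)
Lemma coef1_binpoly k : (binpoly k.+1)`_1 = (-1) ^+ k / k.+1%:R.
Proof.
rewrite coefZ big_ord_recl /= polyC0 subr0 mulrC coefXM /= -horner_coef0 horner_prod.
under eq_bigr do rewrite hornerXsubC sub0r -mulN1r.
rewrite big_split prodr_const card_ord /= -natr_prod.
have -> : (\prod_(i < k) bump 0 i = k`!)%N.
  by rewrite fact_prod big_add1 big_mkord.
have kf : (k`!%:R : R) != 0 by rewrite pnatr_eq0 -lt0n fact_gt0.
by rewrite factS natrM invfM -mulrA [X in _ * X]mulrCA divff// mulr1.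
Qed.

(* [m |-> S^m] is polynomial on each word, and its linear coefficient is
   [log S]. *)
Lemma primitive_log a : grouplike a -> primitive (tlog a).
Proof.
move=> ga; have a1 := ga.1; split=> [|u v u0 v0]; first by rewrite /tlog big_geq.
set x := tsub a (@tone R).
pose Q w : {poly R} := \sum_(k < (size w).+1) texp x k w *: binpoly k.
have QE w m : (Q w).[m%:R] = texp a m w.
  rewrite texp_binomial_size// horner_sum; apply: eq_bigr => k _.
  by rewrite hornerZ horner_binpoly mulrC.
have Q0 w : w <> [::] -> (Q w)`_0 = 0.
  by move=> w0; rewrite -horner_coef0 (QE w 0) /= /tone /tword; case: eqP.
have Q1 w : (Q w)`_1 = tlog a w.
  rewrite /tlog big_add1 big_mkord coef_sum big_ord_recl coefZ /binpoly big_ord0.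
  rewrite coefZ coef1 mulr0 mulr0 add0r; apply: eq_bigr => k _.
  by rewrite coefZ coef1_binpoly mulrC.
(* [Q u] and [Q v] vanish at 0, because the power 0 is the unit and both words are nonempty; hence
   their product has no linear term. *)
suff QM : \sum_(s <- shuffle u v) Q s = Q u * Q v.
  rewrite /tshuf; under eq_bigr do rewrite -Q1.
  rewrite -coef_sum QM coefM !big_ord_recl big_ord0 /= addr0.
  by rewrite Q0// mul0r add0r [(Q v)`_ _](Q0 v)// mulr0.
(* By the shuffle relations of the powers, all naturals are roots of the difference [P]; a nonzero
   polynomial has fewer roots than its size. *)
apply/eqP; rewrite -subr_eq0; set P := _ - _; apply/negPn/negP => P0.
have := @max_poly_roots R P [seq m%:R | m <- iota 0 (size P)] P0.
rewrite size_map size_iota ltnn => H; suff: false by []; apply: H.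
  apply/allP => _ /mapP[m _ ->]; rewrite /root /P hornerD hornerN hornerM horner_sum.
  under eq_bigr do rewrite QE.
  by rewrite !QE -(grouplike_exp m ga).2 subrr.
by rewrite map_inj_uniq ?iota_uniq// => i j /eqP; rewrite eqr_nat => /eqP.
Qed.

(** Every cut of this word leaves a power of a single letter on one side, where [a - 1] vanishes. So
    all powers from the second on vanish and the logarithmic series reduces to its first term. *)
Lemma tlog_e1e2 a n k : (forall i, a (nseq i.+1 e1) = 0) ->
  (forall i, a (nseq i.+1 e2) = 0) -> a [::] = 1 ->
  tlog a (nseq n.+1 e1 ++ nseq k.+1 e2) = a (nseq n.+1 e1 ++ nseq k.+1 e2).
Proof.
move=> h1 h2 a1; set w := nseq _ _ ++ _; set x := tsub a (@tone R).
have xE u : u != [::] -> x u = a u.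
  by move=> u0; rewrite /x /tsub /tone /tword (negbTE u0) subr0.
have x0 : x [::] = 0 by rewrite /x /tsub /tone /tword eqxx a1 subrr.
have x1 i : x (nseq i e1) = 0 by case: i => [//|i]; rewrite xE.
have x2 i : x (nseq i e2) = 0 by case: i => [//|i]; rewrite xE.
have take_nseq' i j (c : 'I_2) : exists i', take i (nseq j c) = nseq i' c.
  by exists (minn i j); elim: i j => [|i IH] [|j] //=; rewrite minnSS /= -IH.
have drop_nseq' i j (c : 'I_2) : exists i', drop i (nseq j c) = nseq i' c.
  by exists (j - i)%N; elim: i j => [|i IH] [|j] //=.
have X2 m i : texp x m.+1 (nseq i e2) = 0.
  rewrite texpS /tmul big1// => j _; have [j' ->] := take_nseq' j i e2.
  by rewrite x2 mul0r.
have X12 m : texp x m.+2 w = 0.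
  rewrite texpS /tmul big1// => j _; rewrite /w take_cat drop_cat !size_nseq.
  have [jn|nj] := ltnP; last by have [j' ->] := drop_nseq' (j - n.+1)%N k.+1 e2; rewrite X2 mulr0.
  by have [j' ->] := take_nseq' j n.+1 e1; rewrite x1 mul0r.
rewrite /tlog big_ltn ?size_cat ?size_nseq// expr0 divr1 mul1r texpS tmul_oner -/x xE//.
rewrite big_nat big1 ?addr0// => -[|[|m]]// _.
by rewrite -/x X12 mulr0.
Qed.

End tensor_log.

(** * Lyndon elements *)

(** A proper suffix starts with strictly fewer letters [e1], so at the first difference it has [e2]
    where the word has [e1]. *)
Lemma lyndon_e1e2 n k : (1 <= n)%N -> (1 <= k)%N ->
  lyndon (nseq n e1 ++ nseq k e2).
Proof.
move=> n1 k1; apply/lyndonE; split; first by case: n n1.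
move=> i; rewrite size_cat !size_nseq => iw; rewrite word_ltNge.
have dn (c : 'I_2) j m : drop j (nseq m c) = nseq (m - j) c.
  by elim: j m => [|j IH] [|m] //=.
rewrite drop_cat size_nseq dn; case: ltnP => ni.
  have -> : n = (n - i + i)%N by lia.
  rewrite nseqD addnK -catA word_le_catl.
  by case: i iw {ni} => [|i]; [lia|]; case: k k1 => // k _ _ /=; rewrite word_le_cons.
rewrite dn; case E : (k - (i - n))%N => [|m]; first by lia.
by case: n n1 {iw ni E}.
Qed.

(** The smallest of all proper suffixes is itself Lyndon, hence it competes in the definition of
    [std_right]. *)
Lemma word_le_std_right (w : word) : (2 <= size w)%N ->
  lyndon w -> forall u v : word, w = u ++ v -> u <> [::] -> v <> [::] ->
  word_le (std_right w) v.
Proof.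
move=> sw lw u v wuv u0 v0.
have [i iw imin] := suffix_min sw.
have [_ _ _ smin] := std_factorisationP sw.
apply: word_le_trans (_ : word_le (drop i w) v).
  apply: (smin (take i w)); first by rewrite cat_take_drop.
    by move/(congr1 size); rewrite size_takel /=; lia.
  exact: min_suffix_lyndon.
have -> : v = drop (size u) w by rewrite wuv drop_size_cat.
apply: imin; rewrite wuv size_cat.
by case: u u0 {wuv} => // a u _; case: v v0 => // b v _ /=; lia.
Qed.

(** Suppose that a proper suffix [d] of the left factor [l] is at most [l]. Since [w] is below its
    suffix [d ++ r], the word [d] is also a prefix of [l]. Cancelling it leaves a suffix [y ++ r] of
    [w] that is at most [r] and longer than [r], against the minimality of [r]. *)
Lemma lyndon_std_left (w : word) : (2 <= size w)%N -> lyndon w ->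
  lyndon (std_left w).
Proof.
move=> sw lw; have [wE l0 rl _] := std_factorisationP sw.
have rmin := word_le_std_right sw lw.
have /lyndonE[/eqP r0 _] := rl.
set l := std_left w in wE l0 *; set r := std_right w in wE rl rmin r0 *.
apply/lyndonE; split; first exact/eqP.
move=> i il; rewrite word_ltNge; apply/negP => le_l.
have wE' : w = take i l ++ (drop i l ++ r) by rewrite catA cat_take_drop.
have t0 : take i l <> [::] by move/(congr1 size); rewrite size_takel /=; lia.
have d0 : drop i l ++ r <> [::].
  by case: (drop i l).
have := lyndon_proper_suffix lw wE' t0 d0.
rewrite word_lt_neqAle => /andP[_]; rewrite {1}wE.
rewrite -{1}(cat_take_drop (size (drop i l)) l) -catA => le_w.
have sd : size (take (size (drop i l)) l) = size (drop i l).
  by rewrite size_takel// size_drop leq_subr.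
have le_l' : word_le (drop i l) (take (size (drop i l)) l).
  move: le_l; rewrite -{2}(cat_take_drop (size (drop i l)) l).
  move: sd; move: (drop i l) (take _ l) (drop (size _) l) => d t x.
  elim: d t => [//|a d IH] [//|b t] [] /IH {}IH.
  by rewrite /= !word_le_cons => /orP[->//|/andP[-> /IH ->]]; rewrite orbT.
have tE : take (size (drop i l)) l = drop i l.
  apply: word_le_anti => //.
  move: le_w sd; move: (drop i l) (take _ l) (drop (size _) l) => d t x.
  elim: d t => [[]//|a d IH] [//|b t]; rewrite !cat_cons !word_le_cons.
  by move=> /orP[->//|/andP[-> /IH {}IH]] [] /IH ->; rewrite orbT.
move: le_w; rewrite tE word_le_catl => le_r.
set y := drop (size (drop i l)) l in le_r.
have yr0 : y ++ r <> [::].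
  by case: (y).
have sy : (0 < size y)%N by rewrite /y !size_drop; lia.
have wE2 : w = drop i l ++ (y ++ r) by rewrite -tE catA cat_take_drop.
have d0' : drop i l <> [::] by move/(congr1 size); rewrite size_drop /=; lia.
have le_r' := rmin _ _ wE2 d0' yr0.
have /(congr1 size) := word_le_anti le_r' le_r; rewrite size_cat; lia.
Qed.

(** * Triangularity of the Lyndon elements and the resulting expansion *)

Section lyndon_basis.
Variable R : realType.
Implicit Types (a b f : tensor R) (u v w : word).

Lemma tmul_neq0 a b w : tmul a b w != 0 ->
  exists u v, [/\ w = u ++ v, a u != 0 & b v != 0].
Proof.
move=> ab0; case: (pickP (fun i : 'I_(size w).+1 =>
    (a (take i w) != 0) && (b (drop i w) != 0))) => [i /andP[ai bi]|H].
  by exists (take i w), (drop i w); rewrite cat_take_drop.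
move/eqP: ab0; case; rewrite /tmul big1// => i _.
by have /negbT := H i; rewrite negb_and !negbK => /orP[]/eqP->; rewrite ?mul0r ?mulr0.
Qed.

Lemma tmul_cat a b u v : (forall x, a x != 0 -> size x = size u) ->
  tmul a b (u ++ v) = a u * b v.
Proof.
move=> ha; rewrite /tmul.
have uv : (size u < (size (u ++ v)).+1)%N by rewrite ltnS size_cat leq_addr.
rewrite (bigD1 (Ordinal uv))//= take_size_cat// drop_size_cat// big1 ?addr0// => i iu.
have [->|/ha] := eqVneq (a (take i (u ++ v))) 0; first by rewrite mul0r.
rewrite size_takel; last by rewrite -ltnS.
by move=> E; move: iu; rewrite -val_eqE /= E eqxx.
Qed.

(** In the bracket, the product taken in the order of the factorisation starts at [l ++ r = w]. The
    words of the opposite product are at least [r], and [r] exceeds [w] because [w] is Lyndon.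
    Keeping track of [perm_eq] serves to compare with the smallest rearrangement later. *)
Lemma lyndon_elt_triangular w : lyndon w -> lyndon_elt R w w = 1 /\
  forall u, lyndon_elt R w u != 0 -> perm_eq u w /\ word_le w u.
Proof.
have [n] := ubnP (size w); elim: n w => // n IH w le_n lw.
have [w1|w1] := leqP (size w) 1%N.
  case: w w1 lw {le_n} => [|i [|//]] // _ _.
  rewrite lyndon_elt1 /tword eqxx; split=> // u.
  by case: (u =P _) => [->|]; rewrite ?eqxx// word_le_refl.
have [wE l0 rl _] := std_factorisationP w1.
have ll := lyndon_std_left w1 lw; have /lyndonE[/eqP r0 _] := rl.
rewrite lyndon_eltE//; set l := std_left w in wE l0 ll *.
set r := std_right w in wE rl r0 *.
have sz : (size l + size r = size w)%N by rewrite -size_cat -wE.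
have l1 : (0 < size l)%N by case: (l) l0.
have r1 : (0 < size r)%N by case: (r) r0.
have [|Pl1 Pl] := IH l _ ll; first by lia.
have [|Pr1 Pr] := IH r _ rl; first by lia.
have lrP u : tmul (lyndon_elt R l) (lyndon_elt R r) u != 0 -> perm_eq u w /\ word_le w u.
  move=> /tmul_neq0[x [y [-> /Pl[px lx] /Pr[py ry]]]]; rewrite wE perm_cat//.
  by rewrite word_le_cat// (perm_size px).
have rlP u : tmul (lyndon_elt R r) (lyndon_elt R l) u != 0 -> perm_eq u w /\ ~~ word_le u w.
  move=> /tmul_neq0[x [y [-> /Pr[px rx] /Pl[py ly]]]]; split.
    by rewrite wE perm_sym perm_catC perm_sym perm_cat.
  have := lyndon_proper_suffix lw wE l0 r0; rewrite word_ltNge; apply: contra.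
  move=> xyw; apply: word_le_trans xyw.
  exact: word_le_trans rx (word_le_prefix _ _).
split.
  rewrite /tbracket /tsub [X in tmul _ _ X - _]wE tmul_cat ?Pl1 ?Pr1 ?mulr1; last first.
    by move=> x /Pl[/perm_size].
  have [->|/rlP[_]] := eqVneq (tmul (lyndon_elt R r) (lyndon_elt R l) w) 0.
    by rewrite subr0.
  by rewrite word_le_refl.
move=> u; rewrite /tbracket /tsub.
have [->|/lrP//] := eqVneq (tmul (lyndon_elt R l) (lyndon_elt R r) u) 0.
rewrite sub0r oppr_eq0 => /rlP[pu nuw]; split=> //.
by case/orP: (word_le_total w u) nuw => // ->.
Qed.

Lemma lyndon_elt_size w u : lyndon w -> size u != size w -> lyndon_elt R w u = 0.
Proof.
move=> lw; have [//|/(lyndon_elt_triangular lw).2[/perm_size-> _]] := eqVneq (lyndon_elt R w u) 0.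
by rewrite eqxx.
Qed.

(** Forward substitution in a unitriangular system: at the smallest word only its own Lyndon element
    is nonzero, so its coefficient is read off there and its contribution subtracted. *)
Lemma lyndon_solve (ws : seq word) f : sorted word_lt ws -> all lyndon ws ->
  exists c : word -> R, forall v, v \in ws ->
    f v = \sum_(w <- ws) c w * lyndon_elt R w v.
Proof.
elim: ws f => [|w ws IH] f; first by exists (fun=> 0).
have lt_tr : transitive word_lt by exact: (@lt_trans _ (seqlexi 'I_2)).
rewrite [sorted _ _]path_sortedE// => /andP[/allP wws sws] /andP[lw lws].
have [c cE] := IH (fun v => f v - f w * lyndon_elt R w v) sws lws.
have wnws : w \notin ws by apply/negP => /wws; rewrite word_ltNge word_le_refl.
have cE' v : \sum_(x <- ws) (if x == w then f w else c x) * lyndon_elt R x v =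
             \sum_(x <- ws) c x * lyndon_elt R x v.
  apply: eq_big_seq => x xws; case: eqP => // xw.
  by rewrite -xw xws in wnws.
exists (fun x => if x == w then f w else c x) => v; rewrite inE big_cons eqxx cE'.
case/predU1P => [->|vws]; last by rewrite -cE// addrC subrK.
rewrite (lyndon_elt_triangular lw).1 mulr1 big_seq big1 ?addr0// => x xws.
have [->|/(lyndon_elt_triangular (allP lws _ xws)).2[_]] := eqVneq (lyndon_elt R x w) 0.
  by rewrite mulr0.
by move=> xw; have := wws _ xws; rewrite word_ltNge xw.
Qed.

Lemma lyndon_free (ws : seq word) (d : word -> R) : sorted word_lt ws -> all lyndon ws ->
  (forall v, v \in ws -> \sum_(w <- ws) d w * lyndon_elt R w v = 0) ->
  forall v, v \in ws -> d v = 0.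
Proof.
elim: ws => [//|w ws IH].
have lt_tr : transitive word_lt by exact: (@lt_trans _ (seqlexi 'I_2)).
rewrite [sorted _ _]path_sortedE// => /andP[/allP wws sws] /andP[lw lws] H.
have dw : d w = 0.
  have := H w (mem_head _ _); rewrite big_cons (lyndon_elt_triangular lw).1 mulr1.
  rewrite big_seq big1 ?addr0// => x xws.
  have [->|/(lyndon_elt_triangular (allP lws _ xws)).2[_]] := eqVneq (lyndon_elt R x w) 0.
    by rewrite mulr0.
  by move=> xw; have := wws _ xws; rewrite word_ltNge xw.
move=> v; rewrite inE => /predU1P[->//|]; apply: IH => // {}v vws.
have := H v; rewrite inE vws orbT big_cons dw mul0r add0r; exact.
Qed.

Lemma lyndon_words m : exists ws : seq word, [/\ sorted word_lt ws,
  forall w, w \in ws = lyndon w && (size w == m) &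
  forall F : word -> R, \sum_(w : m.-tuple 'I_2 | lyndon w) F w = \sum_(w <- ws) F w].
Proof.
pose s : seq word := [seq val t | t <- enum [pred t : m.-tuple 'I_2 | lyndon t]].
have us : uniq s by rewrite map_inj_uniq ?enum_uniq//; exact: val_inj.
exists (sort word_le s); split.
- have := @sort_lt_sorted _ (seqlexi 'I_2) s; rewrite us; exact.
- move=> w; rewrite mem_sort; apply/mapP/andP => [[t]|[lw sw]].
    by rewrite mem_enum inE => lt ->; rewrite size_tuple.
  by exists (Tuple sw) => //; rewrite mem_enum inE.
- move=> F; rewrite (perm_big _ (permEl (perm_sort _ _))) big_map.
  by rewrite big_enum.
Qed.

Lemma lyndon_expansion_degree N (c : word -> R) u : (size u <= N)%N ->
  \sum_(m < N.+1) \sum_(w : m.-tuple 'I_2 | lyndon w) c w * lyndon_elt R w u =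
  \sum_(w : (size u).-tuple 'I_2 | lyndon w) c w * lyndon_elt R w u.
Proof.
move=> uN; rewrite -ltnS in uN; rewrite (bigD1 (Ordinal uN))//= [X in _ + X]big1 ?addr0// => m mu.
apply: big1 => w lw; rewrite lyndon_elt_size ?mulr0// size_tuple eq_sym.
by move: mu; rewrite -val_eqE.
Qed.

(* Uses that the word is the smallest one in its permutation class. *)
Lemma lyndon_coef_e1e2 N a n k : primitive a -> (n + k + 2 <= N)%N ->
  lyndon_coef N (ttrunc N a) (nseq n.+1 e1 ++ nseq k.+1 e2)
    (a (nseq n.+1 e1 ++ nseq k.+1 e2)).
Proof.
move=> [a0 pa] nkN.
have Lprim w : lyndon w -> primitive (lyndon_elt R w).
  by move=> /lyndonE[/eqP w0 _]; exact: primitive_lyndon_elt.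
have solve m : exists c : word -> R, forall u, size u = m ->
    a u = \sum_(w : m.-tuple 'I_2 | lyndon w) c w * lyndon_elt R w u.
  have [ws [ws_s wsE wsS]] := lyndon_words m.
  have lws : all lyndon ws by apply/allP => w; rewrite wsE => /andP[].
  have [c cE] := lyndon_solve a ws_s lws; exists c => u su; rewrite (wsS (fun w => c w * lyndon_elt R w u)).
  case: m wsE {wsS} su => [|m] wsE su.
    case: u su => // _; rewrite a0 big_seq big1// => w; rewrite wsE => /andP[/Lprim[-> _] _].
    by rewrite mulr0.
  apply/eqP; rewrite -subr_eq0; apply/eqP.
  (* The system was solved at Lyndon words only. The remainder vanishes there and on proper
     shuffles, hence on all words of this length. *)
  pose f u := a u - \sum_(w <- ws) c w * lyndon_elt R w u.
  apply: (@primitive_eq0 R f m.+1) => // [x y _ x0 y0|w sw lw].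
    rewrite /tshuf /f sumrB [X in X - _]pa// sub0r exchange_big big_seq big1 ?oppr0// => w.
    rewrite wsE => /andP[lw _]; rewrite -big_distrr /= [X in _ * X](Lprim w lw).2//.
    by rewrite mulr0.
  by rewrite /f -cE ?subrr// wsE lw sw eqxx.
(* Lyndon elements are homogeneous, so the solutions chosen in each degree can be glued according to
   the length of the word. *)
pose c w := sval (cid (solve (size w))) w.
have cE u : a u = \sum_(w : (size u).-tuple 'I_2 | lyndon w) c w * lyndon_elt R w u.
  rewrite /= {1}(svalP (cid (solve (size u))) u erefl); apply: eq_bigr => w _.
  by rewrite /c size_tuple.
exists c; split.
- move=> u; rewrite /ttrunc; case: ifPn => uN; first by rewrite lyndon_expansion_degree.
  symmetry; apply: big1 => m _; apply: big1 => w lw; rewrite lyndon_elt_size ?mulr0//.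
  rewrite size_tuple; apply: contraNN uN => /eqP ->; by rewrite -ltnS.
- move=> c' c'E v lv vN; set m := size v.
  have [ws [ws_s wsE wsS]] := lyndon_words m.
  have lws : all lyndon ws by apply/allP => w; rewrite wsE => /andP[].
  apply/eqP; rewrite -subr_eq0; apply/eqP.
  apply: (lyndon_free (d := fun v => c' v - c v) ws_s lws); last by rewrite wsE lv eqxx.
  move=> u; rewrite wsE => /andP[lu /eqP su].
  have := c'E u; rewrite lyndon_expansion_degree ?su// /ttrunc su vN cE su (wsS (fun w => c w * lyndon_elt R w u)) (wsS (fun w => c' w * lyndon_elt R w u)).
  by move=> E; under eq_bigr do rewrite mulrBl; rewrite sumrB -E subrr.
- set w0 := nseq _ _ ++ _.
  have lw0 : lyndon w0 by exact: lyndon_e1e2.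
  rewrite [RHS]cE (bigD1 (in_tuple w0))//= (lyndon_elt_triangular lw0).1 mulr1.
  rewrite big1 ?addr0// => w /andP[lw ww0].
  have [->|/(lyndon_elt_triangular lw).2[pw le_w]] := eqVneq (lyndon_elt R w w0) 0.
    by rewrite mulr0.
  (* The letters of [w0] are in increasing order, so it is below all its rearrangements; by
     triangularity no other Lyndon element is nonzero at [w0]. *)
  suff le0 : word_le w0 w.
    by move: ww0; rewrite -val_eqE /= (word_le_anti le_w le0) eqxx.
  have srt : sorted leq (map val w0).
    rewrite /w0 map_cat !map_nseq.
    have srt2 : sorted leq (nseq k.+1 (val e2)).
      by elim: k {nkN w0 lw0 w lw ww0 pw le_w} => //= k ->.
    elim: n.+1 => [//|i IH]; rewrite /= path_sortedE ?IH ?andbT//.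
      by apply/allP.
    exact: leq_trans.
  move: pw srt; move: (w0) (val w) => s0 w'.
  elim: s0 w' => [//|x s IH] w' p srt.
  case: w' p => [/perm_size//|y t] p.
  have xy : (x <= y)%N.
    have : y \in x :: s by rewrite (perm_mem p) mem_head.
    rewrite inE => /predU1P[->//|ys].
    have := order_path_min leq_trans srt => /allP/(_ (val y)); apply; exact: map_f.
  rewrite word_le_cons; move: xy; rewrite leq_eqVlt => /orP[/eqP/val_inj xy|->//].
  subst y; rewrite ltnn eqxx /= IH//; last exact: path_sorted srt.
  by rewrite perm_cons in p.
Qed.

End lyndon_basis.

(** * Sewing *)

Section sewing.
Variable R : realType.
Implicit Types (om xi : R -> R -> R) (tau : nat -> R) (s t u e A : R).

Definition control om : Prop :=
  [/\ forall s t, 0 <= s -> s <= t -> t <= 1 -> 0 <= om s t,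
      forall s u t, 0 <= s -> s <= u -> u <= t -> t <= 1 ->
        om s u + om u t <= om s t
    & forall e, 0 < e -> exists2 d, 0 < d & forall s t,
        0 <= s -> s <= t -> t <= 1 -> t - s < d -> om s t <= e].

Definition almost_additive om (th A : R) xi : Prop :=
  forall s u t, 0 <= s -> s <= u -> u <= t -> t <= 1 ->
    `|xi s u + xi u t - xi s t| <= A * om s t `^ th.

(** Points may be repeated, so that clamped grids and partitions padded by a default value
    qualify. *)
Definition subdivision tau : Prop :=
  (forall i, 0 <= tau i <= 1) /\ {homo tau : i j / (i <= j)%N >-> i <= j}.

(** The solution of [K = 2 * 2^(-th) * K + 2]: two pieces, each with at most half of the control,
    and two defects of almost additivity. *)
Definition sewing_cst (th : R) : R := 2 / (1 - 2 `^ (1 - th)).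

Lemma powR2_lt1 (th : R) : 1 < th -> 2 `^ (1 - th) < 1.
Proof.
move=> th1; rewrite -opprB powRN invf_lt1 ?powR_gt0//.
have := @gt0_ltr_powR R (th - 1) _ 1 2; rewrite powR1; apply.
- by rewrite subr_gt0.
- by rewrite nnegrE.
- by rewrite nnegrE.
- by rewrite ltr1n.
Qed.

Lemma sewing_cst_ge0 (th : R) : 1 < th -> 0 <= sewing_cst th.
Proof. by move=> /powR2_lt1 h; rewrite divr_ge0// subr_ge0 ltW. Qed.

Section control_facts.
Variables (om : R -> R -> R) (th : R).
Hypothesis om_ctrl : control om.
Hypothesis th1 : 1 < th.

Let om_ge0 s t : 0 <= s -> s <= t -> t <= 1 -> 0 <= om s t.
Proof. by case: om_ctrl => h _ _; exact: h. Qed.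

Let om_add s u t : 0 <= s -> s <= u -> u <= t -> t <= 1 ->
  om s u + om u t <= om s t.
Proof. by case: om_ctrl => _ h _; exact: h. Qed.

Lemma control_diag s : 0 <= s -> s <= 1 -> om s s = 0.
Proof.
move=> s0 s1; apply/eqP; rewrite eq_le om_ge0// andbT.
by have := om_add s0 (lexx s) (lexx s) s1; lra.
Qed.

Lemma control_sub s u v t : 0 <= s -> s <= u -> u <= v -> v <= t -> t <= 1 ->
  om u v <= om s t.
Proof.
move=> s0 su uv vt t1; have u0 := le_trans s0 su; have v1 := le_trans vt t1.
have := om_add s0 su uv v1; have := om_add s0 (le_trans su uv) vt t1.
have := om_ge0 s0 su (le_trans uv v1).
by have := om_ge0 (le_trans u0 uv) vt t1; lra.
Qed.

Lemma control_sum tau n : subdivision tau ->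
  \sum_(0 <= i < n) om (tau i) (tau i.+1) <= om (tau 0%N) (tau n).
Proof.
move=> [t01 th_]; have t0 i : 0 <= tau i by case/andP: (t01 i).
have t1 i : tau i <= 1 by case/andP: (t01 i).
elim: n => [|n IH]; first by rewrite big_geq// control_diag.
rewrite big_nat_recr//=; apply: le_trans (om_add (t0 0%N) (th_ _ _ (leq0n n)) (th_ _ _ (leqnSn n)) (t1 _)).
by rewrite lerD2r.
Qed.

Lemma powR_control_le s t e : 0 <= s -> s <= t -> t <= 1 -> om s t <= e ->
  om s t `^ th <= e `^ (th - 1) * om s t.
Proof.
move=> s0 st t1 le_e; have o0 := om_ge0 s0 st t1.
have th0 : 0 < th by exact: lt_trans th1.
rewrite -(mulr_powRB1 o0 th0) mulrC ler_wpM2r// ge0_ler_powR ?nnegrE//.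
- by rewrite subr_ge0 ltW.
- exact: le_trans le_e.
Qed.

Lemma powR_control_sub s u v t : 0 <= s -> s <= u -> u <= v -> v <= t ->
  t <= 1 -> om u v `^ th <= om s t `^ th.
Proof.
move=> s0 su uv vt t1; rewrite ge0_ler_powR ?nnegrE//.
- by rewrite ltW// (lt_trans _ th1).
- exact: om_ge0 (le_trans s0 su) uv (le_trans vt t1).
- exact: om_ge0 s0 (le_trans su (le_trans uv vt)) t1.
- exact: control_sub.
Qed.

(** Since [th > 1], a factor [om ^ (th - 1)] can be split off, which is uniformly small on fine
    meshes; the remaining sum of [om] is bounded by superadditivity. *)
Lemma powR_control_sum e : 0 < e -> exists2 d, 0 < d & forall tau n,
  subdivision tau -> (forall i, (i < n)%N -> tau i.+1 - tau i < d) ->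
  \sum_(0 <= i < n) om (tau i) (tau i.+1) `^ th <= e.
Proof.
move=> e0; have o01 : 0 <= om 0 1 by exact: om_ge0.
pose c := (e / (om 0 1 + 1)) `^ (th - 1)^-1.
have q0 : 0 < e / (om 0 1 + 1) by rewrite divr_gt0// ltr_wpDl.
have c0 : 0 < c by exact: powR_gt0.
have cE : c `^ (th - 1) = e / (om 0 1 + 1).
  by rewrite /c -powRrM mulVf ?powRr1 ?ltW// subr_eq0 gt_eqF.
have [_ _ /(_ c c0)[d d0 dP]] := om_ctrl.
exists d => // tau n tau_s mesh; have [t01 thm] := tau_s.
have t0 i : 0 <= tau i by case/andP: (t01 i).
have t1 i : tau i <= 1 by case/andP: (t01 i).
apply: (@le_trans _ _ (\sum_(0 <= i < n) c `^ (th - 1) * om (tau i) (tau i.+1))).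
  rewrite big_nat [leRHS]big_nat; apply: ler_sum => i /andP[_ i_n].
  by apply: powR_control_le => //; [exact: thm | apply: dP => //; [exact: thm|exact: mesh]].
rewrite -big_distrr /= cE mulrAC ler_pdivrMr ?ltr_wpDl// ler_pM2l//.
apply: le_trans (control_sum n tau_s) _.
by rewrite (le_trans (control_sub (lexx 0) (t0 0%N) _ (t1 n) (lexx 1))) ?lerDl//; exact: thm.
Qed.

Lemma almost_additive_diag A xi s : almost_additive om th A xi ->
  0 <= s -> s <= 1 -> xi s s = 0.
Proof.
move=> axi s0 s1; have := axi s s s s0 (lexx s) (lexx s) s1.
rewrite control_diag// powR0 ?gt_eqF ?(lt_trans _ th1)// mulr0 addrK normr_le0.
by move/eqP.
Qed.

(* Cut the interval where the control passes half of its value: both remaining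
   parts have at most half of the control. *)
Lemma sewing A xi tau m n : almost_additive om th A xi -> 0 <= A ->
  subdivision tau -> (m <= n)%N ->
  `|\sum_(m <= i < n) xi (tau i) (tau i.+1) - xi (tau m) (tau n)| <=
    sewing_cst th * A * om (tau m) (tau n) `^ th.
Proof.
move=> axi A0 [t01 thm]; have t0 i : 0 <= tau i by case/andP: (t01 i).
have t1 i : tau i <= 1 by case/andP: (t01 i).
set K := sewing_cst th; have K0 : 0 <= K by exact: sewing_cst_ge0.
have [k] := ubnP (n - m)%N; elim: k m n => // k IH m n le_k.
rewrite leq_eqVlt => /orP[/eqP <-|mn].
  rewrite big_geq// (almost_additive_diag axi)// subrr normr0.
  by rewrite mulr_ge0 ?powR_ge0// mulr_ge0.
pose half v := (m <= v < n)%N && (om (tau m) (tau v) <= om (tau m) (tau n) / 2).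
have om_mn : 0 <= om (tau m) (tau n) by apply: om_ge0 => //; exact/thm/ltnW.
have half_m : exists v, half v.
  by exists m; rewrite /half leqnn mn control_diag//= divr_ge0.
have half_n v : half v -> (v <= n)%N by move=> /andP[/andP[_ /ltnW]].
case: (ex_maxnP half_m half_n) => v /andP[/andP[mv vn] om_mv] v_max.
(* By maximality of [v], more than half of the control lies before [v.+1], and superadditivity
   leaves at most half after it. The step from [v] to [v.+1] belongs to neither piece: joining it to
   them costs the defects [D1] and [D2]. *)
have om_vn : om (tau v.+1) (tau n) <= om (tau m) (tau n) / 2.
  have [vn'|vn'] := ltnP v.+1 n; last first.
    have -> : v.+1 = n by apply/eqP; rewrite eqn_leq vn.
    by rewrite control_diag// divr_ge0.
  have : ~~ half v.+1 by apply/negP => /v_max; rewrite ltnn.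
  rewrite /half vn' (leq_trans mv)//= -ltNge => h.
  have := om_add (t0 m) (thm _ _ (leq_trans mv (leqnSn v))) (thm _ _ vn) (t1 n).
  by lra.
have [l1 l2] : (v - m < k)%N /\ (n - v.+1 < k)%N.
  by move: mn mv vn le_k; clear; lia.
have P1 := IH m v l1 mv; have P2 := IH v.+1 n l2 vn.
rewrite (big_cat_nat (n := v))//= ?(ltnW vn)// (big_ltn vn).
set S1 := \sum_(m <= i < v) _ in P1 *; set S2 := \sum_(v.+1 <= i < n) _ in P2 *.
have D1 := axi (tau m) (tau v) (tau v.+1) (t0 m) (thm _ _ mv) (thm _ _ (leqnSn v)) (t1 _).
have D2 := axi (tau m) (tau v.+1) (tau n) (t0 m) (thm _ _ (leq_trans mv (leqnSn v))) (thm _ _ vn) (t1 _).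
set p := om (tau m) (tau n) `^ th in D2 *.
have halfp s t : 0 <= om s t -> om s t <= om (tau m) (tau n) / 2 ->
    om s t `^ th <= 2 `^ (1 - th) / 2 * p.
  move=> st0 st; apply: (@le_trans _ _ ((om (tau m) (tau n) / 2) `^ th)).
    by rewrite ge0_ler_powR ?nnegrE ?divr_ge0// ltW// (lt_trans _ th1).
  rewrite powRM ?invr_ge0// mulrC ler_wpM2r ?powR_ge0//.
  rewrite powRD ?pnatr_eq0 ?implybT// powRr1// mulrAC mulfV ?pnatr_eq0// mul1r.
  by rewrite powRN -powR_inv1// -powRrM mulN1r powRN.
have h1 := halfp _ _ (om_ge0 (t0 m) (thm _ _ mv) (t1 v)) om_mv.
have h2 := halfp _ _ (om_ge0 (t0 v.+1) (thm _ _ vn) (t1 n)) om_vn.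
have h3 : om (tau m) (tau v.+1) `^ th <= p.
  by apply: powR_control_sub => //; apply: thm => //; exact: leq_trans mv (leqnSn v).
have KE : K * (1 - 2 `^ (1 - th)) = 2.
  by rewrite /K /sewing_cst mulfVK// subr_eq0 gt_eqF// powR2_lt1.
have q1 : A * om (tau m) (tau v.+1) `^ th <= A * p by exact: ler_wpM2l.
have KA0 : 0 <= K * A by exact: mulr_ge0.
have {}P1 : `|S1 - xi (tau m) (tau v)| <= K * A * (2 `^ (1 - th) / 2 * p).
  by apply: le_trans P1 _; exact: ler_wpM2l.
have {}P2 : `|S2 - xi (tau v.+1) (tau n)| <= K * A * (2 `^ (1 - th) / 2 * p).
  by apply: le_trans P2 _; exact: ler_wpM2l.
have -> : S1 + (xi (tau v) (tau v.+1) + S2) - xi (tau m) (tau n) =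
  (S1 - xi (tau m) (tau v)) + (S2 - xi (tau v.+1) (tau n)) +
  (xi (tau m) (tau v) + xi (tau v) (tau v.+1) - xi (tau m) (tau v.+1)) +
  (xi (tau m) (tau v.+1) + xi (tau v.+1) (tau n) - xi (tau m) (tau n)) by ring.
have -> : K * A * p = K * A * (2 `^ (1 - th) / 2 * p) + K * A * (2 `^ (1 - th) / 2 * p)
   + A * p + A * p.
  have e2 : A * p + A * p = (K * (1 - 2 `^ (1 - th))) * (A * p) by rewrite KE; ring.
  by rewrite -[in RHS]addrA e2; field.
by do 3 (apply: le_trans (ler_normD _ _) _; apply: lerD; rewrite ?(le_trans D1)//).
Qed.

End control_facts.
End sewing.

(** * The additive map associated with an almost additive germ *)

Section sewing_map.
Variable R : realType.
Implicit Types (om xi : R -> R -> R) (tau : nat -> R) (s t u e A : R).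

Lemma cvgn_distP (u_ : nat -> R) (l : R) : u_ @ \oo --> l <->
  forall e, 0 < e -> exists N, forall n, (N <= n)%N -> `|u_ n - l| <= e.
Proof.
rewrite cvgrPdist_le; split=> h e e0.
  by have [N _ NP] := h e e0; exists N => n /NP; rewrite distrC.
by have [N NP] := h e e0; exists N => // n /NP; rewrite distrC.
Qed.

Lemma cauchy_converges (u_ : nat -> R) :
  (forall e, 0 < e -> exists N, forall n, (N <= n)%N -> `|u_ n - u_ N| <= e) ->
  exists l : R, u_ @ \oo --> l.
Proof.
move=> h; suff : cvg (u_ @ \oo) by move/cvg_ex.
apply: cauchy_cvg; apply: cauchy_exP => e e0.
have e20 : 0 < e / 2 by rewrite divr_gt0.
have [N NP] := h _ e20; exists (u_ N), N => // n /= Nn.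
rewrite -ball_normE /= distrC (le_lt_trans (NP _ Nn))//.
by rewrite ltr_pdivrMr// ltr_pMr// ltr1n.
Qed.

(** Projection onto [[s, t]]. Clamping one fixed grid subdivides all intervals at once, in a way
    almost compatible with cutting an interval, as [usum_split] makes precise. *)
Definition clamp s t u : R := Num.max s (Num.min t u).

Lemma clamp_mono s t u v : u <= v -> clamp s t u <= clamp s t v.
Proof.
move=> uv; rewrite /clamp ge_max le_max lexx /= le_max; apply/orP; right.
by rewrite le_min !ge_min lexx uv orbT.
Qed.

Lemma clamp_01 s t u : 0 <= s -> s <= t -> t <= 1 -> 0 <= clamp s t u <= 1.
Proof.
move=> s0 st t1; rewrite /clamp le_max s0 /= ge_max (le_trans st t1) /=.
by rewrite ge_min t1.
Qed.

Lemma clampl s t u : u <= s -> s <= t -> clamp s t u = s.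
Proof. by move=> us st; rewrite /clamp min_r ?max_l// (le_trans us). Qed.

Lemma clampr s t u : t <= u -> s <= t -> clamp s t u = t.
Proof. by move=> tu st; rewrite /clamp min_l ?max_r. Qed.

Lemma clampm s t u : s <= u -> u <= t -> clamp s t u = u.
Proof. by move=> su ut; rewrite /clamp min_r ?max_r. Qed.

Lemma clamp_lip s t u v : s <= t -> u <= v -> clamp s t v - clamp s t u <= v - u.
Proof.
move=> st uv.
have [us|su] := leP u s; have [vs|sv] := leP v s.
- by rewrite !clampl// subrr subr_ge0.
- rewrite (clampl us)//; have [vt|tv] := leP v t.
    by rewrite clampm ?(ltW sv)//; lra.
  by rewrite clampr ?(ltW tv)//; lra.
- by lra.
- have [vt|tv] := leP v t.
    by rewrite !clampm ?(ltW sv) ?(ltW su) ?(le_trans uv vt).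
  rewrite (clampr (ltW tv))//; have [ut|tu] := leP u t.
    by rewrite clampm ?(ltW su)//; lra.
  by rewrite clampr ?(ltW tu)//; lra.
Qed.

Definition ugrid (N k : nat) : R := k%:R / N%:R.

Definition usum xi (N : nat) s t : R :=
  \sum_(0 <= k < N) xi (clamp s t (ugrid N k)) (clamp s t (ugrid N k.+1)).

Lemma ugrid_mono N i j : (i <= j)%N -> ugrid N i <= ugrid N j.
Proof. by move=> ij; rewrite /ugrid ler_wpM2r ?invr_ge0 ?ler_nat. Qed.

Lemma ugridn N : ugrid N.+1 N.+1 = 1.
Proof. by rewrite /ugrid divff. Qed.

Lemma ugrid0 N : ugrid N 0 = 0.
Proof. by rewrite /ugrid mul0r. Qed.

Lemma ugridS N k : ugrid N k.+1 - ugrid N k = N%:R^-1.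
Proof. by rewrite /ugrid -mulrBl -natrB// subSnn mul1r. Qed.

Lemma ugridM N M k : ugrid (N.+1 * M.+1) (k * M.+1) = ugrid N.+1 k.
Proof. by rewrite /ugrid !natrM -mulf_div divff// mulr1. Qed.

Lemma subdivision_clamp N s t : 0 <= s -> s <= t -> t <= 1 ->
  subdivision (fun k => clamp s t (ugrid N k)).
Proof.
move=> s0 st t1; split=> [i|i j ij]; first exact: clamp_01.
by apply: clamp_mono; exact: ugrid_mono.
Qed.

Lemma sum_block (f : nat -> R) N M : \sum_(0 <= j < N * M) f j =
  \sum_(0 <= k < N) \sum_(k * M <= j < k.+1 * M) f j.
Proof.
elim: N => [|N IH]; first by rewrite !big_geq.
rewrite [RHS]big_nat_recr//= -IH (big_cat_nat (n := (N * M)%N))//.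
by rewrite leq_mul2r leqnSn orbT.
Qed.

Section limit.
Variables (om : R -> R -> R) (th A : R) (xi : R -> R -> R).
Hypothesis om_ctrl : control om.
Hypothesis th1 : 1 < th.
Hypothesis A0 : 0 <= A.
Hypothesis axi : almost_additive om th A xi.

Let pw s t := om s t `^ th.
Let K := sewing_cst th.

Lemma usum_close N s t : 0 <= s -> s <= t -> t <= 1 ->
  `|usum xi N.+1 s t - xi s t| <= K * A * pw s t.
Proof.
move=> s0 st t1; have := sewing om_ctrl th1 axi A0 (subdivision_clamp N.+1 s0 st t1) (leq0n N.+1).
by rewrite ugrid0 ugridn clampl// clampr.
Qed.

Lemma usum_refine N M s t : 0 <= s -> s <= t -> t <= 1 ->
  `|usum xi (N.+1 * M.+1) s t - usum xi N.+1 s t| <=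
  K * A * \sum_(0 <= k < N.+1) pw (clamp s t (ugrid N.+1 k)) (clamp s t (ugrid N.+1 k.+1)).
Proof.
move=> s0 st t1; rewrite /usum sum_block -sumrB big_distrr.
apply: le_trans (ler_norm_sum _ _ _) _; apply: ler_sum => k _.
have kk : (k * M.+1 <= k.+1 * M.+1)%N by rewrite leq_mul2r leqnSn orbT.
have := sewing om_ctrl th1 axi A0 (subdivision_clamp (N.+1 * M.+1) s0 st t1) kk.
by rewrite !ugridM.
Qed.

(** A grid step on one side of [u] contributes equally to both sides of the difference; only the
    step straddling [u] leaves a defect. *)
Lemma usum_split N s u t : 0 <= s -> s <= u -> u <= t -> t <= 1 ->
  `|usum xi N s u + usum xi N u t - usum xi N s t| <=
  A * \sum_(0 <= k < N) pw (clamp s t (ugrid N k)) (clamp s t (ugrid N k.+1)).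
Proof.
move=> s0 su ut t1; rewrite /usum -big_split -sumrB big_distrr.
apply: le_trans (ler_norm_sum _ _ _) _; apply: ler_sum => k _ /=.
set p := ugrid N k; set q := ugrid N k.+1.
have pq : p <= q by exact: ugrid_mono.
have st := le_trans su ut; have u0 := le_trans s0 su; have u1 := le_trans ut t1.
have pos : 0 <= A * pw (clamp s t p) (clamp s t q) by rewrite mulr_ge0 ?powR_ge0.
have [up|pu] := leP u p.
  have uq := le_trans up pq; rewrite (clampr up)// (clampr uq)//.
  rewrite (almost_additive_diag om_ctrl th1 axi)// add0r.
  have cE v : u <= v -> clamp u t v = clamp s t v.
    move=> uv; have [vt|tv] := leP v t; first by rewrite !clampm// (le_trans su).
    by rewrite !clampr// ltW.
  by rewrite !cE// subrr normr0.
have [qu|uq] := leP q u.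
  rewrite (clampl (ltW pu))// (clampl qu)//.
  rewrite (almost_additive_diag om_ctrl th1 axi)// addr0.
  have cE v : v <= u -> clamp s u v = clamp s t v.
    move=> vu; have [sv|vs] := leP s v; first by rewrite !clampm// (le_trans vu).
    by rewrite !clampl// ltW.
  by rewrite !cE ?(ltW pu)// subrr normr0.
have -> : clamp s u p = clamp s t p.
  have [sv|vs] := leP s p; first by rewrite !clampm// ?ltW// (lt_le_trans pu).
  by rewrite !clampl// ltW.
rewrite (clampr (ltW uq))// (clampl (ltW pu))//.
have -> : clamp u t q = clamp s t q.
  have [vt|tv] := leP q t; first by rewrite !clampm// ?ltW// (le_lt_trans su).
  by rewrite !clampr// ltW.
apply: axi.
- by case/andP: (clamp_01 p s0 st t1).
- by rewrite -{1}(clampm su ut); apply: clamp_mono; exact: ltW.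
- by rewrite -{1}(clampm su ut); apply: clamp_mono; exact: ltW.
- by case/andP: (clamp_01 q s0 st t1).
Qed.

Lemma ugrid_pw_small e : 0 < e -> exists N0, forall N s t, (N0 <= N)%N ->
  0 <= s -> s <= t -> t <= 1 ->
  \sum_(0 <= k < N) pw (clamp s t (ugrid N k)) (clamp s t (ugrid N k.+1)) <= e.
Proof.
move=> e0; have [d d0 dP] := powR_control_sum om_ctrl th1 e0.
exists (Num.trunc d^-1).+1 => N s t dN s0 st t1; apply: dP; first exact: subdivision_clamp.
move=> k kN; apply: le_lt_trans (clamp_lip st (ugrid_mono _ (leqnSn k))) _.
rewrite ugridS invf_plt ?posrE// ?ltr0n; last exact: leq_trans dN.
by apply: lt_le_trans (_ : (Num.trunc d^-1).+1%:R <= N%:R); rewrite ?truncnS_gt// ler_nat.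
Qed.

Lemma sewing_map : exists F : R -> R -> R,
  (forall s u t, 0 <= s -> s <= u -> u <= t -> t <= 1 -> F s u + F u t = F s t) /\
  (forall s t, 0 <= s -> s <= t -> t <= 1 -> `|F s t - xi s t| <= K * A * pw s t).
Proof.
have KA0 : 0 <= K * A by rewrite mulr_ge0// sewing_cst_ge0.
(* The conditions on [s] and [t] are put under the existential, so that choosing the limits gives a
   total function. *)
have cv s t : exists l : R, 0 <= s -> s <= t -> t <= 1 ->
    (fun n => usum xi n.+1 s t) @ \oo --> l.
  case: (pselect (0 <= s /\ s <= t /\ t <= 1)) => [[s0 [st t1]]|n]; last first.
    by exists 0 => s0 st t1; case: n.
  suff [l lP] : exists l : R, (fun n => usum xi n.+1 s t) @ \oo --> l by exists l.
  apply: cauchy_converges => e e0.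
  have e'0 : 0 < e / 2 / (K * A + 1) by rewrite !divr_gt0// ltr_wpDl.
  have [N0 NP] := ugrid_pw_small e'0; exists N0 => n Nn.
  have bnd N M : (N0 <= N)%N -> `|usum xi (N.+1 * M.+1) s t - usum xi N.+1 s t| <= e / 2.
    move=> N0N; apply: le_trans (usum_refine _ _ s0 st t1) _.
    apply: le_trans (_ : (K * A + 1) * (e / 2 / (K * A + 1)) <= _).
      apply: ler_pM => //; [by apply: sumr_ge0 => k _; exact: powR_ge0|by rewrite lerDl|].
      by apply: NP => //; exact: leq_trans N0N _.
    by rewrite mulrC divfK// gt_eqF// ltr_wpDl.
  have b1 := bnd n N0 Nn; have b2 := bnd N0 n (leqnn _).
  (* Two uniform grids are compared through their common refinement. *)
  rewrite (_ : usum xi n.+1 s t - usum xi N0.+1 s t =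
    (usum xi (N0.+1 * n.+1) s t - usum xi N0.+1 s t) -
    (usum xi (n.+1 * N0.+1) s t - usum xi n.+1 s t)); last by rewrite [(n.+1 * _)%N]mulnC; ring.
  by apply: le_trans (ler_normB _ _) _; lra.
pose F s t := sval (cid (cv s t)); have FP s t := svalP (cid (cv s t)).
exists F; split=> [s u t s0 su ut t1|s t s0 st t1].
  have st := le_trans su ut; have u0 := le_trans s0 su; have u1 := le_trans ut t1.
  have /cvgn_distP P1 := FP _ _ s0 su u1; have /cvgn_distP P2 := FP _ _ u0 ut t1.
  have /cvgn_distP P3 := FP _ _ s0 st t1.
  apply/eqP; rewrite -subr_eq0 -normr_le0; apply/ler_addgt0Pl => e e0; rewrite addr0.
  have e4 : 0 < e / 4 by rewrite divr_gt0.
  have e'0 : 0 < e / 4 / (A + 1) by rewrite !divr_gt0// ltr_wpDl.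
  have [N1 {}P1] := P1 _ e4; have [N2 {}P2] := P2 _ e4; have [N3 {}P3] := P3 _ e4.
  have [N4 P4] := ugrid_pw_small e'0.
  pose n := maxn (maxn N1 N2) (maxn N3 N4).
  have {}P1 := P1 n _; have {}P2 := P2 n _; have {}P3 := P3 n _.
  have {}P4 := P4 n.+1 s t _ s0 st t1; have P5 := usum_split n.+1 s0 su ut t1.
  have {}P5 : `|usum xi n.+1 s u + usum xi n.+1 u t - usum xi n.+1 s t| <= e / 4.
    apply: le_trans P5 _; apply: le_trans (_ : (A + 1) * (e / 4 / (A + 1)) <= _).
      apply: ler_pM => //; [by apply: sumr_ge0 => k _; exact: powR_ge0|by rewrite lerDl|].
      by apply: P4; rewrite /n; clear; lia.
    by rewrite mulrC divfK// gt_eqF// ltr_wpDl.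
  have {}P1 : `|usum xi n.+1 s u - F s u| <= e / 4 by apply: P1; rewrite /n; clear; lia.
  have {}P2 : `|usum xi n.+1 u t - F u t| <= e / 4 by apply: P2; rewrite /n; clear; lia.
  have {}P3 : `|usum xi n.+1 s t - F s t| <= e / 4 by apply: P3; rewrite /n; clear; lia.
  move: P1 P2 P3 P5; rewrite !ler_norml; clear; lra.
have /cvgn_distP P := FP _ _ s0 st t1; apply/ler_addgt0Pr => e /P[N /(_ N (leqnn _)) NP].
rewrite (_ : F s t - xi s t = (usum xi N.+1 s t - xi s t) - (usum xi N.+1 s t - F s t)); last by ring.
by apply: le_trans (ler_normB _ _) _; apply: lerD => //; exact: usum_close.
Qed.

End limit.
End sewing_map.

(** * Young differentials *)

Section shuffle_rcons.
Variable R : realType.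

Definition trder (c : 'I_2) (a : tensor R) : tensor R := fun w => a (rcons w c).

(** The shuffle recursion read from the end of the words. The last letter carries the outermost
    integration variable, so this is the form that matches the product rule. *)
Lemma tshuf_rcons (f : tensor R) a b u v : tshuf f (rcons u a) (rcons v b) =
  tshuf (trder a f) u (rcons v b) + tshuf (trder b f) (rcons u a) v.
Proof.
have [n] := ubnP (size u + size v); elim: n f u v => // n IH f u v le_n.
have cm (g : tensor R) c w : tder c (trder w g) = trder w (tder c g) by [].
case: u le_n => [|c u] le_n; case: v le_n => [|d v] le_n.
- by rewrite tshuf_cons !tshuf0l !tshuf0r addrC.
- rewrite [LHS]tshuf_cons (IH _ [::] v) ?tshuf0l; last by move: le_n; rewrite /=; lia.
  by rewrite [X in _ = _ + X]tshuf_cons tshuf0l cm addrCA.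
- rewrite [LHS]tshuf_cons (IH _ u [::]) ?tshuf0r; last by move: le_n; rewrite /=; lia.
  by rewrite [X in _ = X + _]tshuf_cons tshuf0r cm -!addrA; congr (_ + _); exact: addrC.
rewrite [LHS]tshuf_cons (IH _ u (d :: v)); last by move: le_n; rewrite /=; lia.
rewrite (IH _ (c :: u) v); last by move: le_n; rewrite /=; lia.
by rewrite [X in _ = X + _]tshuf_cons [X in _ = _ + X]tshuf_cons !cm addrACA.
Qed.

End shuffle_rcons.

Section differentials.
Variables (R : realType) (om : R -> R -> R) (th : R).
Hypothesis om_ctrl : control om.
Hypothesis th1 : 1 < th.
Variable x : 'I_2 -> R -> R.
Implicit Types (h g : R -> R) (f k : 'I_2 -> R -> R) (s t C : R).

(** Half of the exponent [th], as for the path itself: a product of two such increments is of order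
    [om ^ th]. *)
Definition om_lip h := exists2 C, 0 <= C & forall s t,
  0 <= s -> s <= t -> t <= 1 -> `|h t - h s| <= C * om s t `^ (th / 2).

Hypothesis x_lip : forall i s t, 0 <= s -> s <= t -> t <= 1 ->
  `|x i t - x i s| <= om s t `^ (th / 2).

(* [dh = \sum_i f i dx_i] in the sense of Young. *)
Definition has_diff h f := exists2 C, 0 <= C & forall s t,
  0 <= s -> s <= t -> t <= 1 ->
  `|h t - h s - \sum_i f i s * (x i t - x i s)| <= C * om s t `^ th.

Definition bounded01 h := exists2 C, 0 <= C & forall t, 0 <= t -> t <= 1 -> `|h t| <= C.

(** The coefficients of the one-form [h dx_i]. *)
Definition single i h : 'I_2 -> R -> R := fun j t => if j == i then h t else 0.

Let kp s t := om s t `^ (th / 2).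

Lemma sum_single i h s (d : 'I_2 -> R) : \sum_j single i h j s * d j = h s * d i.
Proof.
rewrite (bigD1 i)//= /single eqxx big1 ?addr0// => j /negPf ->.
by rewrite mul0r.
Qed.

Lemma half_powR s t : kp s t * kp s t = om s t `^ th.
Proof.
have th0 : th != 0 by rewrite gt_eqF// (lt_trans _ th1).
rewrite /kp -powRD; last by rewrite -splitr (negbTE th0).
by rewrite -splitr.
Qed.

Lemma half_powR_sub s u v t : 0 <= s -> s <= u -> u <= v -> v <= t ->
  t <= 1 -> kp u v <= kp s t.
Proof.
move=> s0 su uv vt t1; case: (om_ctrl) => om0 _ _.
rewrite ge0_ler_powR ?nnegrE//.
- by rewrite divr_ge0// ltW// (lt_trans _ th1).
- exact: om0 (le_trans s0 su) uv (le_trans vt t1).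
- exact: om0 s0 (le_trans su (le_trans uv vt)) t1.
- exact: (control_sub om_ctrl).
Qed.

Lemma powR_le_half s t : 0 <= s -> s <= t -> t <= 1 ->
  om s t `^ th <= kp 0 1 * kp s t.
Proof.
by move=> s0 st t1; rewrite -half_powR ler_wpM2r ?powR_ge0// half_powR_sub.
Qed.

Lemma om_lip_bounded h : om_lip h -> bounded01 h.
Proof.
move=> [C C0 hC]; exists (`|h 0| + C * kp 0 1); first by rewrite addr_ge0// mulr_ge0 ?powR_ge0.
move=> t t0 t1; rewrite -[h t](subrK (h 0)) addrC.
apply: le_trans (ler_normD _ _) _; rewrite lerD2l.
by apply: le_trans (hC _ _ (lexx 0) t0 t1) _; rewrite ler_wpM2l// half_powR_sub.
Qed.

Lemma om_lip_cst C : om_lip (fun=> C).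
Proof. by exists 0 => // s t _ _ _; rewrite subrr normr0 mul0r. Qed.

Lemma has_diff_lip h f : (forall i, bounded01 (f i)) -> has_diff h f -> om_lip h.
Proof.
move=> fb [C C0 hC]; pose B i := s2val (cid2 (fb i)).
have B0 i : 0 <= B i by exact: s2valP (cid2 (fb i)).
have BP i : forall t, 0 <= t -> t <= 1 -> `|f i t| <= B i by exact: s2valP' (cid2 (fb i)).
exists (\sum_i B i + C * kp 0 1).
  by rewrite addr_ge0 ?sumr_ge0// mulr_ge0 ?powR_ge0.
move=> s t s0 st t1; rewrite -[h t - h s](subrK (\sum_i f i s * (x i t - x i s))) addrC.
apply: le_trans (ler_normD _ _) _; rewrite mulrDl; apply: lerD.
  apply: le_trans (ler_norm_sum _ _ _) _; rewrite big_distrl; apply: ler_sum => i _ /=.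
  by rewrite normrM; apply: ler_pM => //; [apply: BP => //; exact: le_trans t1|exact: x_lip].
apply: le_trans (hC _ _ s0 st t1) _; rewrite -mulrA ler_wpM2l//.
exact: powR_le_half.
Qed.

Lemma has_diff_ext h h' f f' : (forall t, 0 <= t -> t <= 1 -> h t = h' t) ->
  (forall i t, 0 <= t -> t <= 1 -> f i t = f' i t) -> has_diff h f -> has_diff h' f'.
Proof.
move=> hh ff [C C0 hC]; exists C => // s t s0 st t1.
have t0 := le_trans s0 st; have s1 := le_trans st t1.
rewrite -!hh//; under eq_bigr do rewrite -ff//; exact: hC.
Qed.

Lemma has_diffD h g f k : has_diff h f -> has_diff g k ->
  has_diff (fun t => h t + g t) (fun i t => f i t + k i t).
Proof.
move=> [C C0 hC] [D D0 gD]; exists (C + D) => [|s t s0 st t1]; first exact: addr_ge0.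
under eq_bigr do rewrite mulrDl.
rewrite big_split /= mulrDl; set X := \sum_i _; set Y := \sum_i _.
rewrite (_ : _ - _ = (h t - h s - X) + (g t - g s - Y)); last by ring.
by apply: le_trans (ler_normD _ _) _; apply: lerD; [exact: hC|exact: gD].
Qed.

Lemma has_diffZ c h f : has_diff h f ->
  has_diff (fun t => c * h t) (fun i t => c * f i t).
Proof.
move=> [C C0 hC]; exists (`|c| * C) => [|s t s0 st t1]; first exact: mulr_ge0.
under eq_bigr do rewrite -mulrA.
by rewrite -big_distrr /= -!mulrBr normrM -mulrA ler_wpM2l//; exact: hC.
Qed.

Lemma has_diff_cst c : has_diff (fun=> c) (fun _ _ => 0).
Proof.
exists 0 => // s t _ _ _; rewrite subrr sub0r normrN big1 ?normr0 ?mul0r// => i _.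
by rewrite mul0r.
Qed.

Lemma has_diff_sum (T : Type) (r : seq T) (h : T -> R -> R) (f : T -> 'I_2 -> R -> R) :
  (forall y, has_diff (h y) (f y)) ->
  has_diff (fun t => \sum_(y <- r) h y t) (fun i t => \sum_(y <- r) f y i t).
Proof.
move=> hf; elim: r => [|y r IH].
  apply: has_diff_ext (has_diff_cst 0) => [t _ _|i t _ _]; by rewrite big_nil.
apply: has_diff_ext (has_diffD (hf y) IH) => [t _ _|i t _ _]; by rewrite big_cons.
Qed.

Lemma has_diff_x i : has_diff (x i) (single i (fun=> 1)).
Proof. by exists 0 => // s t _ _ _; rewrite sum_single mul1r subrr normr0 mul0r. Qed.

Lemma has_diffM h g f k : om_lip h -> om_lip g -> has_diff h f -> has_diff g k ->
  has_diff (fun t => h t * g t) (fun i t => h t * k i t + g t * f i t).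
Proof.
move=> hl gl [C C0 hC] [D D0 gD].
have [Bh Bh0 hB] := om_lip_bounded hl; have [Bg Bg0 gB] := om_lip_bounded gl.
move: hl gl => [Lh Lh0 hL] [Lg Lg0 gL].
exists (Bh * D + Bg * C + Lh * Lg); first by rewrite !addr_ge0// mulr_ge0.
move=> s t s0 st t1; under eq_bigr do rewrite mulrDl -!mulrA.
rewrite big_split /= -!big_distrr /=.
have {}hC := hC s t s0 st t1; have {}gD := gD s t s0 st t1.
set X := \sum_i _ in gD *; set Y := \sum_i _ in hC *.
rewrite (_ : _ - _ = h s * (g t - g s - X) + g s * (h t - h s - Y) +
  (h t - h s) * (g t - g s)); last by ring.
rewrite [leRHS]mulrDl [X in _ <= X + _]mulrDl; have s1 := le_trans st t1.
apply: le_trans (ler_normD _ _) _; apply: lerD.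
  apply: le_trans (ler_normD _ _) _; apply: lerD; rewrite normrM -mulrA.
    by apply: ler_pM => //; exact: hB.
  by apply: ler_pM => //; exact: gB.
by rewrite normrM -half_powR mulrACA; apply: ler_pM => //; [exact: hL|exact: gL].
Qed.

(** The counterpart of a vanishing derivative: telescoping along a fine grid, the increments sum to
    an arbitrarily small quantity because [th > 1]. *)
Lemma eq_increments h C : 0 <= C -> (forall s t, 0 <= s -> s <= t -> t <= 1 ->
  `|h t - h s| <= C * om s t `^ th) -> forall t, 0 <= t -> t <= 1 -> h t = h 0.
Proof.
move=> C0 hC t t0 t1; apply/eqP; rewrite -subr_eq0 -normr_le0.
apply/ler_addgt0Pl => e e0; rewrite addr0.
have e'0 : 0 < e / (C + 1) by rewrite divr_gt0// ltr_wpDl.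
have [N0 N0P] := ugrid_pw_small om_ctrl th1 e'0.
have := N0P N0.+1 0 t (leqnSn _) (lexx 0) t0 t1.
set tau := fun j : nat => clamp 0 t (ugrid R N0.+1 j) => small.
have [tau01 taum] := subdivision_clamp N0.+1 (lexx 0) t0 t1.
have -> : h t - h 0 = \sum_(0 <= j < N0.+1) (h (tau j.+1) - h (tau j)).
  have c1 : tau N0.+1 = t by rewrite /tau ugridn clampr.
  have c0 : tau 0%N = 0 by rewrite /tau ugrid0 clampl.
  by rewrite (telescope_sumr (fun j => h (tau j)))// c1 c0.
apply: le_trans (ler_norm_sum _ _ _) _.
apply: (@le_trans _ _ (\sum_(0 <= j < N0.+1) C * om (tau j) (tau j.+1) `^ th)).
  apply: ler_sum => j _; apply: hC; first by case/andP: (tau01 j).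
    exact: taum.
  by case/andP: (tau01 j.+1).
rewrite -big_distrr /=; apply: le_trans (_ : (C + 1) * (e / (C + 1)) <= _); last first.
  by rewrite mulrC divfK// gt_eqF// ltr_wpDl.
by apply: ler_pM => //; [apply: sumr_ge0 => j _; exact: powR_ge0|rewrite lerDl].
Qed.

Lemma has_diff_uniq h h' f : has_diff h f -> has_diff h' f -> h 0 = h' 0 ->
  forall t, 0 <= t -> t <= 1 -> h t = h' t.
Proof.
move=> [C C0 hC] [D D0 hD] h0 t t0 t1.
apply/eqP; rewrite -subr_eq0; apply/eqP.
have := @eq_increments (fun t => h t - h' t) (C + D); rewrite h0 subrr; apply=> //.
  exact: addr_ge0.
move=> s u s0 su u1; rewrite mulrDl; set X := \sum_i f i s * (x i u - x i s).
rewrite (_ : _ - _ = (h u - h s - X) - (h' u - h' s - X)); last by ring.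
by apply: le_trans (ler_normB _ _) _; apply: lerD; [exact: hC|exact: hD].
Qed.

(** Sewing applied to the germ [h s * (x i t - x i s)], whose defect is the product of an increment
    of [h] and one of [x i]. *)
Lemma has_diff_exists i h : om_lip h -> exists2 H, H 0 = 0 & has_diff H (single i h).
Proof.
move=> [C C0 hC]; pose xi s t := h s * (x i t - x i s).
have axi : almost_additive om th C xi.
  move=> s u t s0 su ut t1; rewrite /xi.
  rewrite (_ : _ - _ = (h u - h s) * (x i t - x i u)); last by ring.
  rewrite normrM -half_powR mulrA; have u1 := le_trans ut t1; have u0 := le_trans s0 su.
  apply: ler_pM => //.
    by apply: le_trans (hC _ _ s0 su u1) _; rewrite ler_wpM2l// half_powR_sub.
  by apply: le_trans (x_lip _ u0 ut t1) _; exact: half_powR_sub.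
have [F [Fadd Fxi]] := sewing_map om_ctrl th1 C0 axi.
exists (F 0).
  by have := Fadd 0 0 0 (lexx 0) (lexx 0) (lexx 0) ler01; lra.
exists (sewing_cst th * C); first by rewrite mulr_ge0// sewing_cst_ge0.
move=> s t s0 st t1; rewrite sum_single.
by rewrite -(Fadd 0 s t (lexx 0) s0 st t1) [F 0 s + _]addrC addrK; exact: Fxi.
Qed.

Lemma itv_partition_subdivision a b (r : seq R) : 0 <= a -> b <= 1 ->
  itv_partition a b r -> subdivision (nth b (a :: r)).
Proof.
move=> a0 b1 abr; 
have ab := itv_partition_le abr.
split=> [j|j l jl].
  have [jr|rj] := ltnP j (size r).+1.
    by rewrite (le_trans a0 (itv_partition_nth_ge jr abr)) (le_trans (itv_partition_nth_le jr abr)).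
  by rewrite nth_default// b1 (le_trans a0).
have [lr|rl] := ltnP l (size r).+1; last first.
  rewrite [leRHS]nth_default//; have [jr|rj] := ltnP j (size r).+1; first exact: itv_partition_nth_le.
  by rewrite nth_default.
have /(sorted_leq_nth le_trans le_refl) : sorted <=%O (a :: r).
  by case: abr => + _; apply: sub_path => ? ? /ltW.
by apply=> //; rewrite ?inE//; exact: leq_ltn_trans jl lr.
Qed.

(** Tags are arbitrary because moving one inside its step changes the term by an increment of [h]
    times an increment of [x i], again of order [om ^ th]. *)
Lemma has_diff_young i h H a b : om_lip h -> has_diff H (single i h) ->
  0 <= a -> b <= 1 -> is_young_integral a b h (x i) (H b - H a).
Proof.
move=> [L L0 hL] [C C0 HC] a0 b1 e e0.
have e'0 : 0 < e / 2 / (L + C + 1) by rewrite !divr_gt0// ltr_wpDl// addr_ge0.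
have [d d0 dP] := powR_control_sum om_ctrl th1 e'0.
exists d => // r tag tau abr mesh tagP.
have tau_s := itv_partition_subdivision a0 b1 abr.
have small := dP _ (size r) tau_s mesh; rewrite -/tau in tau_s small.
have [tau01 taum] := tau_s.
have t0 j : 0 <= tau j by case/andP: (tau01 j).
have t1 j : tau j <= 1 by case/andP: (tau01 j).
have -> : H b - H a = \sum_(0 <= j < size r) (H (tau j.+1) - H (tau j)).
  rewrite telescope_sumr// /tau; congr (H _ - H _).
  by rewrite -last_nth; case: abr => _ /eqP.
rewrite -sumrB; apply: le_lt_trans (ler_norm_sum _ _ _) _.
apply: (@le_lt_trans _ _ (\sum_(0 <= j < size r) (L + C) * om (tau j) (tau j.+1) `^ th)).
  rewrite big_nat [leRHS]big_nat; apply: ler_sum => j /andP[_ jr].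
  have tt := taum _ _ (leqnSn j); have /andP[tag1 tag2] := tagP j jr.
  have := HC _ _ (t0 j) tt (t1 _); rewrite sum_single => hc.
  set dx := x i _ - x i _ in hc *; set dH := H _ - H _ in hc *.
  rewrite (_ : _ - _ = (h (tag j) - h (tau j)) * dx - (dH - h (tau j) * dx)); last by ring.
  apply: le_trans (ler_normB _ _) _; rewrite [leRHS]mulrDl; apply: lerD => //.
  rewrite normrM -half_powR mulrA; apply: ler_pM => //; last exact: x_lip.
  apply: le_trans (hL _ _ (t0 j) tag1 (le_trans tag2 (t1 _))) _.
  by rewrite ler_wpM2l// half_powR_sub.
rewrite -big_distrr /=; apply: (@le_lt_trans _ _ ((L + C + 1) * (e / 2 / (L + C + 1)))).
  apply: ler_pM => //; [exact: addr_ge0|by apply: sumr_ge0 => j _; exact: powR_ge0|by rewrite lerDl].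
rewrite mulrC divfK; last by rewrite gt_eqF// ltr_wpDl// addr_ge0.
by rewrite ltr_pdivrMr// ltr_pMr// ltr1n.
Qed.

End differentials.

Section young.
Variable R : realType.
Implicit Types (a b d l : R) (f g : R -> R).

Lemma fine_itv_partition a b d : 0 < d -> a <= b -> exists2 r : seq R,
  itv_partition a b r & forall k, (k < size r)%N ->
    nth b (a :: r) k.+1 - nth b (a :: r) k < d.
Proof.
move=> d0; rewrite le_eqVlt => /predU1P[<-|ab].
  by exists [::] => //; rewrite /itv_partition /= eqxx.
pose N := (Num.trunc ((b - a) / d)).+1.
pose t (k : nat) := a + k%:R * ((b - a) / N%:R).
have st : 0 < (b - a) / N%:R by rewrite divr_gt0// subr_gt0.
have std : (b - a) / N%:R < d.
  by rewrite ltr_pdivrMr// mulrC -ltr_pdivrMr// truncnS_gt.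
have N0 : (N%:R : R) != 0 by rewrite pnatr_eq0.
have tN : t N = b by rewrite /t; field.
have t0 : t 0%N = a by rewrite /t mul0r addr0.
have tS k : t k.+1 - t k = (b - a) / N%:R by rewrite /t -natr1; ring.
have nthE k : (k <= N)%N -> nth b (a :: mkseq (t \o succn) N) k = t k.
  case: k => [|k] kN; first by rewrite /= t0.
  by rewrite /= nth_mkseq.
exists (mkseq (t \o succn) N); last first.
  move=> k; rewrite size_mkseq => kN.
  by rewrite !nthE// ?tS// ltnW.
split.
  apply/(pathP b) => k; rewrite size_mkseq => kN.
  rewrite -[X in nth b X k]/(a :: mkseq (t \o succn) N) in nthE *.
  by rewrite nthE ?(ltnW kN)// nth_mkseq//= -subr_gt0 tS.
by rewrite (last_nth b) size_mkseq nthE// tN.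
Qed.

Lemma young_integralE a b f g l : a <= b -> is_young_integral a b f g l ->
  young_integral a b f g = l.
Proof.
move=> ab il; rewrite /young_integral.
case: xgetP => [m _ /= im|/(_ l)//].
apply/eqP; rewrite -subr_eq0 -normr_le0; apply/ler_addgt0Pl => e e0; rewrite addr0.
have e20 : 0 < e / 2 by rewrite divr_gt0.
have [d1 d10 P1] := il _ e20; have [d2 d20 P2] := im _ e20.
have [|r abr mesh] := @fine_itv_partition a b (Num.min d1 d2) _ ab.
  by rewrite lt_min d10.
pose tag := nth b (a :: r).
have tagP k : (k < size r)%N -> nth b (a :: r) k <= tag k <= nth b (a :: r) k.+1.
  move=> kr; rewrite lexx /= ltW//; case: abr => /(pathP b) H _; exact: H.
have {}P1 : `|\sum_(0 <= k < size r) f (tag k) * (g (tag k.+1) - g (tag k)) - l| < e / 2.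
  by apply: P1 => // k kr; apply: lt_le_trans (mesh k kr) _; rewrite ge_min lexx.
have {}P2 : `|\sum_(0 <= k < size r) f (tag k) * (g (tag k.+1) - g (tag k)) - m| < e / 2.
  by apply: P2 => // k kr; apply: lt_le_trans (mesh k kr) _; rewrite ge_min lexx orbT.
move: P1 P2; set S := \sum_(_ <= _ < _) _ => P1 P2.
rewrite (_ : m - l = (S - l) - (S - m)); last by ring.
by apply: le_trans (ler_normB _ _) _; move: P1 P2; lra.
Qed.

End young.

(** * The signature *)

Section signature_facts.
Variables (R : realType) (om : R -> R -> R) (th : R) (gamma : R -> R * R).
Hypothesis om_ctrl : control om.
Hypothesis th1 : 1 < th.
Let x := coordinate gamma.
Hypothesis x_lip : forall i s t, 0 <= s -> s <= t -> t <= 1 ->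
  `|x i t - x i s| <= om s t `^ (th / 2).
Implicit Types (h g : R -> R) (f : 'I_2 -> R -> R) (s t : R) (i a b : 'I_2) (w u v : word).

Let lip := om_lip om th.
Let diff := has_diff om th x.
Let it := iterated_integral gamma.

Lemma om_lipM h g : lip h -> lip g -> lip (fun t => h t * g t).
Proof.
move=> hl gl.
have [B B0 hB] := om_lip_bounded om_ctrl th1 hl; have [D D0 gD] := om_lip_bounded om_ctrl th1 gl.
move: hl gl => [L L0 hL] [M M0 gM]; exists (B * M + D * L).
  by rewrite addr_ge0// mulr_ge0.
move=> s t s0 st t1; rewrite (_ : _ - _ = h s * (g t - g s) + g t * (h t - h s)); last by ring.
rewrite [leRHS]mulrDl; apply: le_trans (ler_normD _ _) _; apply: lerD; rewrite normrM -mulrA; apply: ler_pM => //.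
- by apply: hB => //; exact: le_trans t1.
- exact: gM.
- by apply: gD => //; exact: le_trans st.
- exact: hL.
Qed.

Lemma om_lipX h n : lip h -> lip (fun t => h t ^+ n).
Proof.
move=> hl; elim: n => [|n IH]; first exact: om_lip_cst.
have [C C0 CP] := om_lipM hl IH; exists C => // s t s0 st t1.
by rewrite !exprS; exact: CP.
Qed.

Lemma om_lip_single_bounded i h : lip h -> forall j, bounded01 (single i h j).
Proof.
move=> /(om_lip_bounded om_ctrl th1)[C C0 hC] j; exists C => // t t0 t1.
by rewrite /single; case: eqP => _; [exact: hC|rewrite normr0].
Qed.

(** Regularity of one iterated integral is what allows the next one to exist, and it follows from
    the differential; hence the joint induction. *)
Lemma iterated_integral_facts w : lip (it w) /\
  forall i, it (i :: w) 0 = 0 /\ diff (it (i :: w)) (single i (it w)).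
Proof.
have step w' : lip (it w') -> forall i,
    it (i :: w') 0 = 0 /\ diff (it (i :: w')) (single i (it w')).
  move=> lw i; have [H H0 dH] := has_diff_exists om_ctrl th1 x_lip i lw.
  have E t : 0 <= t -> t <= 1 -> it (i :: w') t = H t.
    move=> t0 t1; apply: young_integralE => //.
    by have := has_diff_young om_ctrl th1 x_lip lw dH (lexx 0) t1; rewrite H0 subr0.
  split; first by rewrite E.
  by apply: has_diff_ext dH => // t t0 t1; rewrite E.
elim: w => [|i w [IH1 IH2]].
  by split; [exact: om_lip_cst|apply: step; exact: om_lip_cst].
have lw : lip (it (i :: w)).
  have [_ d] := IH2 i.
  exact: (has_diff_lip om_ctrl th1 x_lip (om_lip_single_bounded i IH1) d).
by split=> //; exact: step.
Qed.

Lemma om_lip_it w : lip (it w). Proof. exact: (iterated_integral_facts w).1. Qed.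

Lemma it0 i w : it (i :: w) 0 = 0.
Proof. exact: ((iterated_integral_facts w).2 i).1. Qed.

Lemma has_diff_it i w : diff (it (i :: w)) (single i (it w)).
Proof. exact: ((iterated_integral_facts w).2 i).2. Qed.

Let S t : tensor R := fun w => it (rev w) t.

(** Both sides start at 0 and have the same differential: the last-letter recursion gives it for the
    shuffle, the product rule for the product, and the induction hypothesis identifies the
    coefficients. *)
Lemma tshuf_it u v t : 0 <= t -> t <= 1 -> tshuf (S t) u v = S t u * S t v.
Proof.
have [n] := ubnP (size u + size v); elim: n u v t => // n IH u v t le_n t0 t1.
case/lastP: u le_n => [|u a] le_n; first by rewrite tshuf0l mul1r.
case/lastP: v le_n => [|v b] le_n; first by rewrite tshuf0r mulr1.
have Scons s w c : S s (rcons w c) = it (c :: rev w) s by rewrite /S rev_rcons.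
have d1 : diff (fun t => tshuf (S t) (rcons u a) (rcons v b)) (fun i t =>
    single a (fun t => S t u * S t (rcons v b)) i t +
    single b (fun t => S t (rcons u a) * S t v) i t).
  apply: (@has_diff_ext _ om th x (fun t =>
     \sum_(w <- shuffle u (rcons v b)) it (a :: rev w) t +
     \sum_(w <- shuffle (rcons u a) v) it (b :: rev w) t) _ (fun i t =>
     \sum_(w <- shuffle u (rcons v b)) single a (it (rev w)) i t +
     \sum_(w <- shuffle (rcons u a) v) single b (it (rev w)) i t)).
  - move=> s s0 s1; rewrite tshuf_rcons /tshuf /trder.
    by congr (_ + _); apply: eq_bigr => w _; rewrite Scons.
  - move=> i s s0 s1; rewrite /single; congr (_ + _); case: eqP => _.
    + by rewrite -IH//; move: le_n; rewrite !size_rcons; clear; lia.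
    + by rewrite big1.
    + by rewrite -IH//; move: le_n; rewrite !size_rcons; clear; lia.
    + by rewrite big1.
  - by apply: has_diffD; apply: has_diff_sum => w; exact: has_diff_it.
have d2 : diff (fun t => S t (rcons u a) * S t (rcons v b)) (fun i t =>
    single a (fun t => S t u * S t (rcons v b)) i t +
    single b (fun t => S t (rcons u a) * S t v) i t).
  have d := has_diffM om_ctrl th1 (om_lip_it (a :: rev u)) (om_lip_it (b :: rev v))
     (has_diff_it a (rev u)) (has_diff_it b (rev v)).
  apply: has_diff_ext d => [s _ _|i s _ _]; first by rewrite /S !rev_rcons.
  rewrite /S !rev_rcons /single addrC; congr (_ + _); case: eqP => _ //; rewrite ?mulr0//.
  by rewrite mulrC.
apply: (has_diff_uniq om_ctrl th1 d1 d2) => //.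
rewrite !Scons it0 mul0r /tshuf big_seq big1// => w.
case/lastP: w => [/size_shuffle|w c _]; first by rewrite !size_rcons.
by rewrite Scons it0.
Qed.

Lemma grouplike_signature : grouplike (signature gamma).
Proof. by split=> // u v; exact: tshuf_it. Qed.

Hypothesis gamma_closed : gamma 0 = gamma 1.

Let X i t := x i t - x i 0.

Let X1 i : X i 1 = 0.
Proof. by rewrite /X /x /coordinate gamma_closed subrr. Qed.

Let diff_X i : diff (X i) (single i (fun=> 1)).
Proof.
have := has_diffD (has_diff_x om th x i) (has_diff_cst om th x (- x i 0)).
by apply: has_diff_ext => // j s _ _; rewrite addr0.
Qed.

Let lip_X i : lip (X i).
Proof.
have l1 := om_lip_single_bounded i (om_lip_cst om th 1).
exact: (has_diff_lip om_ctrl th1 x_lip l1 (diff_X i)).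
Qed.

Lemma has_diff_expX i n :
  diff (fun t => X i t ^+ n.+1) (single i (fun t => n.+1%:R * X i t ^+ n)).
Proof.
elim: n => [|n IH].
  apply: has_diff_ext (diff_X i) => [t _ _|j t _ _]; first by rewrite expr1.
  by rewrite /single; case: eqP => _ //; rewrite expr0 mulr1.
have d := has_diffM om_ctrl th1 (lip_X i) (om_lipX n.+1 (lip_X i)) (diff_X i) IH.
apply: has_diff_ext d => [t _ _|j t _ _]; first by rewrite -exprS.
by rewrite /single; case: eqP => _; rewrite ?mulr0 ?addr0// -[n.+2%:R]natr1 exprS; ring.
Qed.

Lemma has_diff_expX_fact i n c :
  diff (fun t => (c * X i t) ^+ n.+1 / n.+1`!%:R)
       (single i (fun t => c * ((c * X i t) ^+ n / n`!%:R))).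
Proof.
have := has_diffZ (c ^+ n.+1 / n.+1`!%:R) (has_diff_expX i n).
apply: has_diff_ext => [t _ _|j t _ _]; first by rewrite exprMn; ring.
rewrite /single; case: eqP => _; rewrite ?mulr0// factS natrM invfM exprMn exprS.
have nf : (n`!%:R : R) != 0 by rewrite pnatr_eq0 -lt0n fact_gt0.
have n1 : (n.+1%:R : R) != 0 by rewrite pnatr_eq0.
by move: n1 nf; move: (n.+1%:R : R) (n`!%:R : R) => p q p0 q0; field; rewrite p0 q0.
Qed.

Lemma it_nseq i n t : 0 <= t -> t <= 1 -> it (nseq n i) t = X i t ^+ n / n`!%:R.
Proof.
elim: n t => [|n IH] t t0 t1; first by rewrite expr0 divr1.
have d1 := has_diff_it i (nseq n i); have d2 := has_diff_expX_fact i n 1.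
apply: (has_diff_uniq om_ctrl th1 d1 (h' := fun t => X i t ^+ n.+1 / n.+1`!%:R)) => //.
  apply: has_diff_ext d2 => [s _ _|j s s0 s1]; first by rewrite mul1r.
  by rewrite /single; case: eqP => _//; rewrite !mul1r IH.
by rewrite it0 /X subrr expr0n /= mul0r.
Qed.

Lemma signature_nseq i n : signature gamma (nseq n.+1 i) = 0.
Proof.
have -> : signature gamma (nseq n.+1 i) = it (nseq n.+1 i) 1.
  rewrite /signature /it; congr (iterated_integral _ _ _).
  exact: rev_nseq.
by rewrite it_nseq// X1 expr0n mul0r.
Qed.

(** Repeated integration by parts. Each step lowers the power of [- X e2] by one and prepends a
    letter [e2] to [w]; boundary terms vanish at 0 because iterated integrals start at 0, and at 1
    because the curve is closed. *)
Lemma iterated_by_parts w k h : h 0 = 0 ->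
  diff h (single e2 (fun t => it w t * ((- X e2 t) ^+ k / k`!%:R))) ->
  h 1 = it (nseq k.+1 e2 ++ w) 1.
Proof.
elim: k w h => [|k IH] w h h0 dh.
  apply: (has_diff_uniq om_ctrl th1 _ (has_diff_it e2 w)) => //; last by rewrite it0.
  by apply: has_diff_ext dh => // j t _ _; rewrite /single; case: eqP => _ //; rewrite expr0 divr1 mulr1.
pose E t := (- 1 * X e2 t) ^+ k.+1 / k.+1`!%:R.
have dE : diff E _ := has_diff_expX_fact e2 k (- 1).
have lE : lip E.
  rewrite /E; apply: om_lipM (om_lip_cst _ _ _); apply: om_lipX.
  by apply: om_lipM (lip_X e2); exact: om_lip_cst.
have d := has_diffM om_ctrl th1 (om_lip_it (e2 :: w)) lE (has_diff_it e2 w) dE.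
(* Subtracting [it (e2 :: w) * E] cancels the differential of [h]; the sign in the derivative of a
   power of [- X e2] makes the remaining term positive. *)
have := IH (e2 :: w) (fun t => h t + (-1) * (it (e2 :: w) t * E t)).
rewrite h0 it0 mul0r mulr0 addr0 /E X1 mulr0 expr0n mul0r mulr0 mulr0 addr0.
have -> : nseq k.+2 e2 ++ w = nseq k.+1 e2 ++ e2 :: w.
  by rewrite -cat_rcons; congr (_ ++ _); elim: (k.+1) => //= m <-.
move=> -> //.
apply: has_diff_ext (has_diffD dh (has_diffZ (-1) d)) => // j t _ _.
rewrite /single; case: eqP => _; last by rewrite !(mulr0, addr0).
by rewrite /E !mulN1r; ring.
Qed.

Lemma signature_e1e2 n k h : h 0 = 0 ->
  diff h (single e2 (fun t => X e1 t ^+ n.+1 / n.+1`!%:R * (X e2 t ^+ k / k`!%:R))) ->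
  signature gamma (nseq n.+1 e1 ++ nseq k.+1 e2) = (-1) ^+ k * h 1.
Proof.
move=> h0 dh.
have -> : signature gamma (nseq n.+1 e1 ++ nseq k.+1 e2) =
          it (nseq k.+1 e2 ++ nseq n.+1 e1) 1.
  by rewrite /signature /it rev_cat !rev_nseq.
symmetry; apply: (@iterated_by_parts (nseq n.+1 e1) k (fun t => (-1) ^+ k * h t)).
  by rewrite h0 mulr0.
apply: has_diff_ext (has_diffZ ((-1) ^+ k) dh) => // j t t0 t1.
rewrite /single; case: eqP => _; last by rewrite mulr0.
by rewrite it_nseq// -[in RHS]mulN1r exprMn; ring.
Qed.

End signature_facts.

(** * The control of a path of finite p-variation *)

Section continuity01.
Variable R : realType.
Implicit Types (h : R -> R) (s t e d : R).

Definition continuous01 h := forall t, 0 <= t -> t <= 1 -> forall e, 0 < e ->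
  exists2 d, 0 < d & forall s, 0 <= s -> s <= 1 -> `|s - t| < d -> `|h s - h t| < e.

Lemma continuous01P h : {within `[0, 1], continuous h} <-> continuous01 h.
Proof.
rewrite subspace_continuousP; split=> H t.
  move=> t0 t1 e e0; have tI : `[0, 1]%classic t by rewrite /= in_itv /= t0.
  have /cvgrPdist_lt/(_ e e0) := H t tI; rewrite near_withinE.
  move=> /nbhs_ballP[d d0 dP]; exists d => // s s0 s1 sd; rewrite distrC.
  by apply: dP; rewrite /= ?in_itv /= ?s0// -ball_normE /= distrC.
rewrite /= in_itv /= => /andP[t0 t1]; apply/cvgrPdist_lt => e e0.
rewrite near_withinE; have [d d0 dP] := H t t0 t1 e e0.
apply/nbhs_ballP; exists d => // s; rewrite -ball_normE /= distrC => sd.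
by rewrite in_itv /= => /andP[s0 s1]; rewrite distrC; exact: dP.
Qed.

Lemma uniform_continuous01 h : continuous01 h -> forall e, 0 < e ->
  exists2 d, 0 < d & forall s t, 0 <= s -> s <= 1 -> 0 <= t -> t <= 1 ->
    `|s - t| < d -> `|h s - h t| < e.
Proof.
move=> hc e e0; have /compact_near_coveringP K := @segment_compact R 0 1.
pose P (d t : R) := forall s, 0 <= s -> s <= 1 -> 0 <= t -> t <= 1 -> `|s - t| < d -> `|h s - h t| < e.
suff U : \forall d \near 0^'+, `[0, 1]%classic `<=` P d.
  have /filter_ex[d [d0 dP]] : \forall d \near (0 : R)^'+, 0 < d /\ `[0, 1]%classic `<=` P d.
    by apply: filterI => //; exact: nbhs_right_gt.
  exists d => // s t s0 s1 t0 t1; apply: dP => //.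
  by rewrite /= in_itv /= t0.
apply: K => t; rewrite /= in_itv /= => /andP[t0 t1].
have e20 : 0 < e / 2 by rewrite divr_gt0.
have [d d0 dP] := hc t t0 t1 _ e20; have d20 : 0 < d / 2 by rewrite divr_gt0.
  exists ([set t' | `|t' - t| < d / 2], [set d' | d' < d / 2]); first split => /=.
  - by apply/nbhs_ballP; exists (d / 2) => // t'; rewrite -ball_normE /= distrC.
  - exact: nbhs_right_lt.
  move=> [t' d'] /= [tt' dd'] s s0 s1 t'0 t'1 st'.
  have A : `|h s - h t| < e / 2.
    apply: dP => //; rewrite -(subrK t' s) -addrA (le_lt_trans (ler_normD _ _))//.
    by move: st' tt' dd'; lra.
  have B : `|h t' - h t| < e / 2 by apply: dP => //; move: tt'; lra.
  rewrite (_ : h s - h t' = (h s - h t) - (h t' - h t)); last by ring.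
  by rewrite (le_lt_trans (ler_normB _ _))//; move: A B; lra.
Qed.

Lemma continuous01_fst (gamma : R -> R * R) : {within `[0, 1], continuous gamma} ->
  continuous01 (fun t => (gamma t).1).
Proof.
move=> /subspace_continuousP H; apply/continuous01P/subspace_continuousP.
by move=> t tI; apply: (@cvg_comp _ _ _ gamma fst _ _ _ (H t tI)); exact: cvg_fst.
Qed.

Lemma continuous01_snd (gamma : R -> R * R) : {within `[0, 1], continuous gamma} ->
  continuous01 (fun t => (gamma t).2).
Proof.
move=> /subspace_continuousP H; apply/continuous01P/subspace_continuousP.
by move=> t tI; apply: (@cvg_comp _ _ _ gamma snd _ _ _ (H t tI)); exact: cvg_snd.
Qed.

End continuity01.

Section pvariation_control.
Variables (R : realType) (p : R) (gamma : R -> R * R).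
Implicit Types (s t u e d q : R) (r : seq R).
Hypothesis p12 : 1 <= p < 2.
Hypothesis gamma_cont : {within `[0, 1], continuous gamma}.
Hypothesis gamma_var : finite_pvariation p gamma.

Let len s t := enorm (gamma t - gamma s).

Fixpoint pvar_sum q s r : R :=
  if r is t :: r' then len s t `^ q + pvar_sum q t r' else 0.

Lemma enorm_ge0 (z : R * R) : 0 <= enorm z.
Proof. exact: sqrtr_ge0. Qed.

Lemma enorm_ge1 (z : R * R) : `|z.1| <= enorm z.
Proof. by rewrite -sqrtr_sqr ler_wsqrtr// lerDl sqr_ge0. Qed.

Lemma enorm_ge2 (z : R * R) : `|z.2| <= enorm z.
Proof. by rewrite -sqrtr_sqr ler_wsqrtr// lerDr sqr_ge0. Qed.

Lemma enorm_le (z : R * R) : enorm z <= `|z.1| + `|z.2|.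
Proof.
have s0 : 0 <= `|z.1| + `|z.2| by rewrite addr_ge0.
rewrite -[leRHS]ger0_norm// -sqrtr_sqr ler_wsqrtr// sqrrD !real_normK ?num_real//.
by rewrite addrAC lerDl mulrn_wge0// mulr_ge0.
Qed.

Lemma pvar_sum_ge0 q s r : 0 <= pvar_sum q s r.
Proof. by elim: r s => //= t r IH s; rewrite addr_ge0 ?powR_ge0. Qed.

Lemma pvar_sum_cat q s r1 r2 :
  pvar_sum q s (r1 ++ r2) = pvar_sum q s r1 + pvar_sum q (last s r1) r2.
Proof. by elim: r1 s => [|t r1 IH] s /=; rewrite ?add0r// IH addrA. Qed.

Lemma pvar_sumE q s b r : pvar_sum q s r = \sum_(0 <= k < size r)
  len (nth b (s :: r) k) (nth b (s :: r) k.+1) `^ q.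
Proof.
elim: r s => [|t r IH] s; first by rewrite big_geq.
by rewrite /= big_nat_recl//= IH.
Qed.

(** Partitions of a subinterval are completed to partitions of [[0, 1]]. As partitions are strictly
    increasing, 0 and 1 are adjoined only where they differ from the endpoints. *)
Lemma pvar_sum_bounded : exists2 M, 0 <= M & forall s t r, 0 <= s -> t <= 1 ->
  itv_partition s t r -> pvar_sum p s r <= M.
Proof.
have [M HM] := gamma_var.
have H r : itv_partition 0 1 r -> pvar_sum p 0 r <= M.
  by move=> /HM; rewrite (pvar_sumE _ _ 1).
have part1 : itv_partition 0 1 [:: (1 : R)] by rewrite /itv_partition /= ltr01 eqxx.
exists M; first by apply: le_trans (H _ part1); exact: pvar_sum_ge0.
move=> s t r s0 t1 str; have st := itv_partition_le str.
have [r1 r1P le1] : exists2 r1, itv_partition 0 t r1 & pvar_sum p s r <= pvar_sum p 0 r1.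
  have [s00|sn0] := eqVneq s 0; first by exists r; rewrite -s00.
  exists (s :: r); last by rewrite /= lerDr powR_ge0.
  by case: str => sr lr; split => //=; rewrite sr andbT lt_def sn0.
apply: le_trans le1 _.
have {st} t0 := le_trans s0 st.
have [t11|tn1] := eqVneq t 1; first by apply: H; rewrite -t11.
apply: le_trans (H (r1 ++ [:: 1]) _).
  by rewrite pvar_sum_cat lerDl pvar_sum_ge0.
apply: itv_partition_cat r1P _; rewrite /itv_partition /= eqxx andbT; split=> //.
by rewrite lt_def t1 eq_sym tn1.
Qed.

Lemma itv_partition_head s t u r : itv_partition s t (u :: r) ->
  [/\ s < u, u <= t & itv_partition u t r].
Proof.
move=> str; have utr := itv_partition_cons str; split=> //; last exact: itv_partition_le utr.
by case: str => /= /andP[].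
Qed.

(** Interpolation: each increment to the power [q] loses a factor [c ^ (q - p)] and keeps its power
    [p]. *)
Lemma pvar_sum_le q c s t r : p < q -> 0 <= c -> itv_partition s t r ->
  (forall u v, s <= u -> u <= v -> v <= t -> len u v <= c) ->
  pvar_sum q s r <= c `^ (q - p) * pvar_sum p s r.
Proof.
move=> pq c0; elim: r s => [|u r IH] s; first by rewrite /= mulr0.
move=> /itv_partition_head[su ut utr] H /=.
rewrite mulrDr; apply: lerD; last first.
  by apply: IH => // v w uv; apply: H; exact: le_trans (ltW su) uv.
rewrite -[X in _ `^ X <= _](subrK p q) [X in X <= _]powRD; last first.
  by rewrite subrK gt_eqF// (lt_trans _ pq)//; case/andP: p12 => + _; exact: lt_le_trans.
rewrite ler_wpM2r ?powR_ge0// ge0_ler_powR ?nnegrE ?enorm_ge0 ?subr_ge0 ?(ltW pq)//.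
by apply: H => //; exact: ltW.
Qed.

(** Any exponent strictly between [p] and 2 would do: above [p] for smallness on short intervals,
    below 2 for [2 / q > 1]. *)
Let q := (p + 2) / 2.

Definition pvar_control s t : R := sup [set pvar_sum q s r | r in itv_partition s t].

Let pq : p < q. Proof. by rewrite /q; case/andP: p12; lra. Qed.

Lemma itv_partition_step s t : s <= t -> exists2 r, itv_partition s t r &
  len s t `^ q <= pvar_sum q s r.
Proof.
rewrite le_eqVlt => /predU1P[<-|st]; last first.
  by exists [:: t]; rewrite ?addr0 /itv_partition /= ?st ?eqxx ?addr0.
exists [::]; first by rewrite /itv_partition /= eqxx.
rewrite /= /len subrr /enorm expr0n addr0 sqrtr0 powR0 //.
by rewrite gt_eqF// (lt_trans _ pq)//; case/andP: p12 => + _; exact: lt_le_trans.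
Qed.

Lemma pvar_control_nonempty s t : s <= t ->
  [set pvar_sum q s r | r in itv_partition s t] !=set0.
Proof. by move=> /itv_partition_step[r str _]; exists (pvar_sum q s r), r. Qed.

Lemma len_bounded : exists2 c, 0 <= c & forall u v, 0 <= u -> u <= v -> v <= 1 -> len u v <= c.
Proof.
have [M M0 HM] := pvar_sum_bounded; exists (M `^ p^-1); first exact: powR_ge0.
move=> u v u0 uv v1; have p0 : 0 < p by case/andP: p12 => + _; exact: lt_le_trans.
have [<-|uv'] := eqVneq u v.
  by rewrite /len subrr /enorm expr0n addr0 sqrtr0 powR_ge0.
have := HM u v [:: v] u0 v1; rewrite /= addr0 => H.
have {}H : len u v `^ p <= M by apply: H; rewrite /itv_partition /= eqxx lt_def eq_sym uv' uv.
rewrite -[leLHS]powRr1 ?enorm_ge0// -(mulfV (lt0r_neq0 p0)) powRrM.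
by rewrite ge0_ler_powR ?nnegrE ?powR_ge0// invr_ge0 ltW.
Qed.

Lemma pvar_control_ub s t c M : 0 <= c -> 0 <= s -> t <= 1 ->
  (forall s t r, 0 <= s -> t <= 1 -> itv_partition s t r -> pvar_sum p s r <= M) ->
  (forall u v, s <= u -> u <= v -> v <= t -> len u v <= c) ->
  ubound [set pvar_sum q s r | r in itv_partition s t] (c `^ (q - p) * M).
Proof.
move=> c0 s0 t1 HM Hc _ [r str <-]; apply: le_trans (pvar_sum_le pq c0 str Hc) _.
by rewrite ler_wpM2l ?powR_ge0//; exact: HM str.
Qed.

Lemma pvar_control_has_ub s t : 0 <= s -> t <= 1 ->
  has_ubound [set pvar_sum q s r | r in itv_partition s t].
Proof.
move=> s0 t1; have [M M0 HM] := pvar_sum_bounded; have [c c0 Hc] := len_bounded.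
exists (c `^ (q - p) * M); apply: pvar_control_ub => // u v su uv vt.
by apply: Hc => //; [exact: le_trans su|exact: le_trans t1].
Qed.

Lemma pvar_sum_le_control s t r : 0 <= s -> t <= 1 -> itv_partition s t r ->
  pvar_sum q s r <= pvar_control s t.
Proof. by move=> s0 t1 str; apply: ub_le_sup; [exact: pvar_control_has_ub|exists r]. Qed.

(** Superadditivity comes from concatenating partitions. For smallness, uniform continuity bounds
    all increments on a short interval by [c], and interpolation bounds the control by [c ^ (q - p)]
    times the bound on the sums of exponent [p]. *)
Lemma pvar_controlP : control pvar_control.
Proof.
split=> [s t s0 st t1|s u t s0 su ut t1|e e0].
- have [r str _] := itv_partition_step st.
  exact: le_trans (pvar_sum_ge0 _ _ _) (pvar_sum_le_control s0 t1 str).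
- rewrite -lerBrDr; apply: ge_sup; first exact: pvar_control_nonempty.
  move=> _ [r1 sur1 <-]; rewrite lerBrDr -lerBrDl.
  apply: ge_sup; first exact: pvar_control_nonempty.
  move=> _ [r2 utr2 <-]; rewrite lerBrDl.
  have := pvar_sum_le_control s0 t1 (itv_partition_cat sur1 utr2).
  by rewrite pvar_sum_cat; case: (sur1) => _ /eqP ->.
have [M M0 HM] := pvar_sum_bounded.
pose c := (e / (M + 1)) `^ (q - p)^-1.
have M1 : 0 < M + 1 by rewrite ltr_wpDl.
have c0 : 0 < c by rewrite powR_gt0// divr_gt0.
have cE : c `^ (q - p) = e / (M + 1).
  rewrite /c -powRrM mulVf ?powRr1 ?divr_ge0 ?(ltW M1) ?(ltW e0)//.
  by rewrite subr_eq0 gt_eqF.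
have c20 : 0 < c / 2 by rewrite divr_gt0.
have [d1 d10 H1] := uniform_continuous01 (continuous01_fst gamma_cont) c20.
have [d2 d20 H2] := uniform_continuous01 (continuous01_snd gamma_cont) c20.
exists (Num.min d1 d2); first by rewrite lt_min d10.
move=> s t s0 st t1; rewrite lt_min => /andP[std1 std2].
apply: ge_sup; first exact: pvar_control_nonempty.
have -> : e = c `^ (q - p) * (M + 1) by rewrite cE divfK// gt_eqF.
apply: pvar_control_ub => //; first exact: ltW.
  move=> s' t' r s'0 t'1 H; apply: le_trans (HM _ _ _ s'0 t'1 H) _.
  by rewrite lerDl.
move=> u v su uv vt; apply: le_trans (enorm_le _) _.
have uvd d' : t - s < d' -> `|v - u| < d'.
  by rewrite ger0_norm ?subr_ge0//; move: su vt; lra.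
have u0 := le_trans s0 su; have v1 := le_trans vt t1.
have A1 := H1 v u (le_trans u0 uv) v1 u0 (le_trans uv v1) (uvd _ std1).
have A2 := H2 v u (le_trans u0 uv) v1 u0 (le_trans uv v1) (uvd _ std2).
by move: A1 A2; rewrite /=; lra.
Qed.

Lemma pvar_theta : 1 < 2 / q.
Proof. by rewrite /q; case/andP: p12 => p1 p2; rewrite ltr_pdivlMr; lra. Qed.

Lemma enorm_pvar_control s t : 0 <= s -> s <= t -> t <= 1 ->
  enorm (gamma t - gamma s) <= pvar_control s t `^ (2 / q / 2).
Proof.
move=> s0 st t1; have [r str le_r] := itv_partition_step st.
have q0 : 0 < q by rewrite (lt_trans _ pq)//; case/andP: p12 => + _; exact: lt_le_trans.
have -> : 2 / q / 2 = q^-1 by field; rewrite gt_eqF.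
have {}le_r := le_trans le_r (pvar_sum_le_control s0 t1 str).
rewrite -[leLHS]powRr1 ?enorm_ge0// -(mulfV (lt0r_neq0 q0)) powRrM.
rewrite ge0_ler_powR ?nnegrE ?powR_ge0//; first by rewrite invr_ge0 ltW.
exact: le_trans (powR_ge0 _ _) le_r.
Qed.

End pvariation_control.

(** * Winding numbers and crossings of a ray *)

Section turning.
Variable R : realType.
Implicit Types (a b x y : R) (m : int).

(** The number of completed turns. It jumps when the angle passes a multiple of [2 * pi], that is,
    when the direction crosses the horizontal ray to the right. *)
Definition turn a : int := Num.floor (a / (2 * pi)).

Lemma cos_period x m : cos (x + 2 * pi * m%:~R) = cos x.
Proof.
case: m => n.
  by rewrite -pmulrn mulr_natr mulr_natl (periodicn (@cosD2pi R)).
rewrite NegzE mulrNz -pmulrn mulrN mulr_natr mulr_natl.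
by rewrite -[in RHS](subrK (pi *+ 2 *+ n.+1) x) (periodicn (@cosD2pi R)).
Qed.

Lemma sin_period x m : sin (x + 2 * pi * m%:~R) = sin x.
Proof.
case: m => n.
  by rewrite -pmulrn mulr_natr mulr_natl (periodicn (@sinD2pi R)).
rewrite NegzE mulrNz -pmulrn mulrN mulr_natr mulr_natl.
by rewrite -[in RHS](subrK (pi *+ 2 *+ n.+1) x) (periodicn (@sinD2pi R)).
Qed.

Let pi0 : 0 < pi :> R. Proof. exact: pi_gt0. Qed.

Lemma turn_itv a : 0 <= a - 2 * pi * (turn a)%:~R < 2 * pi.
Proof.
have := floor_itv (a / (2 * pi)); rewrite -/(turn a) intrD => /andP[h1 h2].
have p2 : 0 < 2 * pi :> R by rewrite mulr_gt0.
by move: h1 h2; rewrite ler_pdivlMr// ltr_pdivrMr// => h1 h2; lra.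
Qed.

Lemma turn_def a m : 2 * pi * m%:~R <= a < 2 * pi * (m%:~R + 1) -> turn a = m.
Proof.
move=> /andP[h1 h2]; apply: floor_def; rewrite intrD.
have p2 : 0 < 2 * pi :> R by rewrite mulr_gt0.
by rewrite ler_pdivlMr// ltr_pdivrMr// mulrC h1 mulrC h2.
Qed.

Lemma sin_lt0_pi2pi x : pi < x -> x < 2 * pi -> (0 <= sin x) = false.
Proof.
move=> x1 x2; apply/negbTE; rewrite -ltNge -(subrK pi x) sinDpi oppr_lt0.
by apply: sin_gt0_pi; rewrite subr_gt0 x1 /= ltrBlDr -mulr2n -mulr_natl.
Qed.

(** In less than a quarter turn, an angle with nonpositive cosine cannot reach a multiple of
    [2 * pi]; from an angle with positive cosine, the sign of the sine tells on which side of the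
    ray the end lies. *)
Lemma turn_step_base a b : 0 <= a -> a < 2 * pi -> - (pi / 2) < b - a ->
  b - a < pi / 2 -> exists2 i : int, 2 * pi * i%:~R <= b < 2 * pi * (i%:~R + 1) &
  (i%:~R : R) = (0 < cos a)%R%:R * ((0 <= sin b)%R%:R - (0 <= sin a)%R%:R).
Proof.
move=> a0 a2 ab1 ab2; have [a1|a1] := ltP a (pi / 2).
  have ca : 0 < cos a by apply: cos_gt0_pihalf; apply/andP; split; lra.
  have sa : 0 <= sin a by apply: sin_ge0_pi; apply/andP; split; lra.
  rewrite ca sa; have [b0|b0] := leP 0 b.
    have sb : 0 <= sin b by apply: sin_ge0_pi; apply/andP; split; lra.
    by exists 0; rewrite ?sb ?subrr ?mulr0//; apply/andP; split; lra.
  have sb : (0 <= sin b) = false.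
    apply/negbTE; rewrite -ltNge -[b]opprK sinN oppr_lt0.
    by apply: sin_gt0_pi; apply/andP; split; lra.
  exists (-1); rewrite ?sb mulrN1z /=; last by ring.
  by apply/andP; split; lra.
have [a3|a3] := leP a (3 * pi / 2).
  have ca : (0 < cos a) = false.
    apply/negbTE; rewrite -leNgt -(subrK pi a) cosDpi oppr_le0.
    by apply: cos_ge0_pihalf; apply/andP; split; lra.
  by exists 0; rewrite ?ca ?mul0r//; apply/andP; split; lra.
have ca : 0 < cos a.
  have -> : a = (a - 2 * pi) + 2 * pi * 1%:~R by rewrite mulr1; ring.
  by rewrite cos_period; apply: cos_gt0_pihalf; apply/andP; split; lra.
have sa : (0 <= sin a) = false by apply: sin_lt0_pi2pi => //; lra.
rewrite ca sa; have [b2|b2] := ltP b (2 * pi).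
  have sb : (0 <= sin b) = false by apply: sin_lt0_pi2pi => //; lra.
  by exists 0; rewrite ?sb ?subrr ?mulr0//; apply/andP; split; lra.
have sb : 0 <= sin b.
  have -> : b = (b - 2 * pi) + 2 * pi * 1%:~R by rewrite mulr1; ring.
  by rewrite sin_period; apply: sin_ge0_pi; apply/andP; split; lra.
exists 1; rewrite ?sb mulr1z /=; last by ring.
by apply/andP; split; lra.
Qed.

Lemma turn_step a b : `|b - a| < pi / 2 ->
  ((turn b)%:~R - (turn a)%:~R : R) =
  (0 < cos a)%R%:R * ((0 <= sin b)%R%:R - (0 <= sin a)%R%:R).
Proof.
move=> ab; set m := turn a; have /andP[a0 a2] := turn_itv a.
pose a' := a - 2 * pi * m%:~R; pose b' := b - 2 * pi * m%:~R.
have ca : cos a = cos a' by rewrite -(cos_period a' m) /a' subrK.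
have sa : sin a = sin a' by rewrite -(sin_period a' m) /a' subrK.
have sb : sin b = sin b' by rewrite -(sin_period b' m) /b' subrK.
have ba : b' - a' = b - a by rewrite /b' /a'; ring.
move: ab; rewrite ca sa sb -ba ltr_norml => /andP[ab1 ab2].
have [i /andP[h1 h2] <-] := turn_step_base a0 a2 ab1 ab2.
have -> : turn b = m + i; last by rewrite intrD addrAC subrr add0r.
apply: turn_def; rewrite intrD; move: h1 h2; rewrite /b'; clear => h1 h2.
by apply/andP; split; lra.
Qed.

Lemma turn_total a b : cos a = cos b -> sin a = sin b ->
  (b - a) / (2 * pi) = (turn b)%:~R - (turn a)%:~R.
Proof.
move=> cab sab; have /andP[a0 a2] := turn_itv a; have /andP[b0 b2] := turn_itv b.
pose a' := a - 2 * pi * (turn a)%:~R; pose b' := b - 2 * pi * (turn b)%:~R.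
rewrite -/a' -/b' in a0 a2 b0 b2.
suff ab' : a' = b'.
  have p2 : 2 * pi != 0 :> R by rewrite gt_eqF// mulr_gt0.
  apply: (mulIf p2); rewrite divfK//.
  by move: ab'; rewrite /a' /b'; lra.
have c1 : cos (a' - b') = 1.
  rewrite cosB -(cos_period a' (turn a)) -(cos_period b' (turn b)).
  rewrite -(sin_period a' (turn a)) -(sin_period b' (turn b)) /a' /b' !subrK.
  by rewrite cab sab -!expr2 cos2Dsin2.
pose h := (a' - b') / 2.
have s0 : sin h = 0.
  have : cos (h *+ 2) = 1 by rewrite -c1 /h -mulr_natr mulfVK.
  rewrite cos_mulr2n cos2sin2 => e; apply/eqP; rewrite -sqrf_eq0; apply/eqP.
  by move: e; rewrite -[_ *+ 2]mulr_natr; lra.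
have [h0|h0|h0] := ltgtP h 0.
- have : 0 < sin (- h) by apply: sin_gt0_pi; apply/andP; split; rewrite /h; move: h0; rewrite /h; lra.
  by rewrite sinN s0 oppr0 ltxx.
- have : 0 < sin h by apply: sin_gt0_pi; apply/andP; split; rewrite /h; move: h0; rewrite /h; lra.
  by rewrite s0 ltxx.
- by move: h0; rewrite /h; lra.
Qed.

End turning.

(** * The winding number as a signed count of crossings *)

Section winding_steps.
Variables (R : realType) (G : R -> R * R).
Hypothesis G_closed : G 0 = G 1.
Implicit Types (z : R * R) (r : R).

(* Counts with sign the crossings of the horizontal ray issued from [z] to the
   right by the staircase through the points [G (k / N)]. *)
Definition wstep (N : nat) z : R := \sum_(0 <= k < N)
  (z.1 < (G (ugrid R N k)).1)%R%:R *
  ((z.2 <= (G (ugrid R N k.+1)).2)%R%:R - (z.2 <= (G (ugrid R N k)).2)%R%:R).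

Lemma ugrid01 N k : (k <= N)%N -> 0 <= ugrid R N k <= 1.
Proof.
move=> kN; rewrite /ugrid divr_ge0//=; case: N kN => [|N] kN.
  by rewrite invr0 mulr0.
by rewrite ler_pdivrMr// mul1r ler_nat.
Qed.

Lemma ugrid_fine d : 0 < d -> exists N0, forall N k, (N0 <= N)%N ->
  `|ugrid R N k.+1 - ugrid R N k| < d.
Proof.
move=> d0; exists (Num.trunc d^-1).+1 => N k dN.
rewrite ugridS ger0_norm ?invr_ge0//.
rewrite invf_plt ?posrE// ?ltr0n; last exact: leq_trans dN.
by apply: lt_le_trans (_ : (Num.trunc d^-1).+1%:R <= N%:R); rewrite ?truncnS_gt// ler_nat.
Qed.

Lemma winding_off_curve z r s : is_winding_number G z r -> 0 <= s -> s <= 1 ->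
  0 < enorm (G s - z).
Proof.
move=> [g [_ gP _]] s0 s1; have [|c1 c2] := gP s _; first by rewrite in_itv /= s0.
rewrite lt_def enorm_ge0 andbT; apply/eqP => e0.
have := cos2Dsin2 (g s); rewrite c1 c2 e0 invr0 !mulr0 expr0n addr0.
by move/eqP; rewrite eq_sym oner_eq0.
Qed.

(** As soon as the angle moves by less than a quarter turn on every grid step, [turn_step] makes
    each term of the count exact, and the sum telescopes to the total number of turns. *)
Lemma winding_wstep z r : is_winding_number G z r ->
  exists N0, forall N, (N0 <= N)%N -> wstep N z = r.
Proof.
move=> wr; have off s := winding_off_curve (s := s) wr.
have [g [gc gP ->]] := wr.
have pos (e x : R) : 0 < e -> (0 <= x / e) = (0 <= x).
  by move=> e0; rewrite pmulr_lge0// invr_gt0.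
have pos' (e x : R) : 0 < e -> (0 < x / e) = (0 < x).
  by move=> e0; rewrite pmulr_lgt0// invr_gt0.
have pi2 : 0 < pi / 2 :> R by rewrite divr_gt0// pi_gt0.
have [d d0 dP] := uniform_continuous01 ((continuous01P g).1 gc) pi2.
have [N0 N0P] := ugrid_fine d0; exists N0.+1 => -[//|N] /ltnW N0N.
have gP' s : 0 <= s -> s <= 1 -> [/\ (0 < cos (g s)) = (z.1 < (G s).1) &
    (0 <= sin (g s)) = (z.2 <= (G s).2)].
  move=> s0 s1; have [|-> ->] := gP s _; first by rewrite in_itv /= s0.
  by split; [rewrite pos' ?off// subr_gt0|rewrite pos ?off// subr_ge0].
have /gP[c0 s0] : (0 : R) \in `[0, 1] by rewrite in_itv /= lexx ler01.
have /gP[c1 s1] : (1 : R) \in `[0, 1] by rewrite in_itv /= lexx ler01.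
rewrite turn_total ?c0 ?c1 ?s0 ?s1 ?G_closed//.
have -> : (turn (g 1))%:~R - (turn (g 0))%:~R = \sum_(0 <= k < N.+1)
    ((turn (g (ugrid R N.+1 k.+1)))%:~R - (turn (g (ugrid R N.+1 k)))%:~R) :> R.
  by rewrite (telescope_sumr (fun k => (turn (g (ugrid R N.+1 k)))%:~R))// ugrid0 ugridn.
rewrite /wstep big_nat [RHS]big_nat; apply: eq_bigr => k /andP[_ kN].
have /andP[k0 k1] := ugrid01 (ltnW kN); have /andP[k0' k1'] := ugrid01 kN.
rewrite turn_step; last exact: dP (N0P _ _ N0N).
by have [-> ->] := gP' _ k0 k1; have [_ ->] := gP' _ k0' k1'.
Qed.

End winding_steps.

(** * Continuous angle functions of curves avoiding the origin *)

Section angle_lift.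
Variable R : realType.
Implicit Types (a b z : R * R) (s t : R) (h : R -> R).

Definition dot a b : R := a.1 * b.1 + a.2 * b.2.
Definition cross a b : R := a.1 * b.2 - a.2 * b.1.

Lemma enorm_sqr a : enorm a ^+ 2 = dot a a.
Proof. by rewrite /enorm sqr_sqrtr ?addr_ge0 ?sqr_ge0// /dot !expr2. Qed.

Lemma enorm_gt0 a : a != 0 -> 0 < enorm a.
Proof.
move=> a0; rewrite lt_def enorm_ge0 andbT; apply: contra a0 => /eqP e0.
have : `|a.1| <= 0 by rewrite -e0 enorm_ge1.
have : `|a.2| <= 0 by rewrite -e0 enorm_ge2.
rewrite !normr_le0 => /eqP a2 /eqP a1.
by rewrite (surjective_pairing a) a1 a2.
Qed.

Lemma exists_angle a : a != 0 ->
  exists g, cos g = a.1 / enorm a /\ sin g = a.2 / enorm a.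
Proof.
move=> /enorm_gt0 e0; have n0 : enorm a != 0 by rewrite gt_eqF.
set x := a.1 / enorm a; set y := a.2 / enorm a.
have xy : x ^+ 2 + y ^+ 2 = 1.
  have en : a.1 ^+ 2 + a.2 ^+ 2 = enorm a ^+ 2 by rewrite enorm_sqr /dot !expr2.
  by rewrite /x /y !expr_div_n -mulrDl en divff// sqrf_eq0.
have x1 : -1 <= x <= 1.
  by rewrite -ler_norml -(@ler_pXn2r _ 2)// ?nnegrE// real_normK ?num_real// expr1n -xy lerDl sqr_ge0.
have cx : cos (acos x) = x by apply: acosK; rewrite in_itv.
have sx : sin (acos x) = `|y| by rewrite sin_acos// -sqrtr_sqr -xy addrAC subrr add0r.
have [y0|y0] := leP 0 y; first by exists (acos x); rewrite cx sx ger0_norm.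
by exists (- acos x); rewrite cosN sinN cx sx ltr0_norm// opprK.
Qed.

(** [dot a b] and [cross a b] are the real and imaginary parts of the conjugate of [a] times [b];
    when the real part is positive, the argument of this product is an arctangent. *)
Lemma rotate_angle a b g : 0 < dot a b ->
  cos g = a.1 / enorm a -> sin g = a.2 / enorm a ->
  let g' := g + atan (cross a b / dot a b) in
  cos g' = b.1 / enorm b /\ sin g' = b.2 / enorm b.
Proof.
move=> d0 cg sg g'; have a0 : a != 0.
  by apply/eqP => a0; move: d0; rewrite a0 /dot !mul0r addr0 ltxx.
have b0 : b != 0.
  by apply/eqP => b0; move: d0; rewrite b0 /dot !mulr0 addr0 ltxx.
have A0 := enorm_gt0 a0; have B0 := enorm_gt0 b0.
set x := cross a b / dot a b.
have lagrange : dot a b ^+ 2 + cross a b ^+ 2 = (enorm a * enorm b) ^+ 2.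
  by rewrite exprMn !enorm_sqr /dot /cross; ring.
have cx : cos (atan x) = dot a b / (enorm a * enorm b).
  rewrite cos_atan.
  have -> : 1 + x ^+ 2 = ((enorm a * enorm b) / dot a b) ^+ 2.
    rewrite [RHS]expr_div_n -lagrange /x expr_div_n mulrDl divff//.
    by rewrite sqrf_eq0 gt_eqF.
  by rewrite sqrtr_sqr gtr0_norm ?invf_div// divr_gt0// mulr_gt0.
have sx : sin (atan x) = cross a b / (enorm a * enorm b).
  have cx0 : cos (atan x) != 0.
    by rewrite cx mulf_neq0 ?invr_eq0 ?mulf_neq0 ?gt_eqF.
  have := atanK x; rewrite /tan => /(canRL (divfK cx0)) ->.
  by rewrite cx /x mulrA divfK// gt_eqF.
have nA : enorm a != 0 by rewrite gt_eqF.
have nB : enorm b != 0 by rewrite gt_eqF.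
have E1 : a.1 * dot a b - a.2 * cross a b = enorm a ^+ 2 * b.1.
  by rewrite enorm_sqr /dot /cross; ring.
have E2 : a.2 * dot a b + a.1 * cross a b = enorm a ^+ 2 * b.2.
  by rewrite enorm_sqr /dot /cross; ring.
rewrite /g' cosD sinD -/x cx sx cg sg; split.
  have -> : a.1 / enorm a * (dot a b / (enorm a * enorm b)) -
     a.2 / enorm a * (cross a b / (enorm a * enorm b)) =
     (a.1 * dot a b - a.2 * cross a b) / (enorm a ^+ 2 * enorm b) by field; rewrite nA nB.
  by rewrite E1; field; rewrite nA nB.
have -> : a.2 / enorm a * (dot a b / (enorm a * enorm b)) +
   a.1 / enorm a * (cross a b / (enorm a * enorm b)) =
   (a.2 * dot a b + a.1 * cross a b) / (enorm a ^+ 2 * enorm b) by field; rewrite nA nB.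
by rewrite E2; field; rewrite nA nB.
Qed.

Let within_cvg h t := h s @[s --> within `[0, 1]%classic (nbhs t)] --> h t.

Lemma continuous01_cvg h : continuous01 h <-> forall t, 0 <= t -> t <= 1 -> within_cvg h t.
Proof.
split=> [/continuous01P/subspace_continuousP H t t0 t1|H].
  by apply: H; rewrite /= in_itv /= t0.
by apply/continuous01P/subspace_continuousP => t; rewrite /= in_itv /= => /andP[]; exact: H.
Qed.

Lemma continuous01_clamp h s0 : 0 <= s0 -> continuous01 h ->
  continuous01 (fun s => h (Num.min s s0)).
Proof.
move=> s00 hc t t0 t1 e e0.
have [||d d0 dP] := hc (Num.min t s0) _ _ e e0.
- by rewrite le_min t0.
- by rewrite ge_min t1.
exists d => // s sp s1 st; apply: dP.
- by rewrite le_min sp.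
- by rewrite ge_min s1.
apply: le_lt_trans st; have [ss|ss] := leP s s0; have [tt|tt] := leP t s0 => //.
- by rewrite !ler0_norm; lra.
- by rewrite !ger0_norm; lra.
- by rewrite subrr normr0.
Qed.

Lemma continuous01D h k : continuous01 h -> continuous01 k ->
  continuous01 (fun t => h t + k t).
Proof.
move=> /continuous01_cvg H /continuous01_cvg K; apply/continuous01_cvg => t t0 t1.
by apply: cvgD; [exact: H|exact: K].
Qed.

Lemma continuous01N h : continuous01 h -> continuous01 (fun t => - h t).
Proof.
by move=> /continuous01_cvg H; apply/continuous01_cvg => t t0 t1; apply: cvgN; exact: H.
Qed.

Lemma continuous01M h k : continuous01 h -> continuous01 k ->
  continuous01 (fun t => h t * k t).
Proof.
move=> /continuous01_cvg H /continuous01_cvg K; apply/continuous01_cvg => t t0 t1.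
by apply: cvgM; [exact: H|exact: K].
Qed.

Lemma continuous01V h : (forall t, 0 <= t -> t <= 1 -> h t != 0) -> continuous01 h ->
  continuous01 (fun t => (h t)^-1).
Proof.
move=> h0 /continuous01_cvg H; apply/continuous01_cvg => t t0 t1.
by apply: cvgV; [exact: h0|exact: H].
Qed.

Lemma continuous01_atan h : continuous01 h -> continuous01 (fun t => atan (h t)).
Proof.
move=> /continuous01_cvg H; apply/continuous01_cvg => t t0 t1.
by apply: continuous_cvg (H t t0 t1); exact: continuous_atan.
Qed.

Lemma continuous01_cst (c : R) : continuous01 (fun=> c).
Proof. by move=> t _ _ e e0; exists 1 => // s _ _ _; rewrite subrr normr0. Qed.

Lemma continuous01_sum (h : nat -> R -> R) n : (forall k, continuous01 (h k)) ->
  continuous01 (fun t => \sum_(0 <= k < n) h k t).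
Proof.
move=> hc; elim: n => [|n IH].
  rewrite (_ : (fun _ => _) = fun=> 0); first exact: continuous01_cst.
  by apply/funext => t; rewrite big_geq.
rewrite (_ : (fun _ => _) = fun t => \sum_(0 <= k < n) h k t + h n t).
  exact: continuous01D.
by apply/funext => t; rewrite big_nat_recr.
Qed.

Variable c : R -> R * R.
Hypothesis c1_cont : continuous01 (fun t => (c t).1).
Hypothesis c2_cont : continuous01 (fun t => (c t).2).
Hypothesis c_neq0 : forall t, 0 <= t -> t <= 1 -> c t != 0.

Lemma dot_gt0_near : exists2 d, 0 < d & forall s t, 0 <= s -> s <= 1 ->
  0 <= t -> t <= 1 -> `|s - t| < d -> 0 < dot (c s) (c t).
Proof.
pose w t := dot (c t) (c t).
have wc : {within `[0, 1], continuous w}.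
  by apply/continuous01P; apply: continuous01D; apply: continuous01M.
have [t0 t0I t0_min] := EVT_min ler01 wc.
have m0 : 0 < w t0.
  move: t0I; rewrite in_itv /= => /andP[h0 h1].
  by rewrite /w -enorm_sqr exprn_gt0// enorm_gt0// c_neq0.
(* Being at most 1 lets a square be bounded by the absolute value, so the two squared differences of
   coordinates together stay below the minimum of [w]. *)
pose e := Num.min 1 (w t0 / 2).
have e0 : 0 < e by rewrite lt_min ltr01 divr_gt0.
have [d1 d10 P1] := uniform_continuous01 c1_cont e0.
have [d2 d20 P2] := uniform_continuous01 c2_cont e0.
exists (Num.min d1 d2); first by rewrite lt_min d10.
move=> s t s0 s1 tp t1; rewrite lt_min => /andP[st1 st2].
have {}P1 := P1 s t s0 s1 tp t1 st1; have {}P2 := P2 s t s0 s1 tp t1 st2.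
have ws : w t0 <= w s by apply: t0_min; rewrite in_itv /= s0.
have wt : w t0 <= w t by apply: t0_min; rewrite in_itv /= tp.
have sq (x : R) : `|x| < e -> x ^+ 2 < w t0 / 2.
  move=> xe; rewrite -real_normK ?num_real// expr2.
  apply: (@le_lt_trans _ _ (`|x| * 1)).
    by rewrite ler_wpM2l// (le_trans (ltW xe))// ge_min lexx.
  by rewrite mulr1 (lt_le_trans xe)// ge_min lexx orbT.
have {}P1 := sq _ P1; have {}P2 := sq _ P2.
have : dot (c s) (c t) *+ 2 = w s + w t - ((c s).1 - (c t).1) ^+ 2 - ((c s).2 - (c t).2) ^+ 2.
  by rewrite /w /dot; ring.
rewrite -mulr_natr; lra.
Qed.

(** The angle is a sum of arctangents, one for each grid step, taken along the curve stopped at the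
    two grid points. Each of them is defined and continuous on all of [[0, 1]], so no gluing of
    local lifts occurs. *)
Lemma angle_lift : exists2 g : R -> R, continuous01 g & forall s, 0 <= s -> s <= 1 ->
  cos (g s) = (c s).1 / enorm (c s) /\ sin (g s) = (c s).2 / enorm (c s).
Proof.
have [d d0 dP] := dot_gt0_near; have [N NP] := ugrid_fine d0.
have {NP} NP k := NP N.+1 k (leqnSn _).
have [g0 g0P] := exists_angle (c_neq0 (lexx 0) ler01).
pose m k s := Num.min s (ugrid R N.+1 k).
have g_ge0 k : 0 <= ugrid R N.+1 k by rewrite /ugrid divr_ge0.
have m01 k s : 0 <= s -> s <= 1 -> 0 <= m k s <= 1.
  by move=> s0 s1; rewrite /m le_min s0 g_ge0 /= ge_min s1.
have mm k s : `|m k s - m k.+1 s| < d.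
  apply: le_lt_trans (NP k); rewrite distrC /m.
  have := ugrid_mono R N.+1 (leqnSn k).
  have [a1|a1] := leP s (ugrid R N.+1 k.+1); have [a2|a2] := leP s (ugrid R N.+1 k) => gg.
  - by rewrite subrr normr0.
  - by rewrite !ger0_norm; lra.
  - by rewrite !ger0_norm; lra.
  - by [].
pose A k s := atan (cross (c (m k s)) (c (m k.+1 s)) / dot (c (m k s)) (c (m k.+1 s))).
have dot0 k s : 0 <= s -> s <= 1 -> 0 < dot (c (m k s)) (c (m k.+1 s)).
  move=> s0 s1; have /andP[? ?] := m01 k s s0 s1; have /andP[? ?] := m01 k.+1 s s0 s1.
  exact: dP.
have cm1 k : continuous01 (fun s => (c (m k s)).1) by exact: (continuous01_clamp (g_ge0 k) c1_cont).
have cm2 k : continuous01 (fun s => (c (m k s)).2) by exact: (continuous01_clamp (g_ge0 k) c2_cont).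
have Ac k : continuous01 (A k).
  apply: continuous01_atan; apply: continuous01M.
    by apply: continuous01D; [|apply: continuous01N]; apply: continuous01M.
  apply: continuous01V => [t t0 t1|]; first by rewrite gt_eqF// dot0.
  by apply: continuous01D; apply: continuous01M.
exists (fun s => g0 + \sum_(0 <= k < N.+1) A k s).
  by apply: continuous01D; [exact: continuous01_cst|exact: continuous01_sum].
move=> s s0 s1.
suff H n : let g := g0 + \sum_(0 <= k < n) A k s in
    cos g = (c (m n s)).1 / enorm (c (m n s)) /\ sin g = (c (m n s)).2 / enorm (c (m n s)).
  by have := H N.+1; rewrite /m ugridn min_l.
elim: n => [|n IH] /=; first by rewrite big_geq// addr0 /m ugrid0 min_r.
rewrite big_nat_recr//= addrA; have [c1 c2] := IH.
by apply: rotate_angle => //; exact: dot0.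
Qed.

End angle_lift.

Section winding_number_steps.
Variables (R : realType) (G : R -> R * R).
Hypothesis G_closed : G 0 = G 1.
Hypothesis G_cont : {within `[0, 1], continuous G}.
Implicit Types (z : R * R).

Lemma winding_number_on_curve z t : 0 <= t -> t <= 1 -> G t = z -> winding_number G z = 0.
Proof.
move=> t0 t1 Gz; rewrite /winding_number; case: xgetP => // r _ /= wr.
by have := winding_off_curve wr t0 t1; rewrite Gz subrr /enorm expr0n addr0 sqrtr0 ltxx.
Qed.

Lemma winding_number_wstep z : (forall t, 0 <= t -> t <= 1 -> G t <> z) ->
  exists N0, forall N, (N0 <= N)%N -> wstep G N z = winding_number G z.
Proof.
move=> off; have c0 t : 0 <= t -> t <= 1 -> G t - z != 0.
  by move=> t0 t1; rewrite subr_eq0; apply/eqP; exact: off.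
have c1 : continuous01 (fun t => (G t - z).1).
  by apply: continuous01D (continuous01_cst _); exact: continuous01_fst.
have c2 : continuous01 (fun t => (G t - z).2).
  by apply: continuous01D (continuous01_cst _); exact: continuous01_snd.
have [g gc gP] := angle_lift c1 c2 c0.
have wr : is_winding_number G z ((g 1 - g 0) / (2 * pi)).
  exists g; split=> //; first exact/continuous01P.
  by move=> s; rewrite in_itv /= => /andP[]; exact: gP.
rewrite /winding_number; case: xgetP => [r _ /=|/(_ _ wr)//].
exact: winding_wstep.
Qed.

End winding_number_steps.

(** * Integrals over rectangles *)

Section product_integrals.
Variable R : realType.
Local Notation leb := (@lebesgue_measure R).
Local Notation mu := (leb \x leb)%E.
Implicit Types (f g : R -> R) (a b c d x y : R).

Lemma integrable_tensor f g : leb.-integrable setT (EFin \o f) ->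
  leb.-integrable setT (EFin \o g) ->
  mu.-integrable setT (EFin \o (fun z : R * R => f z.1 * g z.2)).
Proof.
move=> fi gi.
have mf : measurable_fun setT f by apply/measurable_EFinP; exact: measurable_int fi.
have mg : measurable_fun setT g by apply/measurable_EFinP; exact: measurable_int gi.
have /integrableP[_ fo] := fi; have /integrableP[_ go] := gi.
have mfg : measurable_fun setT (EFin \o (fun z : R * R => f z.1 * g z.2)).
  apply/measurable_EFinP; apply: measurable_funM.
    exact: (measurableT_comp mf).
  exact: (measurableT_comp mg).
apply/integrable12ltyP => //.
under eq_integral => x _.
  under eq_integral => y _ do rewrite /= normrM EFinM.
  rewrite ge0_integralZl//; last by do 2 apply: measurableT_comp => //.
  over.
rewrite ge0_integralZr//.
- by rewrite lte_mul_pinfty// ?integral_ge0// ge0_fin_numE// integral_ge0.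
- by do 2 apply: measurableT_comp => //.
- by apply: integral_ge0.
Qed.

Lemma Rintegral_tensor f g : leb.-integrable setT (EFin \o f) ->
  leb.-integrable setT (EFin \o g) ->
  \int[mu]_z (f z.1 * g z.2) = (\int[leb]_x f x) * (\int[leb]_y g y).
Proof.
move=> fi gi; rewrite /Rintegral -(integral12_prod_meas1 (integrable_tensor fi gi)) /fubini_F /=.
have gE := fineK (integrable_fin_num measurableT gi).
under eq_integral => x _.
  under eq_integral => y _ do rewrite /= EFinM.
  rewrite integralZl// -gE; over.
by rewrite integralZr// fineM ?(integrable_fin_num measurableT fi)// gE.
Qed.

Lemma integrable_expr_itv n a b (i : interval R) : [set` i] `<=` `[a, b]%classic ->
  leb.-integrable [set` i] (EFin \o (fun x => x ^+ n)).
Proof.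
move=> iab; apply: (@integrableS _ _ _ leb `[a, b]%classic) => //.
apply: continuous_compact_integrable; first exact: segment_compact.
by apply: continuous_subspaceT; exact: exprn_continuous.
Qed.

Lemma Rintegral_expr n a b : a <= b ->
  \int[leb]_(x in `[a, b]) x ^+ n = (b ^+ n.+1 - a ^+ n.+1) / n.+1%:R.
Proof.
rewrite le_eqVlt => /predU1P[<-|ab].
  by rewrite set_itv1 Rintegral_set1 subrr mul0r.
pose F x := x ^+ n.+1 / n.+1%:R.
have Fc : continuous F.
  by move=> x; apply: cvgM; [exact: exprn_continuous|exact: cvg_cst].
have Fd x : derivable F x 1.
  by apply: derivableM => //; exact: exprn_derivable.
rewrite /Rintegral (@continuous_FTC2 _ (fun x => x ^+ n) F)//.
- by rewrite /= /F mulrBl.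
- by apply: continuous_subspaceT; exact: exprn_continuous.
- by split=> //; [apply: cvg_at_right_filter; exact: Fc|apply: cvg_at_left_filter; exact: Fc].
- move=> x _; rewrite derive1Mr; last exact: exprn_derivable.
  by rewrite exp_derive1 /= [_ *: _]mulrC mulrK// unitfE pnatr_eq0.
Qed.

(* Half-open intervals: [a, b[ for [cl = true] and ]a, b] for [cl = false]. *)
Definition hitv (cl : bool) a b : interval R := Interval (BSide cl a) (BSide cl b).

(** A difference of half-line indicators, hence antisymmetric and additive in the endpoints whatever
    their order; for [a <= b] it is the indicator of [hitv cl a b]. *)
Definition step (cl : bool) a b x : R :=
  (x \in Interval -oo%O (BSide cl b))%:R - (x \in Interval -oo%O (BSide cl a))%:R.

Lemma stepC cl a b x : step cl a b x = - step cl b a x.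
Proof. by rewrite /step opprB. Qed.

Lemma step_indic cl a b : a <= b -> step cl a b = \1_([set` hitv cl a b]).
Proof.
move=> ab; apply/funext => x; rewrite /step indicE mem_setE /hitv !in_itv /=.
by case: cl => /=; case: ltP => h1; case: ltP => h2; rewrite ?subrr ?subr0//= -?ltNge ?h1//; exfalso; move: ab h1 h2; lra.
Qed.

Lemma hitv_sub cl a b : [set` hitv cl a b] `<=` `[a, b]%classic.
Proof.
move=> x; rewrite /= /hitv !in_itv /=; case: cl => /= /andP[h1 h2]; apply/andP.
  by split=> //; exact: ltW.
by split=> //; exact: ltW.
Qed.

Lemma Rintegral_expr_hitv cl n a b : a <= b ->
  \int[leb]_(x in [set` hitv cl a b]) x ^+ n = (b ^+ n.+1 - a ^+ n.+1) / n.+1%:R.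
Proof.
move=> ab; rewrite -Rintegral_expr//.
have int_ (i : interval R) := @integrable_expr_itv n a b i.
case: cl => /=; rewrite /hitv.
  by rewrite Rintegral_itv_bndo_bndc//; apply: int_; exact: (@hitv_sub true).
by rewrite Rintegral_itv_obnd_cbnd//; apply: int_; exact: (@hitv_sub false).
Qed.

Lemma expr_stepE cl n a b : a <= b ->
  (fun x => x ^+ n * step cl a b x) = (fun x => x ^+ n) \_ [set` hitv cl a b].
Proof.
move=> ab; rewrite step_indic//; apply/funext => x; rewrite patchE indicE.
by case: ifPn => _; rewrite ?mulr1 ?mulr0.
Qed.

Lemma integrable_expr_step cl n a b :
  leb.-integrable setT (EFin \o (fun x => x ^+ n * step cl a b x)).
Proof.
wlog ab : a b / a <= b.
  move=> H; have [/H//|/ltW/H h] := leP a b.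
  have := integrableN h; apply: eq_integrable => // x _ /=.
  by rewrite stepC mulrN opprK.
rewrite expr_stepE//.
have h := (@integrable_expr_itv n a b _ (@hitv_sub cl a b)).
rewrite (_ : EFin \o _ = (EFin \o (fun x => x ^+ n)) \_ [set` hitv cl a b]).
  by apply: (iffLR (integrable_mkcond _ _)) => //; exact: measurable_itv.
by apply/funext => x; rewrite /= !patchE; case: ifP.
Qed.

Lemma Rintegral_expr_step cl n a b :
  \int[leb]_x (x ^+ n * step cl a b x) = (b ^+ n.+1 - a ^+ n.+1) / n.+1%:R.
Proof.
wlog ab : a b / a <= b.
  move=> H; have [/H//|/ltW/H h] := leP a b.
  under eq_Rintegral do rewrite stepC mulrN -mulN1r.
  rewrite RintegralZl//; last exact: integrable_expr_step.
  by rewrite h mulN1r -mulNr opprB.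
by rewrite expr_stepE// -Rintegral_mkcond Rintegral_expr_hitv.
Qed.

Lemma integrable_step cl a b : leb.-integrable setT (EFin \o step cl a b).
Proof.
have := integrable_expr_step cl 0 a b; apply: eq_integrable => // x _ /=.
by rewrite expr0 mul1r.
Qed.

Lemma normr_step cl a b x : `|step cl a b x| = step cl (Num.min a b) (Num.max a b) x.
Proof.
have [ab|/ltW ab] := leP a b; last rewrite stepC normrN.
  by rewrite step_indic// ger0_norm// indicE ler0n.
by rewrite step_indic// ger0_norm// indicE ler0n.
Qed.

Lemma Rintegral_normr_step cl a b : \int[leb]_x `|step cl a b x| = `|b - a|.
Proof.
under eq_Rintegral => x _ do rewrite normr_step -[step _ _ _ _]mul1r -[1](expr0 x).
rewrite Rintegral_expr_step !expr1 divr1.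
have [ab|ab] := leP a b; first by rewrite ger0_norm// subr_ge0.
by rewrite ltr0_norm ?subr_lt0// opprB.
Qed.

(* Up to sign, the indicator of the rectangle with opposite corners (a, c) and (b, d). *)
Definition rect a b c d (z : R * R) : R := step true a b z.1 * step false c d z.2.

Lemma integrable_rect a b c d : mu.-integrable setT (EFin \o rect a b c d).
Proof. by apply: integrable_tensor; exact: integrable_step. Qed.

Lemma Rintegral_normr_rect a b c d :
  \int[mu]_z `|rect a b c d z| = `|b - a| * `|d - c|.
Proof.
rewrite /rect; under eq_Rintegral do rewrite normrM.
rewrite (Rintegral_tensor (f := fun x => `|step true a b x|) (g := fun y => `|step false c d y|)).
- by rewrite !Rintegral_normr_step.
- by apply: integrable_norm; exact: integrable_step.
- by apply: integrable_norm; exact: integrable_step.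
Qed.

Lemma Rintegral_moment_rect n k a b c d :
  \int[mu]_z (z.1 ^+ n * z.2 ^+ k * rect a b c d z) =
  (b ^+ n.+1 - a ^+ n.+1) / n.+1%:R * ((d ^+ k.+1 - c ^+ k.+1) / k.+1%:R).
Proof.
rewrite /rect; under eq_Rintegral do rewrite mulrACA.
rewrite (Rintegral_tensor (f := fun x => x ^+ n * step true a b x)
  (g := fun y => y ^+ k * step false c d y)).
- by rewrite !Rintegral_expr_step.
- exact: integrable_expr_step.
- exact: integrable_expr_step.
Qed.

Lemma integrable_moment_rect n k a b c d :
  mu.-integrable setT (EFin \o (fun z => z.1 ^+ n * z.2 ^+ k * rect a b c d z)).
Proof.
have := integrable_tensor (integrable_expr_step true n a b) (integrable_expr_step false k c d).
by apply: eq_integrable => // z _ /=; rewrite /rect mulrACA.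
Qed.

End product_integrals.

(** * Staircase approximations of the winding number *)

Section Rintegral_bounds.
Context d (T : measurableType d) (R : realType) (mu : {measure set T -> \bar R}).
Implicit Types (phi f : T -> R) (C : R).

Lemma integrable_bounded_mul phi f C : measurable_fun setT phi ->
  (forall z, `|phi z| <= C) -> mu.-integrable setT (EFin \o f) ->
  mu.-integrable setT (EFin \o (fun z => phi z * f z)).
Proof.
move=> mphi phiC fi.
have mf : measurable_fun setT f by apply/measurable_EFinP; exact: measurable_int fi.
apply: (@le_integrable _ _ _ mu setT measurableT _ (fun z => C%:E * (EFin \o f) z)%E).
- by apply/measurable_EFinP; exact: measurable_funM.
- move=> z _; rewrite /= lee_fin !normrM ler_wpM2r//.
  by rewrite (le_trans (phiC z))// ler_norm.
- exact: integrableZl.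
Qed.

Lemma normr_Rintegral_bounded_mul phi f C : measurable_fun setT phi ->
  (forall z, `|phi z| <= C) -> mu.-integrable setT (EFin \o f) ->
  `|\int[mu]_z (phi z * f z)| <= C * \int[mu]_z `|f z|.
Proof.
move=> mphi phiC fi; have pfi := integrable_bounded_mul mphi phiC fi.
have nfi := integrable_norm fi.
apply: le_trans (le_normr_Rintegral measurableT pfi) _.
rewrite -RintegralZl//; apply: le_Rintegral => //.
- exact: integrable_norm.
- exact: (@integrableZl _ _ _ mu setT measurableT C _ nfi).
- by move=> z _; rewrite normrM ler_wpM2r.
Qed.

Lemma integrable_sum_nat (s : seq nat) (F : nat -> T -> R) :
  (forall k, mu.-integrable setT (EFin \o F k)) ->
  mu.-integrable setT (EFin \o (fun z => \sum_(k <- s) F k z)).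
Proof.
move=> Fi; rewrite (_ : _ \o _ = (fun z => \sum_(k <- s) (EFin \o F k) z)%E).
  exact: integrable_sum.
by apply/funext => z; rewrite /= -sumEFin.
Qed.

Lemma Rintegral_sum (s : seq nat) (F : nat -> T -> R) :
  (forall k, mu.-integrable setT (EFin \o F k)) ->
  \int[mu]_z (\sum_(k <- s) F k z) = \sum_(k <- s) \int[mu]_z F k z.
Proof.
move=> Fi; elim: s => [|k s IH].
  rewrite big_nil; under eq_Rintegral do rewrite big_nil.
  by rewrite /Rintegral integral0.
under eq_Rintegral do rewrite big_cons.
by rewrite big_cons RintegralD// ?IH//; exact: integrable_sum_nat.
Qed.

End Rintegral_bounds.

Section staircases.
Variables (R : realType) (om : R -> R -> R) (th : R) (G : R -> R * R).
Hypothesis om_ctrl : control om.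
Hypothesis th1 : 1 < th.
Hypothesis G0 : G 0 = 0.
Hypothesis G1 : G 1 = 0.
Let x t := (G t).1.
Let y t := (G t).2.
Hypothesis x_lip : forall s t, 0 <= s -> s <= t -> t <= 1 ->
  `|x t - x s| <= om s t `^ (th / 2).
Hypothesis y_lip : forall s t, 0 <= s -> s <= t -> t <= 1 ->
  `|y t - y s| <= om s t `^ (th / 2).
Local Notation leb := (@lebesgue_measure R).
Local Notation mu := (leb \x leb)%E.
Local Notation RR := (measurableTypeR R * measurableTypeR R)%type.
Implicit Types (s t u e : R) (z : R * R) (phi : R * R -> R).

(** The formal integrand, with the half-line to the left of [x s] cut off at abscissa 0 to make it
    integrable. *)
Definition stair s t z : R := rect 0 (x s) (y s) (y t) z.

Definition stair_sum N z : R := usum (fun s t => stair s t z) N 0 1.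

Lemma clamp_ugrid N k : (k <= N)%N -> clamp 0 1 (ugrid R N k) = ugrid R N k.
Proof. by move=> /(ugrid01 R)/andP[k0 k1]; exact: clampm. Qed.

(** The cut-off at abscissa 0 subtracts a sum that telescopes, and it vanishes because the curve is
    closed. *)
Lemma stair_sum_wstep N z : stair_sum N.+1 z = wstep G N.+1 z.
Proof.
have dE k : (k < N.+1)%N -> stair (clamp 0 1 (ugrid R N.+1 k)) (clamp 0 1 (ugrid R N.+1 k.+1)) z =
  (z.1 < (G (ugrid R N.+1 k)).1)%R%:R *
  ((z.2 <= (G (ugrid R N.+1 k.+1)).2)%R%:R - (z.2 <= (G (ugrid R N.+1 k)).2)%R%:R) -
  (z.1 < 0)%R%:R * ((z.2 <= (G (ugrid R N.+1 k.+1)).2)%R%:R - (z.2 <= (G (ugrid R N.+1 k)).2)%R%:R).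
  move=> kN; rewrite !clamp_ugrid//; last exact: ltnW.
  by rewrite /stair /rect /step !in_itv /= mulrBl.
rewrite /stair_sum /usum big_nat; under eq_bigr => k /andP[_ kN] do rewrite dE//.
rewrite -big_nat sumrB -[X in _ - X]big_distrr /=.
rewrite (telescope_sumr (fun k => (z.2 <= (G (ugrid R N.+1 k)).2)%R%:R))//.
by rewrite ugridn ugrid0 G0 G1 subrr mulr0 subr0.
Qed.

Lemma integrable_stair s t : mu.-integrable setT (EFin \o stair s t).
Proof. exact: integrable_rect. Qed.

Lemma integrable_stair_sum N : mu.-integrable setT (EFin \o stair_sum N).
Proof. by apply: integrable_sum_nat => k; exact: integrable_stair. Qed.

Lemma measurable_stair_sum N : measurable_fun [set: RR] (stair_sum N).
Proof. by apply/measurable_EFinP; exact: measurable_int (integrable_stair_sum N). Qed.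

Definition stair_int phi s t : R := \int[mu]_z (phi z * stair s t z).

Lemma Rintegral_stair_sum phi C N : measurable_fun [set: RR] phi -> (forall z, `|phi z| <= C) ->
  \int[mu]_z (phi z * stair_sum N z) = usum (stair_int phi) N 0 1.
Proof.
move=> mphi phiC; rewrite /stair_sum /usum.
under eq_Rintegral do rewrite big_distrr.
rewrite Rintegral_sum// => k.
exact: (integrable_bounded_mul mphi phiC (integrable_stair _ _)).
Qed.

Lemma almost_additive_stair_int phi : measurable_fun [set: RR] phi -> (forall z, `|phi z| <= 1) ->
  almost_additive om th 1 (stair_int phi).
Proof.
move=> mphi phi1 s u t s0 su ut t1; rewrite /stair_int.
have I a b := integrable_bounded_mul mphi phi1 (integrable_stair a b).
rewrite -RintegralD// -RintegralB//; last exact: (integrableD measurableT (I s u) (I u t)).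
(* The defect of additivity is a single signed rectangle, whose sides are an increment of [x] over
   [[s, u]] and one of [y] over [[u, t]]. *)
have -> : \int[mu]_z (phi z * stair s u z + phi z * stair u t z - phi z * stair s t z) =
   \int[mu]_z (phi z * rect (x s) (x u) (y u) (y t) z).
  by apply: eq_Rintegral => z _; rewrite /stair /rect /step; ring.
apply: le_trans (normr_Rintegral_bounded_mul mphi phi1 (integrable_rect _ _ _ _)) _.
rewrite mul1r Rintegral_normr_rect mul1r -(half_powR om th1).
apply: ler_pM => //.
  apply: le_trans (x_lip s0 su (le_trans ut t1)) _.
  by apply: (half_powR_sub om_ctrl th1).
apply: le_trans (y_lip (le_trans s0 su) ut t1) _.
by apply: (half_powR_sub om_ctrl th1).
Qed.

Lemma Rintegral_stair_refine N M :
  \int[mu]_z `|stair_sum (N.+1 * M.+1) z - stair_sum N.+1 z| <=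
  sewing_cst th * \sum_(0 <= k < N.+1)
     om (clamp 0 1 (ugrid R N.+1 k)) (clamp 0 1 (ugrid R N.+1 k.+1)) `^ th.
Proof.
pose D z := stair_sum (N.+1 * M.+1) z - stair_sum N.+1 z.
(* The sign of the difference turns the tested integral into the L^1 norm. It depends on [N] and
   [M], which is harmless as the sewing bound is uniform over test functions bounded by 1. *)
pose phi z : R := if 0 <= D z then 1 else -1.
have mD : measurable_fun [set: RR] D by apply: measurable_funB; exact: measurable_stair_sum.
have mphi : measurable_fun [set: RR] phi.
  by apply: measurable_fun_ifT => //; apply: measurable_fun_ler.
have phi1 z : `|phi z| <= 1 by rewrite /phi; case: ifP; rewrite ?normrN normr1.
have -> : \int[mu]_z `|D z| = \int[mu]_z (phi z * stair_sum (N.+1 * M.+1) z - phi z * stair_sum N.+1 z).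
  apply: eq_Rintegral => z _; rewrite -mulrBr -/(D z) /phi.
  by case: ifPn => [D0|]; [rewrite mul1r ger0_norm|rewrite -ltNge => D0; rewrite mulN1r ltr0_norm].
rewrite RintegralB//; first last.
- exact: integrable_bounded_mul mphi phi1 (integrable_stair_sum _).
- exact: integrable_bounded_mul mphi phi1 (integrable_stair_sum _).
rewrite !(Rintegral_stair_sum _ mphi phi1).
apply: le_trans (ler_norm _) _.
have := usum_refine om_ctrl th1 ler01 (almost_additive_stair_int mphi phi1) N M (lexx 0) ler01 (lexx 1).
by rewrite mulr1.
Qed.

End staircases.

(** * The image of the curve is null, and the staircases converge in L^1 *)

Section green.
Variables (R : realType) (om : R -> R -> R) (th : R) (G : R -> R * R).
Hypothesis om_ctrl : control om.
Hypothesis th1 : 1 < th.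
Hypothesis G_cont : {within `[0, 1], continuous G}.
Hypothesis G0 : G 0 = 0.
Hypothesis G1 : G 1 = 0.
Let x t := (G t).1.
Let y t := (G t).2.
Hypothesis x_lip : forall s t, 0 <= s -> s <= t -> t <= 1 ->
  `|x t - x s| <= om s t `^ (th / 2).
Hypothesis y_lip : forall s t, 0 <= s -> s <= t -> t <= 1 ->
  `|y t - y s| <= om s t `^ (th / 2).
Local Notation leb := (@lebesgue_measure R).
Local Notation mu := (leb \x leb)%E.
Local Notation RR := (measurableTypeR R * measurableTypeR R)%type.
Implicit Types (s t u e : R) (z : R * R) (phi : R * R -> R).

Let W := stair_sum G.

Definition curve : set RR := [set z | exists2 t, 0 <= t <= 1 & G t = z].

Let rad (N k : nat) : R := om (ugrid R N k) (ugrid R N k.+1) `^ (th / 2).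

Definition curve_box (N k : nat) : set RR :=
  `[x (ugrid R N k) - rad N k, x (ugrid R N k) + rad N k]%classic `*`
  `[y (ugrid R N k) - rad N k, y (ugrid R N k) + rad N k]%classic.

(** The total area of these boxes is 4 times a sum of [om ^ th], so it tends to 0; their
    intersection over [N] is the image of the curve, which is therefore measurable as well as
    null. *)
Definition curve_cover (N : nat) : set RR :=
  \big[setU/set0]_(k < N.+1) curve_box N.+1 k.

Lemma ugrid_locate N t : 0 <= t -> t <= 1 -> exists2 k, (k < N.+1)%N &
  ugrid R N.+1 k <= t <= ugrid R N.+1 k.+1.
Proof.
move=> t0 t1; pose P k := (k < N.+1)%N && (ugrid R N.+1 k <= t).
have P0 : exists k, P k by exists 0%N; rewrite /P ugrid0.
have PN k : P k -> (k <= N.+1)%N by move=> /andP[/ltnW].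
case: (ex_maxnP P0 PN) => k /andP[kN kt] kmax; exists k => //; rewrite kt /=.
have [kN'|kN'] := ltnP k.+1 N.+1; last first.
  by have -> : k.+1 = N.+1; [apply/eqP; rewrite eqn_leq kN|rewrite ugridn].
have : ~~ P k.+1 by apply/negP => /kmax; rewrite ltnn.
by rewrite /P kN' /= -ltNge => /ltW.
Qed.

Lemma sum_rad_small e : 0 < e -> exists N0, forall N, (N0 <= N)%N ->
  \sum_(0 <= k < N.+1) rad N.+1 k ^+ 2 <= e.
Proof.
move=> e0; have [N0 NP] := ugrid_pw_small om_ctrl th1 e0; exists N0 => N NN.
have := NP N.+1 0 1 (leqW NN) (lexx 0) ler01 (lexx 1); apply: le_trans.
rewrite big_nat [leRHS]big_nat; apply: ler_sum => k /andP[_ kN].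
by rewrite !clamp_ugrid ?(ltnW kN)// /rad expr2 (half_powR om th1).
Qed.

Lemma curve_sub_cover N : curve `<=` curve_cover N.
Proof.
move=> z [t /andP[t0 t1] <-]; have [k kN /andP[kt tk]] := ugrid_locate N t0 t1.
rewrite /curve_cover -bigcup_mkord; exists k => //.
have /andP[k0 _] := ugrid01 R (ltnW kN); have /andP[_ k1] := ugrid01 R kN.
have r_le : om (ugrid R N.+1 k) t `^ (th / 2) <= rad N.+1 k.
  exact: (half_powR_sub om_ctrl th1).
have := le_trans (x_lip k0 kt t1) r_le; have := le_trans (y_lip k0 kt t1) r_le.
rewrite !ler_norml => /andP[h1 h2] /andP[h3 h4].
rewrite /curve_box /x /y in h1 h2 h3 h4 *; split; rewrite /= in_itv /=; apply/andP; split.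
- by move: h3; lra.
- by move: h4; lra.
- by move: h1; lra.
- by move: h2; lra.
Qed.

(** The squared distance from [z] to the curve attains its minimum, which is at most twice the
    squared half-side of a box containing [z]. *)
Lemma cover_sub_curve z : (forall N, curve_cover N z) -> curve z.
Proof.
move=> zc; pose w t := dot (G t - z) (G t - z).
have wc : {within `[0, 1], continuous w}.
  apply/continuous01P; have c1 := continuous01_fst G_cont; have c2 := continuous01_snd G_cont.
  by apply: continuous01D; apply: continuous01M; apply: continuous01D (continuous01_cst _).
have [t0 t0I t0_min] := EVT_min ler01 wc.
exists t0; first by move: t0I; rewrite in_itv.
suff w0 : w t0 <= 0.
  apply/eqP; rewrite -subr_eq0; apply/negPn/negP => /enorm_gt0 e0.
  by move: w0; rewrite leNgt /w -enorm_sqr exprn_gt0.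
apply/ler_addgt0Pl => e e0; rewrite addr0.
have e20 : 0 < e / 2 by rewrite divr_gt0.
have [N /(_ _ (leqnn _)) small] := sum_rad_small e20.
have := zc N; rewrite /curve_cover -bigcup_mkord => -[k /= kN].
have /andP[k0 _] := ugrid01 R (ltnW kN); have /andP[_ k1] := ugrid01 R kN.
have rs : rad N.+1 k ^+ 2 <= e / 2.
  apply: le_trans small; rewrite big_mkord (bigD1 (Ordinal kN))//= lerDl.
  by apply: sumr_ge0 => i _; exact: sqr_ge0.
have r0 : 0 <= rad N.+1 k by exact: powR_ge0.
move=> [/=]; rewrite !in_itv /= => /andP[h1 h2] /andP[h3 h4].
apply: le_trans (t0_min (ugrid R N.+1 k) _) _.
  by rewrite in_itv /= k0 (le_trans (ugrid_mono R N.+1 (leqnSn k))).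
have sq (a b r : R) : 0 <= r -> a - r <= b -> b <= a + r -> (a - b) ^+ 2 <= r ^+ 2.
  move=> r00 ab1 ab2; rewrite -[leLHS]real_normK ?num_real// ler_pXn2r ?nnegrE//.
  by rewrite ler_norml; lra.
have := sq _ _ _ r0 h1 h2; have := sq _ _ _ r0 h3 h4.
by rewrite /w /dot /= -!expr2; move: rs; lra.
Qed.

Lemma measurable_curve_box N k : measurable (curve_box N k).
Proof. by apply: measurableX; exact: measurable_itv. Qed.

Lemma measurable_curve_cover N : measurable (curve_cover N).
Proof. by apply: bigsetU_measurable => k _; exact: measurable_curve_box. Qed.

Lemma measurable_curve : measurable curve.
Proof.
have -> : curve = \bigcap_N curve_cover N.
  apply/seteqP; split=> [z zc N _|z zc]; first exact: curve_sub_cover.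
  by apply: cover_sub_curve => N; exact: zc.
by apply: bigcapT_measurable => N; exact: measurable_curve_cover.
Qed.

Lemma measure_curve_box N k : mu (curve_box N k) = (4 * rad N k ^+ 2)%:E.
Proof.
have itvE (a r : R) : 0 <= r -> leb `[a - r, a + r]%classic = (2 * r)%:E.
  move=> r0; rewrite lebesgue_measure_itv /= lte_fin.
  have [ar|ar] := ltP (a - r) (a + r); first by rewrite -EFinB; congr EFin; ring.
  by congr EFin; move: ar; lra.
rewrite /curve_box product_measure1E; try exact: measurable_itv.
transitivity ((2 * rad N k)%:E * (2 * rad N k)%:E)%E.
  by congr (_ * _)%E; apply: itvE; exact: powR_ge0.
by rewrite -EFinM; congr EFin; ring.
Qed.

Lemma measure_curve : mu curve = 0%E.
Proof.
apply/eqP; rewrite eq_le measure_ge0 andbT; apply/lee_addgt0Pr => e e0; rewrite add0e.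
have e40 : 0 < e / 4 by rewrite divr_gt0.
have [N /(_ _ (leqnn _)) small] := sum_rad_small e40.
have := @content_subadditive _ _ _ mu curve (curve_box N.+1) N.+1
  (fun k _ => measurable_curve_box N.+1 k) measurable_curve (@curve_sub_cover N).
move/le_trans; apply; rewrite (eq_bigr (fun k : 'I_N.+1 => (4 * rad N.+1 k ^+ 2)%:E)); last first.
  by move=> k _; exact: measure_curve_box.
rewrite sumEFin lee_fin -big_distrr /=; move: small; rewrite big_mkord; lra.
Qed.

Let eta z := winding_number G z.

Let G01 : G 0 = G 1. Proof. by rewrite G0 G1. Qed.

Lemma winding_number_stair z : ~ curve z -> exists N0, forall N, (N0 <= N)%N ->
  W N.+1 z = eta z.
Proof.
move=> nz; have [|N0 NP] := winding_number_wstep G01 G_cont (z := z).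
  by move=> t t0 t1 Gt; apply: nz; exists t; rewrite ?t0.
exists N0 => N NN; rewrite /W stair_sum_wstep//; exact: NP (leqW NN).
Qed.

Lemma winding_number_curve z : curve z -> eta z = 0.
Proof. by move=> [t /andP[t0 t1] Gt]; exact: winding_number_on_curve Gt. Qed.

Lemma eventually_cst_cvg (T : topologicalType) (v : nat -> T) (l : T) N :
  (forall n, (N <= n)%N -> v n = l) -> v @ \oo --> l.
Proof. by move=> h; apply: cvg_near_cst; exists N. Qed.

(** The value 0 chosen on the curve makes [eta] an everywhere pointwise limit of staircases
    multiplied by the indicator of the complement. *)
Lemma measurable_winding_number : measurable_fun [set: RR] eta.
Proof.
apply: (@measurable_fun_cvg _ _ _ _ (fun N z => W N.+1 z * \1_(~` curve) z)).
  move=> N; apply: measurable_funM; first exact: measurable_stair_sum.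
  by apply: measurable_indic; apply: measurableC; exact: measurable_curve.
move=> z _; have [zc|nz] := pselect (curve z).
  apply: (@eventually_cst_cvg _ _ _ 0%N) => n _.
  by rewrite winding_number_curve// indicE memNset ?mulr0//; apply.
have [N0 NP] := winding_number_stair nz.
apply: (@eventually_cst_cvg _ _ _ N0) => n Nn.
by rewrite NP// indicE mem_set// mulr1.
Qed.

(** Fatou's lemma along the multiples of [N.+1], for which the refinement bound is uniform. The
    integral is taken in the extended reals, so the integrability of [eta] is a consequence. *)
Lemma Rintegral_winding_stair N :
  (\int[mu]_z `|eta z - W N.+1 z|%:E <= (sewing_cst th * \sum_(0 <= k < N.+1)
     om (clamp 0 1 (ugrid R N.+1 k)) (clamp 0 1 (ugrid R N.+1 k.+1)) `^ th)%:E)%E.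
Proof.
set B := sewing_cst th * _.
pose f M z := (`|W (N.+1 * M.+1) z - W N.+1 z|%:E)%E.
have mW n : measurable_fun [set: RR] (W n) by exact: measurable_stair_sum.
have mf M : measurable_fun [set: RR] (f M).
  by apply/measurable_EFinP; apply: measurableT_comp => //; exact: measurable_funB.
have mcurve := measurable_curve.
have fB M : (\int[mu]_(z in ~` curve) f M z <= B%:E)%E.
  have I : mu.-integrable setT (EFin \o (fun z => W (N.+1 * M.+1) z - W N.+1 z)).
    exact: (integrableB measurableT (integrable_stair_sum _ _) (integrable_stair_sum _ _)).
  have fin := integrable_fin_num measurableT (integrable_norm I).
  apply: (@le_trans _ _ (\int[mu]_z f M z)%E).
    by apply: ge0_subset_integral => //; [exact: measurableC|move=> z _; rewrite lee_fin].
  rewrite -[leLHS](fineK fin) lee_fin.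
  exact: (Rintegral_stair_refine om_ctrl th1 x_lip y_lip N M).
have mD : measurable_fun [set: RR] (fun z => `|eta z - W N.+1 z|%:E).
  apply/measurable_EFinP; apply: measurableT_comp => //.
  by apply: measurable_funB => //; exact: measurable_winding_number.
rewrite (ge0_negligible_integral mcurve measurableT mD); last 2 first.
- by move=> z _; rewrite lee_fin.
- exact: measure_curve.
rewrite setTD.
have -> : (\int[mu]_(z in ~` curve) `|eta z - W N.+1 z|%:E)%E =
   (\int[mu]_(z in ~` curve) limn_einf (fun M => f M z))%E.
  apply: eq_integral => z /set_mem nz; symmetry.
  have [N0 NP] := winding_number_stair nz.
  apply: (cvg_limn_einf_sup _).1; apply: (@eventually_cst_cvg _ _ _ N0) => n Nn.
  rewrite /f (_ : (N.+1 * n.+1 = (N.+1 * n.+1).-1.+1)%N)// NP//; nia.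
apply: (@le_trans _ _ (limn_einf (fun M => \int[mu]_(z in ~` curve) f M z))%E).
  apply: fatou => [|M|M z _]; first exact: measurableC.
    exact: measurable_funTS.
  by rewrite lee_fin.
rewrite limn_einf_lim; apply: lime_le; first exact: is_cvg_einfs.
by apply: nearW => n; apply: le_trans (ereal_inf_lbound _) (fB n); exists n => /=.
Qed.

End green.

(** * Moments of the winding number *)

Section moments.
Variables (R : realType) (om : R -> R -> R) (th : R) (G : R -> R * R).
Hypothesis om_ctrl : control om.
Hypothesis th1 : 1 < th.
Hypothesis G_cont : {within `[0, 1], continuous G}.
Hypothesis G0 : G 0 = 0.
Hypothesis G1 : G 1 = 0.
Hypothesis x_lip : forall s t, 0 <= s -> s <= t -> t <= 1 ->
  `|(G t).1 - (G s).1| <= om s t `^ (th / 2).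
Hypothesis y_lip : forall s t, 0 <= s -> s <= t -> t <= 1 ->
  `|(G t).2 - (G s).2| <= om s t `^ (th / 2).
Local Notation leb := (@lebesgue_measure R).
Local Notation mu := (leb \x leb)%E.
Local Notation RR := (measurableTypeR R * measurableTypeR R)%type.
Implicit Types (s t u e : R) (z : R * R).

Let W := stair_sum G.
Let eta z := winding_number G z.
Let L := om 0 1 `^ (th / 2).

Let L0 : 0 <= L. Proof. exact: powR_ge0. Qed.

Let inbox z := (`|z.1| <= L) && (`|z.2| <= L).

Lemma curve_bounded t : 0 <= t -> t <= 1 -> inbox (G t).
Proof.
move=> t0 t1; have h : om 0 t `^ (th / 2) <= L by exact: (half_powR_sub om_ctrl th1).
rewrite /inbox -[X in `|X.1|]subr0 -[X in `|X.2|]subr0 -G0.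
by apply/andP; split; apply: le_trans h; [exact: x_lip|exact: y_lip].
Qed.

Lemma step_outside cl a b v : `|a| <= L -> `|b| <= L -> L < `|v| -> step cl a b v = 0.
Proof.
move=> aL bL vL; have C c : `|c| <= L -> (v \in Interval -oo%O (BSide cl c)) = (v < 0).
  rewrite ler_norml in_itv /= => /andP[c1 c2]; have [v0|v0] := ltP v 0.
    by rewrite ltr0_norm // in vL; case: (cl) => /=; [apply: lt_le_trans c1; lra|apply: ltW; lra].
  rewrite ger0_norm // in vL; apply/negbTE.
  by case: (cl) => /=; [rewrite -leNgt; lra|rewrite -ltNge; lra].
by rewrite /step !C// subrr.
Qed.

Lemma stair_sum_outside N z : ~~ inbox z -> W N z = 0.
Proof.
move=> nz; rewrite /W /stair_sum /usum big1_seq// => k _.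
have [c1 c2] : 0 <= clamp 0 1 (ugrid R N k) /\ clamp 0 1 (ugrid R N k) <= 1.
  by apply/andP; exact: clamp_01.
have [d1 d2] : 0 <= clamp 0 1 (ugrid R N k.+1) /\ clamp 0 1 (ugrid R N k.+1) <= 1.
  by apply/andP; exact: clamp_01.
have /andP[k1 k2] := curve_bounded c1 c2; have /andP[l1 l2] := curve_bounded d1 d2.
move: nz; rewrite /inbox negb_and -!ltNge => /orP[h|h]; rewrite /stair /rect.
  by rewrite step_outside ?normr0// mul0r.
by rewrite [X in _ * X]step_outside// mulr0.
Qed.

Lemma winding_number_outside z : ~~ inbox z -> eta z = 0.
Proof.
move=> nz; have [zc|nc] := pselect (curve G z).
  exact: winding_number_curve.
rewrite /eta; have [N0 /(_ _ (leqnn _)) <-] := winding_number_stair G_cont G0 G1 nc.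
exact: stair_sum_outside.
Qed.

Lemma measurable_winding : measurable_fun [set: RR] eta.
Proof. exact: (measurable_winding_number om_ctrl th1 G_cont G0 G1 x_lip y_lip). Qed.

Lemma integrable_winding_stair N : mu.-integrable setT (EFin \o (fun z => eta z - W N.+1 z)).
Proof.
apply/integrableP; split.
  apply/measurable_EFinP; apply: measurable_funB; first exact: measurable_winding.
  exact: measurable_stair_sum.
have := Rintegral_winding_stair om_ctrl th1 G_cont G0 G1 x_lip y_lip N.
by move/le_lt_trans; apply; exact: ltry.
Qed.

Lemma integrable_winding : mu.-integrable setT (EFin \o eta).
Proof.
have := integrableD measurableT (integrable_winding_stair 0) (integrable_stair_sum G 1).
by apply: eq_integrable => // z _; rewrite /= -EFinD subrK.
Qed.

Section moment.
Variables n k : nat.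

Let mom z : R := z.1 ^+ n * z.2 ^+ k.
(** The monomial cut off outside a box where both [eta] and the staircases live: it is bounded, so
    L^1 convergence passes to the moments. *)
Let phi z : R := if inbox z then mom z else 0.

Let measurable_phi : measurable_fun [set: RR] phi.
Proof.
have m1 : measurable_fun [set: RR] (fun z => z.1 : R) by exact: measurable_fst.
have m2 : measurable_fun [set: RR] (fun z => z.2 : R) by exact: measurable_snd.
apply: measurable_fun_ifT => //.
  apply: measurable_and; apply: measurable_fun_ler => //; exact: measurableT_comp.
by apply: measurable_funM; apply: measurable_funX.
Qed.

Let phi_bounded z : `|phi z| <= L ^+ n * L ^+ k.
Proof.
rewrite /phi; case: ifPn => [/andP[z1 z2]|_]; last first.
  by rewrite normr0 mulr_ge0 ?exprn_ge0.
by rewrite /mom normrM !normrX ler_pM ?exprn_ge0// ?lerXn2r ?nnegrE.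
Qed.

Let phi_eta z : phi z * eta z = mom z * eta z.
Proof. by rewrite /phi; case: ifPn => // /winding_number_outside ->; rewrite !mulr0. Qed.

Let phi_W N z : phi z * W N z = mom z * W N z.
Proof. by rewrite /phi; case: ifPn => // /stair_sum_outside ->; rewrite !mulr0. Qed.

Lemma integrable_moment : mu.-integrable setT (EFin \o (fun z => mom z * eta z)).
Proof.
have := integrable_bounded_mul measurable_phi phi_bounded integrable_winding.
by apply: eq_integrable => // z _; rewrite /= phi_eta.
Qed.

(** The moment of one stair, computed exactly on its rectangle; it is the germ of the Young integral
    of [x^(n+1)/(n+1)] against [y^(k+1)/(k+1)]. *)
Definition moment_germ s t : R := (G s).1 ^+ n.+1 / n.+1%:R *
  (((G t).2 ^+ k.+1 - (G s).2 ^+ k.+1) / k.+1%:R).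

Lemma Rintegral_moment_stair N :
  \int[mu]_z (mom z * W N z) = usum moment_germ N 0 1.
Proof.
rewrite /W /stair_sum /usum; under eq_Rintegral do rewrite big_distrr.
rewrite Rintegral_sum => [|j]; last exact: integrable_moment_rect.
apply: eq_bigr => j _; rewrite /mom /stair Rintegral_moment_rect.
by rewrite expr0n subr0.
Qed.

Lemma moment_winding_approx e : 0 < e -> exists N0, forall N, (N0 <= N)%N ->
  `|\int[mu]_z (mom z * eta z) - usum moment_germ N.+1 0 1| <= e.
Proof.
move=> e0; pose C := L ^+ n * L ^+ k; pose K := sewing_cst th.
have C0 : 0 <= C by rewrite mulr_ge0 ?exprn_ge0.
have K0 : 0 <= K by exact: sewing_cst_ge0.
have D0 : 0 < C * K + 1 by rewrite ltr_wpDl// mulr_ge0.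
have e'0 : 0 < e / (C * K + 1) by rewrite divr_gt0.
have [N0 NP] := ugrid_pw_small om_ctrl th1 e'0; exists N0 => N NN.
have small := NP N.+1 0 1 (leqW NN) (lexx 0) ler01 (lexx 1).
have IW := integrable_winding_stair N.
have phiD : \int[mu]_z (phi z * (eta z - W N.+1 z)) =
    \int[mu]_z (mom z * eta z) - usum moment_germ N.+1 0 1.
  rewrite -Rintegral_moment_stair -RintegralB//.
  - by apply: eq_Rintegral => z _; rewrite mulrBr phi_eta phi_W.
  - exact: integrable_moment.
  - have := integrable_bounded_mul measurable_phi phi_bounded (integrable_stair_sum G N.+1).
    by apply: eq_integrable => // z _; rewrite /= -phi_W.
rewrite -phiD; apply: le_trans (normr_Rintegral_bounded_mul measurable_phi phi_bounded IW) _.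
have R1 : \int[mu]_z `|eta z - W N.+1 z| <= K * (e / (C * K + 1)).
  have := Rintegral_winding_stair om_ctrl th1 G_cont G0 G1 x_lip y_lip N.
  have fin := integrable_fin_num measurableT (integrable_norm IW).
  rewrite -[X in (X <= _)%E -> _](fineK fin) lee_fin => h.
  by apply: le_trans h _; exact: ler_wpM2l.
apply: le_trans (ler_wpM2l C0 R1) _.
rewrite (_ : C * (K * (e / (C * K + 1))) = C * K / (C * K + 1) * e); last by ring.
by rewrite ler_piMl ?(ltW e0)// ler_pdivrMr// mul1r lerDl.
Qed.

End moment.
End moments.

Lemma tlog_closed_signature (R : realType) (om : R -> R -> R) (th : R)
    (gamma : R -> R * R) (n k : nat) :
  control om -> 1 < th -> (forall i s t, 0 <= s -> s <= t -> t <= 1 ->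
    `|coordinate gamma i t - coordinate gamma i s| <= om s t `^ (th / 2)) ->
  gamma 0 = gamma 1 ->
  tlog (signature gamma) (nseq n.+1 e1 ++ nseq k.+1 e2) =
  signature gamma (nseq n.+1 e1 ++ nseq k.+1 e2).
Proof.
move=> om_ctrl th1 x_lip g01; apply: tlog_e1e2 => [i|i|].
- exact: (signature_nseq om_ctrl th1 x_lip g01).
- exact: (signature_nseq om_ctrl th1 x_lip g01).
- by [].
Qed.

Lemma signature_moment (R : realType) (om : R -> R -> R) (th : R)
    (gamma : R -> R * R) (n k : nat) :
  control om -> 1 < th -> (forall i s t, 0 <= s -> s <= t -> t <= 1 ->
    `|coordinate gamma i t - coordinate gamma i s| <= om s t `^ (th / 2)) ->
  gamma 0 = gamma 1 ->
  {within `[0, 1], continuous gamma} ->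
  let G := fun t => gamma t - gamma 0 in
  signature gamma (nseq n.+1 e1 ++ nseq k.+1 e2) =
  (-1) ^+ k * \int[(@lebesgue_measure R \x @lebesgue_measure R)%E]_z
     (z.1 ^+ n * z.2 ^+ k / (n`!%:R * k`!%:R) * winding_number G z).
Proof.
move=> om_ctrl th1 x_lip g01 gc G; pose x := coordinate gamma.
pose X i t := x i t - x i 0.
have XE1 t : X e1 t = (G t).1 by [].
have XE2 t : X e2 t = (G t).2 by [].
have lX i : om_lip om th (X i).
  exists 1 => // s t s0 st t1; rewrite mul1r /X opprB addrA subrK; exact: x_lip.
pose f t := X e1 t ^+ n.+1 / n.+1`!%:R.
have lf : om_lip om th f.
  by apply: (om_lipM om_ctrl th1); [apply: (om_lipX om_ctrl th1)|exact: om_lip_cst].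
have lfg : om_lip om th (fun t => f t * (X e2 t ^+ k / k`!%:R)).
  apply: (om_lipM om_ctrl th1) => //.
  by apply: (om_lipM om_ctrl th1); [apply: (om_lipX om_ctrl th1)|exact: om_lip_cst].
have [h h0 dh] := has_diff_exists om_ctrl th1 x_lip e2 lfg.
rewrite (signature_e1e2 om_ctrl th1 x_lip g01 h0 dh); congr (_ * _).
have dpow := has_diff_expX_fact om_ctrl th1 x_lip e2 k 1.
pose xi s t := f s * ((X e2 t ^+ k.+1 - X e2 s ^+ k.+1) / k.+1`!%:R).
have [B B0 fB] := om_lip_bounded om_ctrl th1 lf.
(* The moments produce increments of [y^(k+1)/(k+1)!], whereas [h] integrates [y^k/k! dy]; the two
   germs differ by a term of order [om ^ th], so they have the same limit. *)
have [D D0 xiD] : exists2 D, 0 <= D & forall s t, 0 <= s -> s <= t -> t <= 1 ->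
    `|xi s t - (h t - h s)| <= D * om s t `^ th.
  move: dh dpow => [C C0 hC] [C' C'0 hC']; exists (B * C' + C).
    by rewrite addr_ge0// mulr_ge0.
  move=> s t s0 st t1; have {}hC := hC s t s0 st t1; have {}hC' := hC' s t s0 st t1.
  rewrite sum_single !mul1r -/x -/(X e2 t) -/(X e2 s) in hC'; rewrite sum_single in hC.
  have fs := fB s s0 (le_trans st t1).
  pose q := X e2 t ^+ k.+1 / k.+1`!%:R - X e2 s ^+ k.+1 / k.+1`!%:R -
    X e2 s ^+ k / k`!%:R * (x e2 t - x e2 s).
  rewrite (_ : xi s t - (h t - h s) = f s * q -
    (h t - h s - f s * (X e2 s ^+ k / k`!%:R) * (x e2 t - x e2 s))); last by rewrite /xi /q; ring.
  apply: le_trans (ler_normB _ _) _; rewrite mulrDl; apply: lerD => //.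
  by rewrite normrM -mulrA; apply: ler_pM.
have Gcont : {within `[0, 1], continuous G}.
  by move=> t; apply: cvgB; [exact: gc|exact: cvg_cst].
have G0 : G 0 = 0 by rewrite /G subrr.
have G1 : G 1 = 0 by rewrite /G -g01 subrr.
have xl s t : 0 <= s -> s <= t -> t <= 1 -> `|(G t).1 - (G s).1| <= om s t `^ (th / 2).
  by move=> s0 st t1; rewrite -!XE1 /X opprB addrA subrK; exact: x_lip.
have yl s t : 0 <= s -> s <= t -> t <= 1 -> `|(G t).2 - (G s).2| <= om s t `^ (th / 2).
  by move=> s0 st t1; rewrite -!XE2 /X opprB addrA subrK; exact: x_lip.
pose c : R := (n`!%:R * k`!%:R)^-1.
have nf m : (m`!%:R : R) != 0 by rewrite pnatr_eq0 -lt0n fact_gt0.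
have ns m : (m.+1%:R : R) != 0 by rewrite pnatr_eq0.
have xiE s t : xi s t = c * moment_germ G n k s t.
  rewrite /xi /moment_germ /f XE1 !XE2 /c !factS !natrM.
  move: (nf n) (nf k) (ns n) (ns k).
  move: (n`!%:R : R) (k`!%:R : R) (n.+1%:R : R) (k.+1%:R : R) => a b a' b' a0 b0 a'0 b'0.
  by field; rewrite a0 b0 a'0 b'0.
have -> : \int[(@lebesgue_measure R \x @lebesgue_measure R)%E]_z
     (z.1 ^+ n * z.2 ^+ k / (n`!%:R * k`!%:R) * winding_number G z) =
  c * \int[(@lebesgue_measure R \x @lebesgue_measure R)%E]_z
     (z.1 ^+ n * z.2 ^+ k * winding_number G z).
  rewrite -RintegralZl//; last exact: (integrable_moment om_ctrl th1 Gcont G0 G1 xl yl).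
  by apply: eq_Rintegral => z _; rewrite -/c mulrAC mulrC.
have c0 : 0 < c by rewrite invr_gt0 mulr_gt0// ltr0n fact_gt0.
apply/eqP; rewrite -subr_eq0 -normr_le0; apply/ler_addgt0Pl => e e0; rewrite addr0.
have ec : 0 < e / 2 / c by rewrite !divr_gt0.
have D1 : 0 < D + 1 by rewrite ltr_wpDl.
have eD : 0 < e / 2 / (D + 1) by rewrite !divr_gt0.
have [N1 P1] := moment_winding_approx om_ctrl th1 Gcont G0 G1 xl yl n k ec.
have [N2 P2] := ugrid_pw_small om_ctrl th1 eD.
pose N := maxn N1 N2.
have {}P1 := P1 N (leq_maxl _ _).
have {}P2 := P2 N.+1 0 1 (leqW (leq_maxr _ _)) (lexx 0) ler01 (lexx 1).
set I := Rintegral _ _ _ in P1 *.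
have uE : usum xi N.+1 0 1 = c * usum (moment_germ G n k) N.+1 0 1.
  by rewrite /usum big_distrr; apply: eq_bigr => j _; rewrite xiE.
have {}P1 : `|c * I - usum xi N.+1 0 1| <= e / 2.
  rewrite uE -mulrBr normrM gtr0_norm//.
  by apply: le_trans (ler_wpM2l (ltW c0) P1) _; rewrite mulrC divfK// gt_eqF.
have {}P2 : `|usum xi N.+1 0 1 - h 1| <= e / 2.
  have hE : h 1 = \sum_(0 <= j < N.+1) (h (clamp 0 1 (ugrid R N.+1 j.+1)) - h (clamp 0 1 (ugrid R N.+1 j))).
    rewrite (telescope_sumr (fun j => h (clamp 0 1 (ugrid R N.+1 j))))//.
    by rewrite ugridn ugrid0 clampr// clampl// h0 subr0.
  rewrite hE /usum -sumrB; apply: le_trans (ler_norm_sum _ _ _) _.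
  apply: (@le_trans _ _ (\sum_(0 <= j < N.+1) D * om (clamp 0 1 (ugrid R N.+1 j)) (clamp 0 1 (ugrid R N.+1 j.+1)) `^ th)).
    apply: ler_sum => j _; apply: xiD.
    - by case/andP: (clamp_01 (ugrid R N.+1 j) (lexx 0) ler01 (lexx 1)).
    - by apply: clamp_mono; exact: ugrid_mono.
    - by case/andP: (clamp_01 (ugrid R N.+1 j.+1) (lexx 0) ler01 (lexx 1)).
  rewrite -big_distrr /=; apply: le_trans (_ : (D + 1) * (e / 2 / (D + 1)) <= _); last first.
    by rewrite mulrC divfK// gt_eqF.
  by apply: ler_pM => //; [apply: sumr_ge0 => j _; exact: powR_ge0|rewrite lerDl].
rewrite (_ : h 1 - c * I = - (c * I - usum xi N.+1 0 1) - (usum xi N.+1 0 1 - h 1)); last by ring.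
by apply: le_trans (ler_normB _ _) _; rewrite normrN; move: P1 P2; lra.
Qed.

Theorem theorem1 (R : realType) (p : R) (gamma : R -> R * R)
  (hp : 1 <= p < 2)
  (hcont : {within `[0, 1], continuous gamma})
  (hclosed : gamma 0 = gamma 1)
  (hvar : finite_pvariation p gamma) :
  (forall n k : nat, (1 <= n)%N -> (1 <= k)%N ->
     lyndon (nseq n e1 ++ nseq k e2)) /\
  (forall n k N : nat, (n + k + 2 <= N)%N ->
     let mu := (@lebesgue_measure R \x @lebesgue_measure R)%E in
     let moment := fun z : R * R =>
       z.1 ^+ n * z.2 ^+ k / (n`!%:R * k`!%:R)
       * winding_number (fun t => gamma t - gamma 0) z in
     mu.-integrable [set: _] (EFin \o moment) /\
     lyndon_coef N (ttrunc N (tlog (signature gamma)))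
       (nseq n.+1 e1 ++ nseq k.+1 e2)
       ((-1) ^+ k * \int[mu]_(z in [set: _]) moment z)).
Proof.
split; first exact: lyndon_e1e2.
move=> n k N nkN mu moment.
have om_ctrl := pvar_controlP hp hcont hvar; have th1 := pvar_theta hp.
have en := enorm_pvar_control hp hvar.
have x_lip i s t : 0 <= s -> s <= t -> t <= 1 ->
    `|coordinate gamma i t - coordinate gamma i s| <=
    pvar_control p gamma s t `^ (2 / ((p + 2) / 2) / 2).
  move=> s0 st t1; apply: le_trans (en s t s0 st t1); rewrite /coordinate.
  by case: ifP => _; [exact: (enorm_ge1 (gamma t - gamma s))|exact: (enorm_ge2 (gamma t - gamma s))].
have gl := grouplike_signature om_ctrl th1 x_lip.
split; last first.
  rewrite -(signature_moment n k om_ctrl th1 x_lip hclosed hcont).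
  rewrite -(tlog_closed_signature n k om_ctrl th1 x_lip hclosed).
  by apply: lyndon_coef_e1e2 => //; exact: primitive_log.
have Gcont : {within `[0, 1], continuous (fun t => gamma t - gamma 0)}.
  by move=> t; apply: cvgB; [exact: hcont|exact: cvg_cst].
pose G t := gamma t - gamma 0.
have xl s t : 0 <= s -> s <= t -> t <= 1 ->
    `|(G t).1 - (G s).1| <= pvar_control p gamma s t `^ (2 / ((p + 2) / 2) / 2).
  move=> s0 st t1; rewrite /G /= opprB addrA subrK.
  exact: le_trans (enorm_ge1 (gamma t - gamma s)) (en s t s0 st t1).
have yl s t : 0 <= s -> s <= t -> t <= 1 ->
    `|(G t).2 - (G s).2| <= pvar_control p gamma s t `^ (2 / ((p + 2) / 2) / 2).
  move=> s0 st t1; rewrite /G /= opprB addrA subrK.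
  exact: le_trans (enorm_ge2 (gamma t - gamma s)) (en s t s0 st t1).
have G0 : G 0 = 0 by rewrite /G subrr.
have G1 : G 1 = 0 by rewrite /G -hclosed subrr.
have I := integrable_moment om_ctrl th1 Gcont G0 G1 xl yl n k.
have := integrableZl measurableT (n`!%:R * k`!%:R)^-1 I.
by apply: eq_integrable => // z _; rewrite /= /moment -EFinM; congr EFin; rewrite mulrA [_^-1 * _]mulrC.
Qed.
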